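(* Let $1\leq p<\infty$ and let $\Sigma=\partial\Omega$ be a sphere centered at $x^0$. Then the system of pairs $$\left\{\left(p_k\cdot\nu,\ Tp_k-(Tp_k\cdot\nu)\nu\right)\right\}_{k=0,1,2,\ldots}$$ is complete in the subspace $\widetilde V^p$ of $L^p(\Sigma)\times[L^p(\Sigma)]^3_0$ defined by $$\widetilde V^p=\left\{(f,F)\in L^p(\Sigma)\times[L^p(\Sigma)]^3_0\ :\ \int_\Sigma F\cdot(b\wedge(x-x^0))\,d\sigma=0\quad\forall\, b\in\mathbb R^3\right\},$$ i.e. the linear span of the system is contained in $\widetilde V^p$ and is dense in $\widetilde V^p$ with respect to the $L^p$ norm.
   Context: $\Omega\subset\mathbb R^3$ is a bounded domain such that $\mathbb R^3\setminus\Omega$ is connected, with boundary $\Sigma$ (here a sphere, so $\Omega$ is a ball); $\nu$ is the outward unit normal to $\Sigma$, and $L^p(\Sigma)$ is taken with respect to surface measure $d\sigma$. $\lambda,\mu$ are real constants (Lamé constants) with $\mu>0$, $3\lambda+2\mu>0$. The elasticity operator is $Eu=\mu\Delta u+(\lambda+\mu)\nabla\operatorname{div}u$ for $u=(u_1,u_2,u_3)$, and the stress operator on $\Sigma$ is $Tu=2\mu\frac{\partial u}{\partial\nu}+\lambda(\operatorname{div}u)\nu+\mu(\nu\wedge\operatorname{curl}u)$, where $\wedge$ is the vector product. $\{p_k\}_{k\ge 0}$ is the system of polynomial vector solutions of $Eu=0$ obtained as follows: for each $k\ge0$ let $\omega_{ks}(x)=|x|^kY_{ks}(x/|x|)$,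 $s=1,\ldots,2k+1$, be a basis of the homogeneous harmonic polynomials of degree $k$ ($Y_{ks}$ spherical harmonics), let $\Lambda_k=-\frac{\lambda+\mu}{2(\lambda(k-1)+\mu(3k-2))}$, and let $e_1,e_2,e_3$ be the standard basis; the vectors $\omega_{ks}e_j+\Lambda_k|x|^2\nabla(\partial_j\omega_{ks})$ ($j=1,2,3$; $s=1,\ldots,2k+1$; $k=0,1,\ldots$), ordered in one sequence, are the $p_k$. Every polynomial vector solution of $Eu=0$ is a finite linear combination of the $p_k$. $[L^p(\Sigma)]^3_0=\{F\in[L^p(\Sigma)]^3 : F\cdot\nu=0 \text{ a.e. on }\Sigma\}$. *)

(* Defs.v *)
From HB Require Import structures.
From mathcomp Require Import all_boot all_order all_algebra.
From mathcomp Require Import all_classical all_reals all_analysis.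
From mathcomp Require Import measurable_realfun.
(* mpoly is imported only in one section below: some of its names and notations
   clash with those of mathcomp-analysis. *)
From mathcomp Require mpoly.
Set Implicit Arguments.
Unset Strict Implicit.
Unset Printing Implicit Defensive.
Import Order.TTheory GRing.Theory Num.Theory.
Import numFieldNormedType.Exports.
Local Open Scope classical_set_scope.
Local Open Scope ring_scope.

Section vectors.
Context {R : realType}.
Implicit Types (u v : 'rV[R]_3) (a b c : R).

Definition vec3 a b c : 'rV[R]_3 := \row_(i < 3) [:: a; b; c]`_i.

Definition dot u v : R := \sum_(i < 3) u 0 i * v 0 i.

Definition cross u v : 'rV[R]_3 :=
  let u_ k := u 0 (inord k) in let v_ k := v 0 (inord k) in
  vec3 (u_ 1%N * v_ 2%N - u_ 2%N * v_ 1%N)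
       (u_ 2%N * v_ 0%N - u_ 0%N * v_ 2%N)
       (u_ 0%N * v_ 1%N - u_ 1%N * v_ 0%N).

End vectors.

Section differential_operators.
Context {R : realType}.
Implicit Types (f : 'rV[R]_3 -> R) (u nu : 'rV[R]_3 -> 'rV[R]_3).

Definition partial (i : 'I_3) f (x : 'rV[R]_3) : R := 'D_(delta_mx 0 i) f x.

Definition grad f (x : 'rV[R]_3) : 'rV[R]_3 := \row_i partial i f x.

Definition laplacian f (x : 'rV[R]_3) : R := \sum_(i < 3) partial i (partial i f) x.

Definition div u (x : 'rV[R]_3) : R :=
  \sum_(i < 3) partial i (fun y => u y 0 i) x.

Definition curl u (x : 'rV[R]_3) : 'rV[R]_3 :=
  let d i j := partial (inord i) (fun y => u y 0 (inord j)) x in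
  vec3 (d 1%N 2%N - d 2%N 1%N) (d 2%N 0%N - d 0%N 2%N) (d 0%N 1%N - d 1%N 0%N).

(* lam, mu are the Lame constants and nu is the unit normal field. *)
Definition stress (lam mu : R) nu u (x : 'rV[R]_3) : 'rV[R]_3 :=
  (2 * mu) *: 'D_(nu x) u x + (lam * div u x) *: nu x
  + mu *: cross (nu x) (curl u x).

End differential_operators.

Section homogeneous_polynomials.
Import -(notations) mpoly.
Context {R : realType}.

Definition homogeneous_polynomial (k : nat) (f : 'rV[R]_3 -> R) : Prop :=
  exists2 P : mpoly 3 R,
    P \is ishomog1 k mdeg &
    forall x, f x = meval (fun i => x 0 i) P.

End homogeneous_polynomials.

Section elastic_polynomials.
Context {R : realType}.

Definition harmonic_polynomial (k : nat) (f : 'rV[R]_3 -> R) : Prop :=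
  homogeneous_polynomial k f /\ forall x, laplacian f x = 0.

(* By homogeneity, each member of such a basis satisfies
   w s x = |x|^k * Y_ks (x / |x|), where Y_ks is its restriction to the unit
   sphere. *)
Definition harmonic_basis (k : nat) (w : 'I_(2 * k + 1)%N -> 'rV[R]_3 -> R) : Prop :=
  [/\ forall s, harmonic_polynomial k (w s),
      forall c : 'I_(2 * k + 1)%N -> R,
        (forall x, \sum_s c s * w s x = 0) -> forall s, c s = 0
    & forall f, harmonic_polynomial k f ->
        exists c : 'I_(2 * k + 1)%N -> R, forall x, f x = \sum_s c s * w s x].

(* k - 1 and 3k - 2 are computed in R, so they are negative for k = 0. *)
Definition Lambda (lam mu : R) (k : nat) : R :=
  - ((lam + mu) / (2 * (lam * (k%:R - 1) + mu * (3 * k%:R - 2)))).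

Definition elastic_polynomial (lam mu : R) (k : nat) (w : 'rV[R]_3 -> R) (j : 'I_3)
    (x : 'rV[R]_3) : 'rV[R]_3 :=
  w x *: delta_mx 0 j + (Lambda lam mu k * dot x x) *: grad (partial j w) x.

Definition elastic_index : Type := {k : nat & ('I_(2 * k + 1)%N * 'I_3)%type}.

Definition elastic_system (lam mu : R)
    (w : forall k : nat, 'I_(2 * k + 1)%N -> 'rV[R]_3 -> R)
    (e : nat -> elastic_index) (n : nat) : 'rV[R]_3 -> 'rV[R]_3 :=
  let: existT k (s, j) := e n in elastic_polynomial lam mu k (w k s) j.

End elastic_polynomials.

Arguments harmonic_basis {R} k w.

(* R^3 with its Borel sigma-algebra *)
Definition borel3 (R : realType) : Type := g_sigma_algebraType (@open 'rV[R]_3).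
HB.instance Definition _ (R : realType) := Measurable.on (borel3 R).

Section surface_measure.
Context {R : realType}.
Local Open Scope ereal_scope.

Lemma measurable_borel3 d (T : measurableType d) (f : T -> 'rV[R]_3) :
  (forall i, measurable_fun setT (fun t => f t 0%R i)) ->
  measurable_fun setT (f : T -> borel3 R).
Proof.
move=> mf; apply: (@measurability _ _ T (borel3 R) setT f (@open 'rV[R]_3)) => //.
move=> _ [U oU <-]; rewrite setTI.
pose box (cn : 'rV[rat]_3 * nat) : set 'rV[R]_3 :=
  ball (map_mx ratr cn.1 : 'rV[R]_3) cn.2.+1%:R^-1%R.
have -> : U = \bigcup_(cn in [set cn | box cn `<=` U]) box cn.
  apply/seteqP; split => [x Ux|x [cn /= + bx]]; last exact.
  have : nbhs x U by exact: open_nbhs_nbhs.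
  move=> /nbhs_ballP[e/= e0 xeU].
  have [n ne] : exists n, (n.+1%:R^-1 < e / 2 :> R)%R.
    have e20 : (0 < e / 2)%R by rewrite divr_gt0.
    exists (Num.truncn (e / 2)^-1).
    by rewrite invf_plt ?posrE// truncnS_gt.
  have rat_near i : exists q : rat, ball (x 0%R i) n.+1%:R^-1%R (ratr q : R).
    have [|q] := @rat_in_itvoo R (x 0%R i) (x 0%R i + n.+1%:R^-1)%R.
      by rewrite ltrDl invr_gt0.
    rewrite in_itv/= => /andP[q1 q2]; exists q.
    rewrite -ball_normE/= distrC ger0_norm ?subr_ge0 ?ltW//.
    by rewrite ltrBlDl.
  have [c xc] := choice rat_near.
  have cE i j : ball (x i j) n.+1%:R^-1%R ((map_mx ratr (\row_k c k) : 'rV[R]_3) i j).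
    by rewrite !mxE ord1; exact: xc.
  have cx : ball x n.+1%:R^-1%R (map_mx ratr (\row_k c k) : 'rV[R]_3).
    by split; rewrite ?invr_gt0.
  exists (\row_k c k, n) => /=; last exact: ball_sym.
  move=> y /= cy; apply: xeU; apply: le_ball (ball_triangle cx cy).
  by rewrite [leRHS]splitr lerD// ltW.
rewrite preimage_bigcup bigcup_mkcond.
apply: countable_bigcupT_measurable => [|cn]; first exact: countableP.
case: ifPn => // _.
have -> : f @^-1` box cn =
    \bigcap_(i in [set: 'I_3])
      (fun t => f t 0%R i) @^-1` ball (ratr (cn.1 0%R i) : R) cn.2.+1%:R^-1%R.
  apply/seteqP; split => [t bt i _|t bt].
    by have := bt.2 0%R i; rewrite mxE.
  by split=> [|i j]; rewrite ?invr_gt0 ?mxE ?ord1//; exact: bt.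
apply: fin_bigcap_measurable => // i _.
rewrite -[X in measurable X]setTI; apply: mf => //.
exact: measurable_ball.
Qed.

Definition spherical (x0 : 'rV[R]_3) (r : R) (t : R * R) : borel3 R :=
  (x0 + r *: vec3 (sin t.1 * cos t.2) (sin t.1 * sin t.2) (cos t.1))%R.

Lemma measurable_spherical x0 r : measurable_fun setT (spherical x0 r).
Proof.
have msin1 : measurable_fun setT (fun t : R * R => sin t.1).
  apply: measurableT_comp => //; apply: continuous_measurable_fun; exact: continuous_sin.
have mcos1 : measurable_fun setT (fun t : R * R => cos t.1).
  apply: measurableT_comp => //; apply: continuous_measurable_fun; exact: continuous_cos.
have msin2 : measurable_fun setT (fun t : R * R => sin t.2).
  apply: measurableT_comp => //; apply: continuous_measurable_fun; exact: continuous_sin.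
have mcos2 : measurable_fun setT (fun t : R * R => cos t.2).
  apply: measurableT_comp => //; apply: continuous_measurable_fun; exact: continuous_cos.
apply: measurable_borel3 => i; under eq_fun do rewrite !mxE.
apply: measurable_funD => //; apply: measurable_funM => //.
by case: i => -[|[|[|//]]] ? //=; exact: measurable_funM.
Qed.

Definition angles : set (R * R) := `[0%R, pi] `*` `[0%R, (2 * pi)%R].

(* r ^ 2 * sin theta is the area element of the parametrization, namely the
   norm of the cross product of its partial derivatives in theta and phi. *)
Definition sphere_area (x0 : 'rV[R]_3) (r : R) (A : set (borel3 R)) : \bar R :=
  \int[lebesgue_measure \x lebesgue_measure]_(t in angles `&` spherical x0 r @^-1` A)
    (r ^+ 2 * sin t.1)%:E.

Lemma measurable_angles : measurable angles.
Proof. exact: measurableX. Qed.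

Lemma angles_sin_ge0 t : angles t -> (0 <= sin t.1)%R.
Proof.
by move=> [/= + _]; rewrite in_itv/= => ?; exact: sin_ge0_pi.
Qed.

Let measurable_dom x0 r A : measurable A ->
  measurable (angles `&` spherical x0 r @^-1` A).
Proof.
move=> mA; apply: measurableI; first exact: measurable_angles.
by rewrite -[X in measurable X]setTI; exact: measurable_spherical.
Qed.

Let sphere_area0 x0 r : sphere_area x0 r set0 = 0.
Proof. by rewrite /sphere_area preimage_set0 setI0 integral_set0. Qed.

Let sphere_area_ge0 x0 r A : 0 <= sphere_area x0 r A.
Proof.
apply: integral_ge0 => t [/angles_sin_ge0 t0 _].
by rewrite lee_fin mulr_ge0// sqr_ge0.
Qed.

Let sphere_area_sigma_additive x0 r : semi_sigma_additive (sphere_area x0 r).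
Proof.
move=> F mF tF mUF; rewrite /sphere_area preimage_bigcup setI_bigcupr.
rewrite ge0_integral_bigcup.
- apply: is_cvg_ereal_nneg_natsum_cond => n _ _; exact: sphere_area_ge0.
- by move=> n; exact: measurable_dom.
- apply/measurable_EFinP/measurable_funTS/measurable_funM => //.
  apply: measurableT_comp => //; apply: continuous_measurable_fun; exact: continuous_sin.
- by move=> t [n _ [/angles_sin_ge0 t0 _]]; rewrite lee_fin mulr_ge0// sqr_ge0.
- apply/trivIsetP => i j _ _ ij; rewrite setIACA setIid -preimage_setI.
  by move/trivIsetP : tF => /(_ _ _ I I ij) ->; rewrite preimage_set0 setI0.
Qed.

HB.instance Definition _ x0 r := isMeasure.Build _ _ _ (sphere_area x0 r)
  (sphere_area0 x0 r) (sphere_area_ge0 x0 r) (@sphere_area_sigma_additive x0 r).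

End surface_measure.

Section boundary_data.
Context {R : realType}.
Variables (x0 : 'rV[R]_3) (r : R).

Definition sphere_normal (x : 'rV[R]_3) : 'rV[R]_3 := r^-1 *: (x - x0).

Definition normal_part (u : 'rV[R]_3 -> 'rV[R]_3) (x : 'rV[R]_3) : R :=
  dot (u x) (sphere_normal x).

Definition tangential_stress (lam mu : R) (u : 'rV[R]_3 -> 'rV[R]_3)
    (x : 'rV[R]_3) : 'rV[R]_3 :=
  let Tu := stress lam mu sphere_normal u x in
  Tu - dot Tu (sphere_normal x) *: sphere_normal x.

(* Functions on the sphere are represented by Borel functions on R^3, considered
   up to equality almost everywhere for sphere_area, which is concentrated on
   the sphere. *)
Definition compatible_data (p : R) (f : borel3 R -> R) (F : borel3 R -> 'rV[R]_3) : Prop :=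
  [/\ f \in Lfun (sphere_area x0 r) p%:E,
      forall i, (fun x => F x 0 i) \in Lfun (sphere_area x0 r) p%:E,
      {ae sphere_area x0 r, forall x, dot (F x) (sphere_normal x) = 0}
    & forall b : 'rV[R]_3,
        (\int[sphere_area x0 r]_x (dot (F x) (cross b (x - x0)%R))%:E = 0)%E].

Definition data_norm (p : R) (f : borel3 R -> R) (F : borel3 R -> 'rV[R]_3) : \bar R :=
  ('N[sphere_area x0 r]_(p%:E) [EFin \o f]
   + \sum_(i < 3) 'N[sphere_area x0 r]_(p%:E) [EFin \o (fun x => F x 0%R i)])%E.

End boundary_data.

(* Main.v *)
(* Translate the centre of the sphere to the origin and let |x| = r there. For h
   harmonic and homogeneous of degree n the three fields
     grad h,    x /\ grad h,    h x + c |x|^2 grad h   (c depending on n)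
   solve E u = 0, and their data (u . nu, tangential part of T u) are explicit
   combinations of h and of the tangential parts of grad h and x /\ grad h; the
   first and the third field are related to their data by a 2 x 2 system which is
   invertible for n >= 1, and the second one has nonzero data unless n = 1. On
   the sphere every polynomial is a sum of harmonic ones and every polynomial
   vector field is, up to a radial part, a sum of fields grad h and x /\ grad h, so
   every pair of polynomial data is attained up to a rotation b /\ x. For F
   orthogonal to the rotations, b is controlled by the distance of F to its
   polynomial approximation, and polynomials are dense in L^p of the sphere.
   Conversely the data of a solution are orthogonal to the rotations because the
   integral over the sphere annihilates x_i d_j P - x_j d_i P for every
   polynomial P. Finally, each polynomial solution splits into homogeneous ones,
   and a homogeneous one is determined by its harmonic part, which yields its
   expansion in the given system. *)

Require Import Defs.
From HB Require Import structures.
From mathcomp Require Import all_boot all_order all_algebra.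
From mathcomp Require Import finmap.
From mathcomp Require Import all_classical all_reals all_analysis.
From mathcomp Require Import measurable_realfun.
From mathcomp Require Import ring lra.
From mathcomp Require mpoly.
Set Implicit Arguments.
Unset Strict Implicit.
Unset Printing Implicit Defensive.
Import Order.TTheory GRing.Theory Num.Theory.
Import numFieldNormedType.Exports.
Local Open Scope classical_set_scope.
Local Open Scope ring_scope.

(** * Polynomial vector calculus *)

(** Algebra and analysis are kept apart. Facts about solutions and their data are identities in a
    differential polynomial algebra, proved by expansion in coordinates. Of the surface integral
    only linearity, dependence on the values on the sphere, positivity on 1 and invariance under
    infinitesimal rotations are used; the last one stands in for the divergence theorem. The
    obstacle is that a polynomial approximation G of F need not be orthogonal to the rotations, so
    its data are attained only up to some b /\ x. Pairing with this same rotation decides the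
    matter: the stress of the solution contributes 0, hence the integral of G . (b /\ x) is that of
    |b /\ x|^2, a fixed positive multiple of |b|^2. As F contributes 0 too, |b|^2 is at most a
    multiple of |b| times the L^1 distance from F to G. The condition 3 lam + 2 mu > 0 enters
    through signs: it keeps the denominator of [Lambda] and the determinant of the 2 x 2 system away
    from 0. *)

Definition ax (k : nat) : 'I_3 := inord k.
Local Notation o0 := (ax 0).
Local Notation o1 := (ax 1).
Local Notation o2 := (ax 2).

(** Used as [elim/axP]: a vector identity becomes three scalar ones, within reach of [ring]. *)
Lemma axP (T : 'I_3 -> Prop) : T o0 -> T o1 -> T o2 -> forall i, T i.
Proof.
move=> t0 t1 t2 i; rewrite -(inord_val i).
by case: i => -[|[|[|//]]] ? /=.
Qed.

Lemma sum_ax (V : nmodType) (F : 'I_3 -> V) : \sum_i F i = F o0 + F o1 + F o2.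
Proof.
rewrite !big_ord_recr big_ord0/= add0r; congr (F _ + F _ + F _);
by apply/val_inj; rewrite /= inordK.
Qed.

Lemma axE (m n : nat) : (m < 3)%N -> (n < 3)%N -> (ax m == ax n) = (m == n).
Proof. by move=> m3 n3; rewrite -(inj_eq val_inj)/= !inordK. Qed.

(* An axiomatization of R[x_0, x_1, x_2]; its model is mpolyAlg below. *)
Record polyAlg (R : realFieldType) := PolyAlg {
  pcar :> comAlgType R;
  dd : 'I_3 -> pcar -> pcar;
  xx : 'I_3 -> pcar;
  peval : ('I_3 -> R) -> pcar -> R;
  ddD : forall i p q, dd i (p + q) = dd i p + dd i q;
  ddZ : forall i c p, dd i (c *: p) = c *: dd i p;
  ddM : forall i p q, dd i (p * q) = dd i p * q + p * dd i q;
  dd_comm : forall i j p, dd i (dd j p) = dd j (dd i p);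
  dd_xx : forall i j, dd i (xx j) = (i == j)%:R;
  pevalD : forall v p q, peval v (p + q) = peval v p + peval v q;
  pevalZ : forall v c p, peval v (c *: p) = c * peval v p;
  pevalM : forall v p q, peval v (p * q) = peval v p * peval v q;
  peval1 : forall v, peval v 1 = 1;
  peval_xx : forall v i, peval v (xx i) = v i;
  palg_ind : forall T : pcar -> Prop, T 1 ->
    (forall p q, T p -> T q -> T (p + q)) -> (forall c p, T p -> T (c *: p)) ->
    (forall i p, T p -> T (xx i * p)) -> forall p, T p
}.

Arguments dd {R _} i p.
Arguments xx {R _} i.
Arguments peval {R _} v p.

Section poly_calculus.
Context {R : realFieldType} {D : polyAlg R}.
Implicit Types (P Q h : D) (u v w : 'I_3 -> D) (i j k : 'I_3) (c : R) (z : 'I_3 -> R).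
Local Notation x := (@xx R D).

Lemma ddN i P : dd i (- P) = - dd i P.
Proof. by rewrite -(scaleN1r P) ddZ scaleN1r. Qed.
Lemma ddB i P Q : dd i (P - Q) = dd i P - dd i Q.
Proof. by rewrite ddD ddN. Qed.
Lemma dd0 i : dd i (0 : D) = 0.
Proof. by have := ddZ i 0 (0 : D); rewrite !scale0r. Qed.
Lemma dd1 i : dd i (1 : D) = 0.
Proof.
have := ddM i (1 : D) 1; rewrite !(mulr1, mul1r) => /eqP.
by rewrite -subr_eq0 opprD addNKr oppr_eq0 => /eqP.
Qed.
Lemma dd_nat i n : dd i (n%:R : D) = 0.
Proof. by elim: n => [|n IH]; rewrite ?dd0// -natr1 ddD IH dd1 addr0. Qed.
Lemma dd_sum i (I : Type) (r : seq I) (T : pred I) (F : I -> D) :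
  dd i (\sum_(a <- r | T a) F a) = \sum_(a <- r | T a) dd i (F a).
Proof. by apply: (big_morph (dd i)); [exact: ddD|exact: dd0]. Qed.

Lemma pevalN z P : peval z (- P) = - peval z P :> R.
Proof. by rewrite -(scaleN1r P) pevalZ mulN1r. Qed.
Lemma pevalB z P Q : peval z (P - Q) = peval z P - peval z Q :> R.
Proof. by rewrite pevalD pevalN. Qed.
Lemma peval0 z : peval z (0 : D) = 0 :> R.
Proof. by have := pevalZ z 0 (0 : D); rewrite scale0r mul0r. Qed.
Lemma peval_sum z (I : Type) (r : seq I) (T : pred I) (F : I -> D) :
  peval z (\sum_(a <- r | T a) F a) = \sum_(a <- r | T a) peval z (F a) :> R.
Proof. by apply: (big_morph (peval z)); [exact: pevalD|exact: peval0]. Qed.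

Definition euler P : D := \sum_i x i * dd i P.
Definition lap P : D := \sum_i dd i (dd i P).
Definition pdiv u : D := \sum_i dd i (u i).
Definition pdot u v : D := \sum_i u i * v i.
Definition rho : D := \sum_i x i * x i.
Definition pcross u v : 'I_3 -> D := fun i =>
  nth 0 [:: u o1 * v o2 - u o2 * v o1; u o2 * v o0 - u o0 * v o2;
            u o0 * v o1 - u o1 * v o0] i.
Definition pgrad P : 'I_3 -> D := fun i => dd i P.
Definition pcurl u : 'I_3 -> D := fun i =>
  nth 0 [:: dd o1 (u o2) - dd o2 (u o1); dd o2 (u o0) - dd o0 (u o2);
            dd o0 (u o1) - dd o1 (u o0)] i.

Lemma pcross0 u v : pcross u v o0 = u o1 * v o2 - u o2 * v o1.
Proof. by rewrite /pcross inordK. Qed.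
Lemma pcross1 u v : pcross u v o1 = u o2 * v o0 - u o0 * v o2.
Proof. by rewrite /pcross inordK. Qed.
Lemma pcross2 u v : pcross u v o2 = u o0 * v o1 - u o1 * v o0.
Proof. by rewrite /pcross inordK. Qed.
Lemma pcurl0 u : pcurl u o0 = dd o1 (u o2) - dd o2 (u o1).
Proof. by rewrite /pcurl inordK. Qed.
Lemma pcurl1 u : pcurl u o1 = dd o2 (u o0) - dd o0 (u o2).
Proof. by rewrite /pcurl inordK. Qed.
Lemma pcurl2 u : pcurl u o2 = dd o0 (u o1) - dd o1 (u o0).
Proof. by rewrite /pcurl inordK. Qed.
Definition pcrossE := (pcross0, pcross1, pcross2, pcurl0, pcurl1, pcurl2).

Lemma ddxE : ((dd o0 (x o0) = 1) * (dd o0 (x o1) = 0) * (dd o0 (x o2) = 0) *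
  (dd o1 (x o0) = 0) * (dd o1 (x o1) = 1) * (dd o1 (x o2) = 0) *
  (dd o2 (x o0) = 0) * (dd o2 (x o1) = 0) * (dd o2 (x o2) = 1))%type.
Proof. by rewrite !dd_xx !axE. Qed.

(** Oriented instances of [dd_comm], so that rewriting sorts iterated derivatives and terminates. *)
Lemma comm10 P : dd o1 (dd o0 P) = dd o0 (dd o1 P). Proof. exact: dd_comm. Qed.
Lemma comm20 P : dd o2 (dd o0 P) = dd o0 (dd o2 P). Proof. exact: dd_comm. Qed.
Lemma comm21 P : dd o2 (dd o1 P) = dd o1 (dd o2 P). Proof. exact: dd_comm. Qed.
Definition ddE := (ddM, ddD, ddB, ddN, ddZ, dd1, dd0, ddxE, comm10, comm20, comm21).

(** [ring] handles products but not scaling, so [sclrE] turns each scaling into a product by a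
    constant polynomial. *)
Definition scl c : D := c%:A.
Lemma sclE c P : c *: P = scl c * P.
Proof. by rewrite mulr_algl. Qed.
Lemma sclD a b : scl (a + b) = scl a + scl b. Proof. exact: scalerDl. Qed.
Lemma sclB a b : scl (a - b) = scl a - scl b. Proof. exact: scalerBl. Qed.
Lemma sclN a : scl (- a) = - scl a. Proof. exact: scaleNr. Qed.
Lemma sclM a b : scl (a * b) = scl a * scl b.
Proof. by rewrite /scl mulr_algl scalerA. Qed.
Lemma scl1 : scl 1 = 1. Proof. exact: scale1r. Qed.
Lemma scl0 : scl 0 = 0. Proof. exact: scale0r. Qed.
Lemma scl_nat n : scl n%:R = n%:R. Proof. exact: scaler_nat. Qed.
Definition sclrE := (sclE, sclD, sclB, sclN, sclM, scl1, scl0, scl_nat).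

End poly_calculus.

Ltac pexp := rewrite /lap /euler /pdiv /rho /pdot /pgrad ?sum_ax ?pcrossE ?ddE.
Ltac pring := pexp; rewrite ?sclrE; ring.

Section poly_identities.
Context {R : realFieldType} {D : polyAlg R}.
Implicit Types (P Q h : D) (u v w : 'I_3 -> D) (i j k : 'I_3) (c : R) (z : 'I_3 -> R).
Local Notation x := (@xx R D).

Lemma lap_xx i h : lap (x i * h) = 2 * dd i h + x i * lap h.
Proof. elim/axP : i; pring. Qed.

Lemma lap_rho h : lap (rho * h) = 6 * h + 4 * euler h + rho * lap h.
Proof. pring. Qed.

Lemma lapD P Q : lap (P + Q) = lap P + lap Q. Proof. pring. Qed.
Lemma lapB P Q : lap (P - Q) = lap P - lap Q. Proof. pring. Qed.
Lemma lapZ c P : lap (c *: P) = c *: lap P. Proof. pring. Qed.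
Lemma lap0 : lap (0 : D) = 0. Proof. pring. Qed.
Lemma lap_dd i P : lap (dd i P) = dd i (lap P). Proof. elim/axP : i; pring. Qed.
Lemma eulerD P Q : euler (P + Q) = euler P + euler Q. Proof. pring. Qed.
Lemma eulerZ c P : euler (c *: P) = c *: euler P. Proof. pring. Qed.
Lemma euler0 : euler (0 : D) = 0. Proof. pring. Qed.
Lemma eulerM P Q : euler (P * Q) = euler P * Q + P * euler Q. Proof. pring. Qed.
Lemma euler_xx i : euler (x i) = x i. Proof. elim/axP : i; pring. Qed.
Lemma euler_rho : euler (rho : D) = 2 * rho. Proof. pring. Qed.
Lemma euler_dd i P : euler (dd i P) = dd i (euler P) - dd i P.
Proof. elim/axP : i; pring. Qed.
Lemma euler_sum (I : Type) (r : seq I) (T : pred I) (F : I -> D) :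
  euler (\sum_(a <- r | T a) F a) = \sum_(a <- r | T a) euler (F a).
Proof. by apply: (big_morph euler); [exact: eulerD|exact: euler0]. Qed.
Lemma lap_sum (I : Type) (r : seq I) (T : pred I) (F : I -> D) :
  lap (\sum_(a <- r | T a) F a) = \sum_(a <- r | T a) lap (F a).
Proof. by apply: (big_morph lap); [exact: lapD|exact: lap0]. Qed.

(* Euler's identity: P is homogeneous of degree c. The degree is a scalar, so that
   dd lowers it by one also in degree 0. *)
Definition wt c P := euler P = c *: P.
Definition harm c h := wt c h /\ lap h = 0.

Lemma wt0 c : wt c (0 : D). Proof. by rewrite /wt euler0 scaler0. Qed.
Lemma wtD c P Q : wt c P -> wt c Q -> wt c (P + Q).
Proof. by rewrite /wt eulerD => -> ->; rewrite scalerDr. Qed.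
Lemma wtZ c a P : wt c P -> wt c (a *: P).
Proof. by rewrite /wt eulerZ => ->; rewrite !scalerA mulrC. Qed.
Lemma wtB c P Q : wt c P -> wt c Q -> wt c (P - Q).
Proof. by move=> wP wQ; rewrite -(scaleN1r Q); exact: wtD wP (wtZ _ wQ). Qed.
Lemma wtM a b P Q : wt a P -> wt b Q -> wt (a + b) (P * Q).
Proof. by rewrite /wt eulerM => -> ->; rewrite -scalerAl -scalerAr scalerDl. Qed.
Lemma wt_xx i : wt 1 (x i). Proof. by rewrite /wt euler_xx scale1r. Qed.
Lemma wt_rho : wt 2 (rho : D).
Proof. by rewrite /wt euler_rho sclE scl_nat. Qed.
Lemma wt_dd c i P : wt c P -> wt (c - 1) (dd i P).
Proof. by rewrite /wt euler_dd => ->; rewrite ddZ scalerBl scale1r. Qed.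
Lemma wt1 : wt 0 (1 : D). Proof. by rewrite /wt scale0r /euler big1// => i _; rewrite dd1 mulr0. Qed.

Lemma harm0 c : harm c (0 : D). Proof. by split; [exact: wt0|exact: lap0]. Qed.
Lemma harmD c P Q : harm c P -> harm c Q -> harm c (P + Q).
Proof. by move=> [wP lP] [wQ lQ]; split; [exact: wtD|rewrite lapD lP lQ addr0]. Qed.
Lemma harmZ c a P : harm c P -> harm c (a *: P).
Proof. by move=> [wP lP]; split; [exact: wtZ|rewrite lapZ lP scaler0]. Qed.
Lemma harmB c P Q : harm c P -> harm c Q -> harm c (P - Q).
Proof. by move=> hP hQ; rewrite -(scaleN1r Q); exact: harmD hP (harmZ _ hQ). Qed.
Lemma harm_dd c i P : harm c P -> harm (c - 1) (dd i P).
Proof. by move=> [wP lP]; split; [exact: wt_dd|rewrite lap_dd lP dd0]. Qed.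

(* On the sphere, x_i h is thus a sum of harmonic polynomials of degrees c + 1
   and c - 1. *)
Lemma harm_raise c h i : harm c h -> 2 * c + 1 != 0 ->
  harm (c + 1) (x i * h - (2 * c + 1)^-1 *: (rho * dd i h)).
Proof.
move=> [wh lh] c0; split.
  apply: wtB; first by rewrite addrC; exact: wtM (wt_xx i) wh.
  apply: wtZ; have -> : c + 1 = 2 + (c - 1) by ring.
  exact: wtM wt_rho (wt_dd _ wh).
rewrite lapB lapZ lap_xx lap_rho lap_dd lh dd0 !mulr0 !addr0 (wt_dd i wh).
have -> : 6 * dd i h + 4 * ((c - 1) *: dd i h) = (2 * (2 * c + 1)) *: dd i h.
  rewrite !sclrE; ring.
by rewrite scalerA mulrCA mulVf// mulr1 sclE scl_nat subrr.
Qed.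

Lemma eq_pcross u v u' v' : u =1 u' -> v =1 v' -> pcross u v =1 pcross u' v'.
Proof. by move=> uu' vv' i; rewrite /pcross !uu' !vv'. Qed.
Lemma pcrossDr u v w i : pcross u (fun j => v j + w j) i = pcross u v i + pcross u w i.
Proof. elim/axP : i; pring. Qed.
Lemma pcrossZr u c v i : pcross u (fun j => c *: v j) i = c *: pcross u v i.
Proof. elim/axP : i; pring. Qed.

Lemma grad_pdot v i : dd i (pdot x v) = v i + euler (v i) + pcross x (pcurl v) i.
Proof. elim/axP : i; pring. Qed.
Lemma lap_pdot v : lap (pdot x v) = 2 * pdiv v + pdot x (fun i => lap (v i)).
Proof. pring. Qed.
Lemma pdiv_pcurl v : pdiv (pcurl v) = 0. Proof. pring. Qed.
Lemma pcurl_pgrad h i : pcurl (pgrad h) i = 0. Proof. elim/axP : i; pring. Qed.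
Lemma pcurl_pcurl v i : pcurl (pcurl v) i = dd i (pdiv v) - lap (v i).
Proof. elim/axP : i; pring. Qed.
Lemma double_pcross v i : pcross x (pcross x v) i = x i * pdot x v - rho * v i.
Proof. elim/axP : i; pring. Qed.

Lemma harm_pcurl c v i : (forall i, harm c (v i)) -> harm (c - 1) (pcurl v i).
Proof.
move=> hv; have B a b j k : harm (c - 1) (dd a (v j) - dd b (v k)).
  by apply: harmB; exact: harm_dd.
by elim/axP : i; rewrite pcrossE.
Qed.

Lemma harm_pdiv c v : (forall i, harm c (v i)) -> harm (c - 1) (pdiv v).
Proof. by move=> hv; rewrite /pdiv sum_ax; apply: harmD; first apply: harmD; exact: harm_dd. Qed.

Lemma wt_pdot c v : (forall i, wt c (v i)) -> wt (c + 1) (pdot x v).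
Proof.
move=> hv; rewrite /pdot sum_ax (addrC c 1).
by apply: wtD; first apply: wtD; apply: wtM => //; exact: wt_xx.
Qed.

Lemma lap_pdot_harm c v : (forall i, harm c (v i)) -> lap (pdot x v) = 2 * pdiv v.
Proof.
move=> hv; rewrite lap_pdot /pdot big1 ?addr0// => i _.
by case: (hv i) => _ ->; rewrite mulr0.
Qed.

(** The Laplacian of x . w is twice the divergence of w for harmonic w, and a curl has divergence
    0. *)
Lemma harm_pdot_pcurl c v : (forall i, harm c (v i)) -> harm c (pdot x (pcurl v)).
Proof.
move=> hv; have hc i := @harm_pcurl c v i hv; split.
  by rewrite -[c](subrK 1); apply: wt_pdot => i; case: (hc i).
by rewrite (lap_pdot_harm hc) pdiv_pcurl mulr0.
Qed.

(** Obtained by eliminating x /\ curl v between [grad_pdot] and [E] below. On the sphere and up to a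
    radial term, v is thus a sum of gradients and of a field x /\ grad q, as long as c (c + 1) is
    not 0. *)
Lemma vector_harmonic_decomposition c v i : (forall i, harm c (v i)) ->
  (c * (c + 1)) *: v i =
    c *: dd i (pdot x v) - pcross x (pgrad (pdot x (pcurl v))) i
    + (c - 1) *: (x i * pdiv v) - rho * dd i (pdiv v).
Proof.
move=> hv; have hc j := @harm_pcurl c v j hv.
(* This is [grad_pdot] applied to curl v, whose own curl is grad (div v) because v is harmonic. *)
have E : pcross x (pgrad (pdot x (pcurl v))) i =
    c *: pcross x (pcurl v) i + (c - 1) *: (x i * pdiv v) - rho * dd i (pdiv v).
  rewrite (@eq_pcross x _ x (fun j => c *: pcurl v j + pcross x (pgrad (pdiv v)) j))//.
    rewrite pcrossDr pcrossZr double_pcross -[pdot x _]/(euler _).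
    have [-> _] := harm_pdiv hv; rewrite -scalerAr addrA; congr (_ + _ - _).
  move=> j; rewrite /pgrad grad_pdot; case: (hc j) => -> _.
  rewrite -[X in X + _ *: _]scale1r -scalerDl (addrC 1) subrK; congr (_ + _).
  apply: eq_pcross => // k; rewrite pcurl_pcurl.
  by case: (hv k) => _ ->; rewrite subr0.
rewrite E grad_pdot; case: (hv i) => -> _; rewrite !sclrE; ring.
Qed.

(* |x|^2 times the tangential part of u. *)
Definition tang u : 'I_3 -> D := fun i => rho * u i - pdot x u * x i.

Lemma eq_tang u v : u =1 v -> tang u =1 tang v.
Proof.
move=> uv i; rewrite /tang uv; congr (_ - _ * _).
by apply: eq_bigr => j _; rewrite uv.
Qed.
Lemma tangD u v i : tang (fun j => u j + v j) i = tang u i + tang v i.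
Proof. rewrite /tang; elim/axP : i; pring. Qed.
Lemma tangB u v i : tang (fun j => u j - v j) i = tang u i - tang v i.
Proof. rewrite /tang; elim/axP : i; pring. Qed.
Lemma tangZ c u i : tang (fun j => c *: u j) i = c *: tang u i.
Proof. rewrite /tang; elim/axP : i; pring. Qed.
Lemma tangM P u i : tang (fun j => P * u j) i = P * tang u i.
Proof. rewrite /tang; elim/axP : i; pring. Qed.
Lemma tang_radial P i : tang (fun j => x j * P) i = 0.
Proof. rewrite /tang; elim/axP : i; pring. Qed.

Section elasticity.
Variables lam mu : R.

Definition Eop u : 'I_3 -> D := fun i => mu *: lap (u i) + (lam + mu) *: dd i (pdiv u).
(* r times the stress on the sphere |x| = r, where nu = x / r. *)
Definition pstress u : 'I_3 -> D := fun i =>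
  (2 * mu) *: euler (u i) + mu *: pcross x (pcurl u) i + lam *: (x i * pdiv u).
Definition sol u := forall i, Eop u i = 0.

Lemma EopD u v i : Eop (fun j => u j + v j) i = Eop u i + Eop v i.
Proof. rewrite /Eop; elim/axP : i; pring. Qed.
Lemma EopZ c u i : Eop (fun j => c *: u j) i = c *: Eop u i.
Proof. rewrite /Eop; elim/axP : i; pring. Qed.
Lemma pstressD u v i : pstress (fun j => u j + v j) i = pstress u i + pstress v i.
Proof. rewrite /pstress; elim/axP : i; pring. Qed.
Lemma pstressZ c u i : pstress (fun j => c *: u j) i = c *: pstress u i.
Proof. rewrite /pstress; elim/axP : i; pring. Qed.
Lemma solD u v : sol u -> sol v -> sol (fun j => u j + v j).
Proof. by move=> su sv i; rewrite EopD su sv addr0. Qed.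
Lemma solZ c u : sol u -> sol (fun j => c *: u j).
Proof. by move=> su i; rewrite EopZ su scaler0. Qed.
Lemma sol0 : sol (fun=> 0 : D).
Proof.
move=> i; rewrite /Eop lap0; have -> : pdiv (fun=> 0 : D) = 0.
  by rewrite /pdiv big1// => j _; rewrite dd0.
by rewrite dd0 !scaler0 addr0.
Qed.

Lemma pdiv_pgrad h : pdiv (pgrad h) = lap h. Proof. by []. Qed.

Lemma sol_pgrad n h : harm n h -> sol (pgrad h).
Proof. by move=> [_ lh] i; rewrite /Eop pdiv_pgrad lap_dd lh dd0 !scaler0 addr0. Qed.

Lemma pdiv_toroidal h : pdiv (pcross x (pgrad h)) = 0.
Proof. pring. Qed.

Lemma lap_toroidal h i : lap (pcross x (pgrad h) i) = pcross x (pgrad (lap h)) i.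
Proof. elim/axP : i; pring. Qed.

Lemma sol_toroidal n h : harm n h -> sol (pcross x (pgrad h)).
Proof.
move=> [_ lh] i; rewrite /Eop pdiv_toroidal lap_toroidal lh dd0 scaler0 addr0.
by elim/axP : i; pexp; rewrite !mulr0 subr0 scaler0.
Qed.

Definition spheroidal c h : 'I_3 -> D := fun i => x i * h + c *: (rho * dd i h).

Lemma pdiv_spheroidal c h :
  pdiv (spheroidal c h) = 3 * h + euler h + c *: (2 * euler h + rho * lap h).
Proof. rewrite /spheroidal; pring. Qed.

(** The operator sends this field to a multiple of grad h; the hypothesis on c is that the factor
    vanishes. *)
Lemma sol_spheroidal n c h : harm n h ->
  2 * mu + (lam + mu) * (n + 3) + c * (mu * (4 * n + 2) + (lam + mu) * (2 * n)) = 0 ->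
  sol (spheroidal c h).
Proof.
move=> [wh lh] cE i; have wi := wt_dd i wh.
rewrite /Eop pdiv_spheroidal /spheroidal lapD lapZ lap_xx lap_rho lap_dd lh wh wi.
rewrite !(ddE, dd_nat, mul0r, mulr0, add0r, addr0).
transitivity ((2 * mu + (lam + mu) * (n + 3)
    + c * (mu * (4 * n + 2) + (lam + mu) * (2 * n))) *: dd i h).
  rewrite !sclrE; ring.
by rewrite cE scale0r.
Qed.

Lemma pdot_pgrad h : pdot x (pgrad h) = euler h.
Proof. by []. Qed.

Lemma pstress_pgrad n h i : harm n h ->
  pstress (pgrad h) i = (2 * mu * (n - 1)) *: dd i h.
Proof.
move=> [wh lh]; rewrite /pstress pdiv_pgrad {1}/pgrad (wt_dd i wh) lh.
have -> : pcross x (pcurl (pgrad h)) i = 0.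
  by elim/axP : i; rewrite pcrossE !pcurl_pgrad !mulr0 subr0.
by rewrite mulr0 !scaler0 !addr0 scalerA.
Qed.

Lemma pdot_toroidal h : pdot x (pcross x (pgrad h)) = 0.
Proof. pring. Qed.

Lemma pcurl_toroidal h i :
  pcurl (pcross x (pgrad h)) i = x i * lap h - dd i (euler h) - dd i h.
Proof. elim/axP : i; pring. Qed.

Lemma wt_toroidal n h i : wt n h -> wt n (pcross x (pgrad h) i).
Proof.
move=> wh; rewrite -[n](subrK 1) (addrC _ 1).
have B a b j k : wt (1 + (n - 1)) (x a * dd b h - x j * dd k h).
  by apply: wtB; apply: wtM (wt_xx _) (wt_dd _ wh).
by elim/axP : i; rewrite pcrossE; exact: B.
Qed.

(** The factor is 2 mu n from the normal derivative minus mu (n + 1) from the curl. It vanishes for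
    n = 1, when the field is an infinitesimal rotation. *)
Lemma pstress_toroidal n h i : harm n h ->
  pstress (pcross x (pgrad h)) i = (mu * (n - 1)) *: pcross x (pgrad h) i.
Proof.
move=> [wh lh]; rewrite /pstress pdiv_toroidal mulr0 scaler0 addr0 (wt_toroidal i wh).
rewrite (@eq_pcross x (pcurl _) x (fun j => (- (n + 1)) *: pgrad h j))//.
  rewrite pcrossZr !sclrE. ring.
by move=> j; rewrite pcurl_toroidal lh wh /pgrad mulr0 ddZ !sclrE; ring.
Qed.

Lemma pdot_spheroidal n c h : wt n h ->
  pdot x (spheroidal c h) = (1 + c * n) *: (rho * h).
Proof.
move=> wh; transitivity (rho * h + c *: (rho * euler h)).
  rewrite /spheroidal; pring.
by rewrite wh !sclrE; ring.
Qed.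

Lemma pcurl_spheroidal c h i :
  pcurl (spheroidal c h) i = (2 * c - 1) *: pcross x (pgrad h) i.
Proof. rewrite /spheroidal; elim/axP : i; pring. Qed.

Lemma tang_pstress_spheroidal n c h i : harm n h ->
  tang (pstress (spheroidal c h)) i = (mu * (2 * n * c + 1)) *: (rho * tang (pgrad h) i).
Proof.
(* [Q] collects all that is radial in the stress, which [tang] removes. The remaining factor of
   |x|^2 grad h is 2 mu c (n + 1) - mu (2 c - 1). *)
move=> [wh lh]; pose Q := (2 * mu * (n + 1)) *: h + (mu * (2 * c - 1) * n) *: h +
  lam *: pdiv (spheroidal c h).
rewrite (@eq_tang _ (fun j => x j * Q + (mu * (2 * n * c + 1)) *: (rho * pgrad h j))).
  by rewrite tangD tang_radial add0r tangZ tangM.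
move=> j; rewrite /pstress (@eq_pcross x _ x (fun k => (2 * c - 1) *: pcross x (pgrad h) k))//.
  rewrite pcrossZr double_pcross pdot_pgrad wh {1}/spheroidal eulerD eulerZ.
  rewrite !eulerM euler_xx euler_rho wh (wt_dd j wh) /Q /pgrad !sclrE; ring.
by move=> k; exact: pcurl_spheroidal.
Qed.

End elasticity.
End poly_identities.

(** * Homogeneous components and spherical harmonics *)

Section homogeneous_components.
Context {R : realFieldType} {D : polyAlg R}.
Implicit Types (P Q h : D) (u v w : 'I_3 -> D) (i j : 'I_3) (k : nat) (c : R) (z : 'I_3 -> R).
Local Notation x := (@xx R D).

(** The equation is asked for all large M so that decompositions of different lengths can be added.
    The clause on [F 0%N] is what makes polynomials of degree 0 constant in [wt0_const]. *)
Lemma homog_components P : exists N (F : nat -> D),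
  [/\ forall k, wt k%:R (F k), exists c, F 0%N = c%:A &
      forall M, (N <= M)%N -> P = \sum_(k < M) F k].
Proof.
elim/palg_ind : P => [|P Q|c P|i P].
- exists 1%N, (fun k => (k == 0%N)%:R); split=> [[|k]||[//|M] _].
  + exact: wt1.
  + exact: wt0.
  + by exists 1; rewrite scale1r.
  + by rewrite big_ord_recl big1 ?addr0.
- move=> [N [F [wF [a aF] PF]]] [M [G [wG [b bG] QG]]].
  exists (maxn N M), (fun k => F k + G k); split=> [k||m].
  + exact: wtD.
  + by exists (a + b); rewrite scalerDl aF bG.
  + rewrite geq_max => /andP[Nm Mm].
    by rewrite (PF _ Nm) (QG _ Mm) big_split.
- move=> [N [F [wF [a aF] PF]]]; exists N, (fun k => c *: F k); split=> [k||m Nm].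
  + exact: wtZ.
  + by exists (c * a); rewrite aF scalerA.
  + by rewrite (PF _ Nm) scaler_sumr.
- move=> [N [F [wF _ PF]]]; exists N.+1, (fun k => if k is k'.+1 then x i * F k' else 0).
  split=> [[|k]||[//|m]].
  + exact: wt0.
  + by rewrite -natr1 addrC; apply: wtM (wt_xx i) (wF k).
  + by exists 0; rewrite scale0r.
  + by rewrite ltnS => Nm; rewrite big_ord_recl add0r (PF _ Nm) mulr_sumr.
Qed.

(** Eigenvectors of the Euler operator: subtracting the top eigenvalue kills the last term and
    multiplies the others by nonzero scalars. The shift [a] serves for E u, whose components have
    degrees k - 2. *)
Lemma wt_independent (a : R) N (F : nat -> D) : (forall k, wt (k%:R + a) (F k)) ->
  \sum_(k < N) F k = 0 -> forall k, (k < N)%N -> F k = 0.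
Proof.
elim: N F => [//|N IH] F wF F0.
have {}IH k : (k < N)%N -> F k = 0.
  move=> kN; have : (k%:R - N%:R) *: F k = 0.
    apply: (IH (fun k => (k%:R - N%:R) *: F k)) => // [m|]; first exact: wtZ.
    transitivity (euler (\sum_(k < N.+1) F k) - (N%:R + a) *: \sum_(k < N.+1) F k).
      rewrite euler_sum scaler_sumr -sumrB big_ord_recr/= wF subrr addr0.
      by apply: eq_bigr => m _; rewrite wF -scalerBl; congr (_ *: _); ring.
    by rewrite F0 euler0 scaler0 subrr.
  move=> /eqP; rewrite scaler_eq0 subr_eq0 eqr_nat => /orP[/eqP kE|/eqP//].
  by move: kN; rewrite kE ltnn.
move=> k; rewrite ltnS leq_eqVlt => /orP[/eqP ->|/IH//].
by rewrite -F0 big_ord_recr/= big1 ?add0r// => m _; exact: IH.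
Qed.

Lemma wt_spectrum (a : R) P N (F : nat -> D) : wt a P -> (forall k, wt k%:R (F k)) ->
  P = \sum_(k < N) F k -> forall k, (k < N)%N -> k%:R != a -> F k = 0.
Proof.
move=> wP wF PF k kN ka.
suff : (k%:R - a) *: F k = 0 by move/eqP; rewrite scaler_eq0 subr_eq0 (negPf ka) => /eqP.
apply: (@wt_independent 0 N (fun k => (k%:R - a) *: F k)) => // [m|].
  by rewrite addr0; exact: wtZ.
transitivity (euler P - a *: P); last by rewrite wP subrr.
rewrite PF euler_sum scaler_sumr -sumrB.
by apply: eq_bigr => m _; rewrite wF -scalerBl.
Qed.

(** Since [wt_dd] assigns the degree -1 to a derivative of a polynomial of degree 0, this is how
    such derivatives vanish. *)
Lemma wtN1_eq0 P : wt (-1) P -> P = 0.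
Proof.
move=> wP; have [N [F [wF _ PF]]] := homog_components P.
have E := PF _ (leqnn N); rewrite E big1// => k _.
apply: (wt_spectrum wP wF E) => //.
by rewrite eq_sym lt_eqF// (lt_le_trans (ltrN10 R)) ?ler0n.
Qed.

Lemma wt0_const P : wt 0 P -> exists c, P = c%:A.
Proof.
move=> wP; have [N [F [wF [c cF] PF]]] := homog_components P.
have E := PF _ (leqnSn N); exists c; rewrite E big_ord_recl cF big1 ?addr0// => k _.
by apply: (wt_spectrum wP wF E (ltn_ord (lift ord0 k))); rewrite pnatr_eq0.
Qed.

Lemma vector_homog_components u : exists N (U : nat -> 'I_3 -> D),
  (forall k i, wt k%:R (U k i)) /\ forall i, u i = \sum_(k < N) U k i.
Proof.
have /fin_all_exists2[N _] : forall i, exists2 N, True & exists F : nat -> D,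
    (forall k, wt k%:R (F k)) /\ forall M, (N <= M)%N -> u i = \sum_(k < M) F k.
  by move=> i; have [N [F [wF _ PF]]] := homog_components (u i); exists N => //; exists F.
move=> /fin_all_exists[F FE]; exists (\max_i N i), (fun k i => F i k).
split=> [k i|i]; first by case: (FE i).
by case: (FE i) => _; apply; exact: leq_bigmax.
Qed.

End homogeneous_components.

Section sphere.
Context {R : realFieldType} {D : polyAlg R}.
Implicit Types (P Q h : D) (u v w : 'I_3 -> D) (i j : 'I_3) (k : nat) (c : R) (z : 'I_3 -> R).
Local Notation x := (@xx R D).

(** Inductive, because what is proved of such sums is additive and goes by adding one harmonic term
    at a time. *)
Inductive harm_span : D -> Prop :=
| harm_span0 : harm_span 0
| harm_spanD (n : nat) h P : harm n%:R h -> harm_span P -> harm_span (h + P).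

Lemma harm_span_harm (n : nat) h : harm n%:R h -> harm_span h.
Proof. by move=> hh; rewrite -[h]addr0; apply: harm_spanD hh harm_span0. Qed.

Lemma harm_span_add P Q : harm_span P -> harm_span Q -> harm_span (P + Q).
Proof.
move=> + hQ; elim=> [|n h P' hh _ IH]; first by rewrite add0r.
by rewrite -addrA; exact: harm_spanD hh IH.
Qed.

Lemma harm_span_scale c P : harm_span P -> harm_span (c *: P).
Proof.
elim=> [|n h P' hh _ IH]; first by rewrite scaler0; exact: harm_span0.
by rewrite scalerDr; exact: harm_spanD (harmZ c hh) IH.
Qed.

Variable s : R.

(** Here [s] is the squared radius, so that the polynomial [rho] may be replaced by the scalar
    [s]. *)
Definition on_sphere P Q :=
  forall z, \sum_i z i * z i = s -> peval z P = peval z Q.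

Lemma on_sphere_sym P Q : on_sphere P Q -> on_sphere Q P.
Proof. by move=> PQ z zs; rewrite PQ. Qed.
Lemma on_sphere_trans P Q T : on_sphere P Q -> on_sphere Q T -> on_sphere P T.
Proof. by move=> PQ QT z zs; rewrite PQ// QT. Qed.
Lemma on_sphereD P Q P' Q' : on_sphere P Q -> on_sphere P' Q' -> on_sphere (P + P') (Q + Q').
Proof. by move=> PQ PQ' z zs; rewrite !pevalD PQ// PQ'. Qed.
Lemma on_sphereZ c P Q : on_sphere P Q -> on_sphere (c *: P) (c *: Q).
Proof. by move=> PQ z zs; rewrite !pevalZ PQ. Qed.
Lemma on_sphereM P Q P' Q' : on_sphere P Q -> on_sphere P' Q' -> on_sphere (P * P') (Q * Q').
Proof. by move=> PQ PQ' z zs; rewrite !pevalM PQ// PQ'. Qed.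
Lemma peval_rho z : peval z (rho : D) = \sum_i z i * z i.
Proof. by rewrite /rho peval_sum; apply: eq_bigr => i _; rewrite pevalM !peval_xx. Qed.
Lemma on_sphere_rho P : on_sphere (rho * P) (s *: P).
Proof. by move=> z zs; rewrite pevalM peval_rho zs pevalZ. Qed.

Lemma harm_span_mulx i P : harm_span P ->
  exists2 Q, harm_span Q & on_sphere (x i * P) Q.
Proof.
elim=> [|n h P' hh _ [Q hQ PQ]]; first by exists 0; [exact: harm_span0|rewrite mulr0].
have n0 : 2 * n%:R + 1 != 0 :> R by rewrite lt0r_neq0// ltr_wpDl// mulr_ge0.
have hr := harm_raise i hh n0.
(* The harmonic part of degree n + 1 comes from [harm_raise]; the subtracted term is added back with
   [rho] replaced by [s]. *)
exists ((x i * h - (2 * n%:R + 1)^-1 *: (rho * dd i h)) +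
        (((2 * n%:R + 1)^-1 * s) *: dd i h + Q)).
  apply: (@harm_spanD n.+1); first by rewrite -natr1.
  apply: harm_span_add hQ; apply: harm_span_scale.
  (* For n = 0 there is no natural degree n - 1, but then the derivative of h is 0. *)
  case: n {hr n0} hh => [|n] hh; last first.
    by apply: (@harm_span_harm n); have := harm_dd i hh; rewrite -natr1 addrK.
  rewrite (wtN1_eq0 (P := dd i h)); first exact: harm_span0.
  by rewrite -[-1]add0r; have [] := harm_dd i hh.
rewrite mulrDr addrA; apply: on_sphereD PQ => z zs.
rewrite pevalD pevalB !pevalZ (@on_sphere_rho (dd i h) z zs) pevalZ; ring.
Qed.

Lemma harm_span_sphere P : exists2 Q, harm_span Q & on_sphere P Q.
Proof.
elim/palg_ind : P => [|P Q [P' hP PP'] [Q' hQ QQ']|c P [P' hP PP']|i P [P' hP PP']].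
- exists 1 => //; apply: (@harm_span_harm 0); split; first exact: wt1.
  by rewrite /lap big1// => i _; rewrite dd1 dd0.
- by exists (P' + Q'); [exact: harm_span_add|exact: on_sphereD].
- by exists (c *: P'); [exact: harm_span_scale|exact: on_sphereZ].
- have [Q hQ PQ] := harm_span_mulx i hP; exists Q => //.
  by apply: on_sphere_trans PQ; exact: on_sphereM.
Qed.

End sphere.

(** * Polynomial solutions and their boundary values *)

Section elastic_solutions.
Context {R : realFieldType} {D : polyAlg R}.
Implicit Types (P Q h f : D) (u v w G : 'I_3 -> D) (i j : 'I_3) (k n : nat) (c : R)
  (z b : 'I_3 -> R).
Local Notation x := (@xx R D).
Variables lam mu : R.
Hypotheses (hmu : 0 < mu) (hlam : 0 < 3 * lam + 2 * mu).

(** The constant [Lambda] of the given system, for an arbitrary real field. *)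
Definition Lame_coef k : R :=
  - ((lam + mu) / (2 * (lam * (k%:R - 1) + mu * (3 * k%:R - 2)))).

Lemma Lame_coef_den k : lam * (k%:R - 1) + mu * (3 * k%:R - 2) != 0.
Proof.
case: k => [|k].
  by rewrite mulr0n lt_eqF//; move: hmu hlam => ? ?; lra.
have k0 : 0 <= k%:R :> R by [].
rewrite gt_eqF// -natr1.
have -> : lam * (k%:R + 1 - 1) + mu * (3 * (k%:R + 1) - 2) =
  (3 * lam + 2 * mu) * k%:R / 3 + mu * k%:R * 7 / 3 + mu by field.
by rewrite ltr_wpDl// addr_ge0// ?mulr_ge0 ?invr_ge0// ltW.
Qed.

(** Linear extension of the given system to vectors of harmonic polynomials: for v = w e_j the
    divergence is d_j w, and a member of the system results. *)
Definition elas k v i : D := v i + Lame_coef k *: (rho * dd i (pdiv v)).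

Lemma pdiv_rho_pgrad h : pdiv (fun i => rho * dd i h) = 2 * euler h + rho * lap h.
Proof.
rewrite /pdiv /euler /lap !mulr_sumr -big_split/=; apply: eq_bigr => i _.
rewrite ddM; congr (_ + _); elim/axP : i; rewrite /rho !sum_ax !ddE; ring.
Qed.

Lemma pdivD u v : pdiv (fun i => u i + v i) = pdiv u + pdiv v.
Proof. by rewrite /pdiv -big_split; apply: eq_bigr => i _; rewrite ddD. Qed.
Lemma pdivZ c u : pdiv (fun i => c *: u i) = c *: pdiv u.
Proof. by rewrite /pdiv scaler_sumr; apply: eq_bigr => i _; rewrite ddZ. Qed.

Lemma lap_rho_dd (c : R) h i : harm c h ->
  lap (rho * dd i h) = (4 * c + 2) *: dd i h.
Proof.
move=> hh; have [wd ld] := harm_dd i hh.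
by rewrite lap_rho ld wd mulr0 addr0 !sclrE; ring.
Qed.

(** Every term of E is a multiple of grad (div v), and [Lame_coef] is the value that makes the
    factors add up to 0. *)
Lemma sol_elas k v : (forall i, harm k%:R (v i)) -> sol lam mu (elas k v).
Proof.
move=> hv i; have hd := harm_pdiv hv; have [wd ld] := hd.
rewrite /Eop pdivD pdivZ pdiv_rho_pgrad ld mulr0 addr0 wd lapD lapZ (lap_rho_dd i hd).
case: (hv i) => _ ->; rewrite !(ddE, dd_nat) mul0r !add0r.
transitivity ((2 * (lam * (k%:R - 1) + mu * (3 * k%:R - 2)) * Lame_coef k + (lam + mu))
    *: dd i (pdiv v)).
  rewrite !sclrE; ring.
suff -> : 2 * (lam * (k%:R - 1) + mu * (3 * k%:R - 2)) * Lame_coef k + (lam + mu) = 0.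
  exact: scale0r.
by have dk := Lame_coef_den k; rewrite /Lame_coef; field.
Qed.

(** The divergence of E u is (lam + 2 mu) times the Laplacian of div u. *)
Lemma harm_pdiv_sol u : sol lam mu u -> lap (pdiv u) = 0.
Proof.
move=> su; have : pdiv (Eop lam mu u) = 0.
  by rewrite /pdiv big1// => i _; rewrite su dd0.
rewrite /Eop (pdivD (fun i => mu *: lap (u i))) !pdivZ -/(pgrad _) pdiv_pgrad.
have -> : pdiv (fun i => lap (u i)) = lap (pdiv u).
  by rewrite /pdiv lap_sum; apply: eq_bigr => i _; rewrite lap_dd.
rewrite -scalerDl => /eqP; rewrite scaler_eq0 => /orP[|/eqP//].
by rewrite gt_eqF//; move: hmu hlam => ? ?; lra.
Qed.

(** The harmonic part is v = u + a |x|^2 grad (div u), with [a] chosen to cancel the Laplacian of u,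
    which E u = 0 expresses through grad (div u). As div v is a multiple of div u, v determines u,
    and the correction is the one in [elas]. *)
Lemma homog_sol k u : (forall i, wt k%:R (u i)) -> sol lam mu u ->
  exists2 v, (forall i, harm k%:R (v i)) & u =1 elas k v.
Proof.
move=> wu su; pose d := pdiv u; pose a := (lam + mu) / (mu * (4 * k%:R - 2)).
have k2 : 4 * k%:R - 2 != 0 :> R.
  (* 4 k = 2 is impossible modulo 4. *)
  rewrite -(natrM R 4 k) subr_eq0 eqr_nat; apply/eqP => /(congr1 (fun m => m %% 4)%N).
  by rewrite modnMr.
have hd : harm (k%:R - 1) d.
  split; last exact: harm_pdiv_sol.
  by rewrite /d /pdiv sum_ax; apply: wtD; first apply: wtD; exact: wt_dd.
have [wd ld] := hd.
pose v i := u i + a *: (rho * dd i d).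
have hv i : harm k%:R (v i).
  split.
    apply: wtD => //; apply: wtZ; have -> : k%:R = 2 + (k%:R - 1 - 1) :> R by ring.
    exact: wtM wt_rho (wt_dd _ wd).
  rewrite /v lapD lapZ (lap_rho_dd i hd).
  apply/eqP; rewrite -(inj_eq (scalerI (lt0r_neq0 hmu))) scaler0 scalerDr -(su i) /Eop.
  apply/eqP; congr (_ + _); rewrite !scalerA; congr (_ *: _).
  rewrite /a; field; rewrite k2 gt_eqF//.
exists v => // i; have vd : pdiv v = (1 + 2 * a * (k%:R - 1)) *: d.
  rewrite /v pdivD pdivZ pdiv_rho_pgrad ld mulr0 addr0 wd -/d !sclrE; ring.
rewrite /elas vd ddZ /v -addrA -scalerAr scalerA -scalerDl.
suff -> : a + Lame_coef k * (1 + 2 * a * (k%:R - 1)) = 0 by rewrite scale0r addr0.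
have dk := Lame_coef_den k; rewrite /a /Lame_coef; field; rewrite dk k2 gt_eqF//.
Qed.

(** E lowers every degree by 2, so the components of E u are the images of those of u and vanish
    separately: each homogeneous component of a solution is a solution. *)
Lemma sol_structure u : sol lam mu u -> exists N (V : nat -> 'I_3 -> D),
  (forall k i, harm k%:R (V k i)) /\ forall i, u i = \sum_(k < N) elas k (V k) i.
Proof.
move=> su; have [N [U [wU uU]]] := vector_homog_components u.
(* Beyond N nothing is known of [U k]; the truncation makes every index a solution, so that [choice]
   applies. *)
pose U' k i := if (k < N)%N then U k i else 0.
have wU' k i : wt k%:R (U' k i) by rewrite /U'; case: ifP => // _; exact: wt0.
have EopU i : Eop lam mu u i = \sum_(k < N) Eop lam mu (U k) i.
  rewrite /Eop uU lap_sum scaler_sumr big_split/=; congr (_ + _); rewrite -scaler_sumr.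
  rewrite -dd_sum /pdiv exchange_big/=; congr (_ *: dd _ _).
  by apply: eq_bigr => j _; rewrite uU dd_sum.
have wE k i : wt (k%:R - 2) (Eop lam mu (U k) i).
  have wdd a j l : wt (k%:R - 2) (dd a (dd j (U k l))).
    have -> : k%:R - 2 = k%:R - 1 - 1 :> R by ring.
    by do 2!apply: wt_dd.
  rewrite /Eop /lap /pdiv !sum_ax !ddD; apply: wtD; apply: wtZ;
    by apply: wtD; first apply: wtD.
have sU' k : sol lam mu (U' k).
  rewrite /U'; case kN : (k < N)%N; last exact: sol0.
  move=> i; apply: (@wt_independent _ _ (- 2) N (fun k => Eop lam mu (U k) i)) => //.
  by rewrite -EopU su.
have /choice[V VE] : forall k, exists v,
    (forall i, harm k%:R (v i)) /\ U' k =1 elas k v.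
  by move=> k; have [v ? ?] := homog_sol (wU' k) (sU' k); exists v.
exists N, V; split=> [k|i]; first by case: (VE k).
by rewrite uU; apply: eq_bigr => k _; case: (VE k) => _ <-; rewrite /U' ltn_ord.
Qed.

End elastic_solutions.

Section boundary_values.
Context {R : realFieldType} {D : polyAlg R}.
Implicit Types (P Q h f : D) (u v w G : 'I_3 -> D) (i j : 'I_3) (k n : nat) (c : R)
  (z b : 'I_3 -> R).
Local Notation x := (@xx R D).
Variables lam mu s : R.
Hypotheses (hmu : 0 < mu) (hlam : 0 < 3 * lam + 2 * mu) (hs : 0 < s).

(* The second expression is the determinant, up to a factor mu, of the system
   solved in reach_spheroidal. *)
Lemma spheroidal_coef n : exists c : R,
  2 * mu + (lam + mu) * (n%:R + 3)
    + c * (mu * (4 * n%:R + 2) + (lam + mu) * (2 * n%:R)) = 0 /\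
  (n != 0%N -> 2 * c * n%:R - n%:R + 2 != 0).
Proof.
move: hmu hlam => m0 l0; have lm0 : 0 < lam + mu by lra.
have n0 : 0 <= n%:R :> R by [].
pose d : R := mu * (4 * n%:R + 2) + (lam + mu) * (2 * n%:R).
have d0 : 0 < d.
  by rewrite ltr_pwDl ?mulr_ge0 ?(ltW lm0)// mulr_gt0// ltr_wpDl// mulr_ge0.
exists (- (2 * mu + (lam + mu) * (n%:R + 3)) / d); split.
  by rewrite -/d divfK ?subrr// gt_eqF.
case: n n0 @d d0 => [//|n] _ d d0 _; set t := (X in X != 0).
suff : 0 < - t * d by rewrite pmulr_lgt0// oppr_gt0 => /lt_eqF ->.
(* Here n is the predecessor of the degree. After multiplication by the positive [- d]-free form,
   all coefficients in n are positive combinations of mu, lam + mu, lam + 2 mu and 3 lam + 2 mu, so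
   [t] is negative. *)
have -> : - t * d = 2 * ((3 * lam + 2 * mu) + n%:R * (5 * (lam + mu) + 3 * mu
    + 2 * n%:R * (lam + 2 * mu))).
  have dn : d != 0 by rewrite gt_eqF.
  transitivity (2 * (2 * mu + (lam + mu) * (n.+1%:R + 3)) * n.+1%:R +
    (n.+1%:R - 2) * d); first by rewrite /t; field.
  rewrite /d -natr1; ring.
have k0 : 0 <= n%:R :> R by [].
have a0 : 0 < 5 * (lam + mu) + 3 * mu by lra.
have b0 : 0 < lam + 2 * mu by lra.
rewrite mulr_gt0// ltr_pwDl// mulr_ge0// addr_ge0 ?(ltW a0)//.
by rewrite mulr_ge0 ?(ltW b0)// mulr_ge0.
Qed.

Definition tang_eq G G' := forall i, on_sphere s (tang G i) (tang G' i).

(** The data are taken without their factors 1 / r: [pdot x u] is r times the normal part and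
    [pstress] is r times the stress. [reach_boundary] restores the factors. *)
Definition reach f G := exists u,
  [/\ sol lam mu u, on_sphere s (pdot x u) f & tang_eq (pstress lam mu u) G].

Lemma pdotxD u v : pdot x (fun i => u i + v i) = pdot x u + pdot x v.
Proof. by rewrite /pdot -big_split; apply: eq_bigr => i _; rewrite mulrDr. Qed.
Lemma pdotxDl u v w : pdot (fun i => u i + v i) w = pdot u w + pdot v w.
Proof. by rewrite /pdot -big_split; apply: eq_bigr => i _; rewrite mulrDl. Qed.
Lemma pdotxZ c u : pdot x (fun i => c *: u i) = c *: pdot x u.
Proof. by rewrite /pdot scaler_sumr; apply: eq_bigr => i _; rewrite scalerAr. Qed.

Lemma pstress_fD u v : pstress lam mu (fun i => u i + v i) =
  fun i => pstress lam mu u i + pstress lam mu v i.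
Proof. by apply/funext => i; rewrite pstressD. Qed.
Lemma pstress_fZ c u : pstress lam mu (fun i => c *: u i) =
  fun i => c *: pstress lam mu u i.
Proof. by apply/funext => i; rewrite pstressZ. Qed.

Lemma reachD f G f' G' : reach f G -> reach f' G' ->
  reach (f + f') (fun i => G i + G' i).
Proof.
move=> [u [su uf uG]] [v [sv vf vG]]; exists (fun i => u i + v i); split.
- exact: solD.
- by rewrite pdotxD; exact: on_sphereD.
- move=> i; rewrite pstress_fD (tangD (pstress lam mu u)) (tangD G).
  by apply: on_sphereD; [exact: uG|exact: vG].
Qed.

Lemma reachZ c f G : reach f G -> reach (c *: f) (fun i => c *: G i).
Proof.
move=> [u [su uf uG]]; exists (fun i => c *: u i); split.
- exact: solZ.
- by rewrite pdotxZ; exact: on_sphereZ.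
- by move=> i; rewrite pstress_fZ (tangZ c (pstress lam mu u)) (tangZ c G); apply: on_sphereZ; exact: uG.
Qed.

Lemma reach_eq f G f' G' : on_sphere s f f' -> tang_eq G G' -> reach f G -> reach f' G'.
Proof.
move=> ff' GG' [u [su uf uG]]; exists u; split=> //.
  exact: on_sphere_trans ff'.
by move=> i; apply: on_sphere_trans (GG' i); exact: uG.
Qed.

Lemma reach0 : reach 0 (fun=> 0).
Proof.
exists (fun=> 0); split; first exact: sol0.
  by rewrite /pdot big1// => i _; rewrite mulr0.
have -> // : pstress lam mu (fun=> 0 : D) = fun=> 0.
apply/funext => i; rewrite -[RHS](scale0r (pstress lam mu (fun=> 0) i)) -pstressZ.
by congr (pstress _ _ _ _); apply/funext => j; rewrite scaler0.
Qed.

Lemma harm0_dd h i : harm 0 h -> dd i h = 0.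
Proof. by move=> hh; apply: wtN1_eq0; have [] := harm_dd i hh; rewrite sub0r. Qed.

Lemma reach_spheroidal n h (a b : R) : harm n%:R h ->
  reach (a *: h) (fun i => b *: dd i h).
Proof.
move=> hh; have [wh _] := hh; have [c [cE c0]] := spheroidal_coef n.
have su := sol_spheroidal hh cE.
have uf : on_sphere s (pdot x (spheroidal c h)) ((s * (1 + c * n%:R)) *: h).
  move=> z zs; rewrite (pdot_spheroidal c wh) pevalZ (on_sphere_rho h zs) !pevalZ; ring.
have uG : tang_eq (pstress lam mu (spheroidal c h))
    (fun i => (s * (mu * (2 * n%:R * c + 1))) *: dd i h).
  move=> i z zs; rewrite (tang_pstress_spheroidal lam mu c i hh) (tangZ _ (pgrad h)).
  rewrite !pevalZ (on_sphere_rho _ zs) pevalZ; ring.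
have [{}n0|n0] := eqVneq n 0%N.
  (* In degree 0 both gradients vanish, and a multiple of the field x h already gives the normal
     datum. *)
  subst n; have dh i : dd i h = 0 by exact: harm0_dd.
  apply: (@reach_eq ((a / s) *: ((s * (1 + c * 0%:R)) *: h))
    (fun i => (a / s) *: ((s * (mu * (2 * 0%:R * c + 1))) *: dd i h))).
  - move=> z _; rewrite !pevalZ !mulr0; field; exact: lt0r_neq0.
  - by move=> i; rewrite (@eq_tang _ _ _ (fun i => b *: dd i h))// => j; rewrite dh !scaler0.
  - by apply: reachZ; exists (spheroidal c h).
have {}c0 := c0 n0.
have s0 := lt0r_neq0 hs; have m0 := lt0r_neq0 hmu.
(* Cramer's rule: [al] and [be] are the coefficients of grad h and of the spheroidal field, and [dl]
   is the determinant. *)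
pose dl := s * mu * (2 * c * n%:R - n%:R + 2).
have dl0 : dl != 0 by apply: mulf_neq0 => //; apply: mulf_neq0; exact: lt0r_neq0.
pose al := (a * (s * (mu * (2 * n%:R * c + 1))) - b * (s * (1 + c * n%:R))) / dl.
pose be := (n%:R * b - 2 * mu * (n%:R - 1) * a) / dl.
apply: (@reach_eq (al *: (n%:R *: h) + be *: ((s * (1 + c * n%:R)) *: h))
  (fun i => al *: ((2 * mu * (n%:R - 1)) *: dd i h) +
    be *: ((s * (mu * (2 * n%:R * c + 1))) *: dd i h))).
- move=> z _; rewrite !(pevalD, pevalZ) /al /be; move: dl0; rewrite /dl => _; field.
  by rewrite ?s0 ?m0 ?c0.
- move=> i; rewrite (@eq_tang _ _ _ (fun i => b *: dd i h))// => j.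
  rewrite !scalerA -scalerDl; congr (_ *: _); rewrite /al /be; move: dl0; rewrite /dl => _.
  by field; rewrite ?s0 ?m0 ?c0.
- apply: reachD; apply: reachZ; last by exists (spheroidal c h).
  exists (pgrad h); split; first exact: sol_pgrad hh.
    by rewrite pdot_pgrad wh.
  move=> i; rewrite (@eq_tang _ _ _ (fun i => (2 * mu * (n%:R - 1)) *: dd i h))//.
  by move=> j; rewrite (pstress_pgrad lam mu j hh).
Qed.

Lemma reach_harm n h : harm n%:R h -> reach h (fun=> 0).
Proof.
move=> hh; apply: reach_eq (reach_spheroidal 1 0 hh); first by rewrite scale1r.
by move=> i; rewrite (@eq_tang _ _ _ (fun=> 0))// => j; rewrite scale0r.
Qed.

Lemma reach_grad n h : harm n%:R h -> reach 0 (pgrad h).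
Proof.
move=> hh; apply: reach_eq (reach_spheroidal 0 1 hh); first by rewrite scale0r.
by move=> i; rewrite (@eq_tang _ _ _ (pgrad h))// => j; rewrite scale1r.
Qed.

Lemma reach_toroidal n h : n != 1%N -> harm n%:R h -> reach 0 (pcross x (pgrad h)).
Proof.
move=> n1 hh; have k0 : mu * (n%:R - 1) != 0.
  apply: mulf_neq0; first exact: lt0r_neq0.
  by rewrite subr_eq0 (eqr_nat R n 1).
exists (fun i => (mu * (n%:R - 1))^-1 *: pcross x (pgrad h) i); split.
- exact/solZ/sol_toroidal/hh.
- by rewrite pdotxZ pdot_toroidal scaler0.
- move=> i; rewrite pstress_fZ (@eq_tang _ _ _ (pcross x (pgrad h)))// => j.
  by rewrite (pstress_toroidal lam mu j hh) scalerA mulVf ?scale1r.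
Qed.

Lemma reach_normal f : reach f (fun=> 0).
Proof.
have [Q hQ fQ] := harm_span_sphere s f.
apply: (@reach_eq Q (fun=> 0)) => //; first exact: on_sphere_sym.
elim: hQ => [|n h P hh _ IH]; first exact: reach0.
apply: reach_eq (reachD (reach_harm hh) IH) => //.
by move=> i; rewrite (@eq_tang _ _ _ (fun=> 0))// => j; rewrite addr0.
Qed.

(* The rotations x /\ b are the only tangential fields x /\ grad h not attained. *)
Definition reach_mod G := exists b, reach 0 (fun i => G i - pcross (fun j => (b j)%:A) x i).

Lemma reach_modD G G' : reach_mod G -> reach_mod G' -> reach_mod (fun i => G i + G' i).
Proof.
move=> [b rb] [b' rb']; exists (fun i => b i + b' i).
have := reachD rb rb'; rewrite addr0; apply: reach_eq => //.
move=> i z _; congr (peval z _); apply: eq_tang => {}i.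
by elim/axP : i; rewrite !pcrossE !scalerDl; ring.
Qed.

Lemma reach_modZ c G : reach_mod G -> reach_mod (fun i => c *: G i).
Proof.
move=> [b rb]; exists (fun i => c * b i).
have := reachZ c rb; rewrite scaler0; apply: reach_eq => //.
move=> i z _; congr (peval z _); apply: eq_tang => {}i.
by elim/axP : i; rewrite !pcrossE -!scalerA !sclrE; ring.
Qed.

Lemma reach_mod_eq G G' : tang_eq G G' -> reach_mod G -> reach_mod G'.
Proof.
move=> GG' [b rb]; exists b; apply: reach_eq rb => // i.
by rewrite (tangB G) (tangB G') => z zs; rewrite (pevalB _ (tang G i)) (pevalB _ (tang G' i)) (GG' i z zs).
Qed.

Lemma reach_mod0 G : reach 0 G -> reach_mod G.
Proof.
move=> rG; exists (fun=> 0); apply: reach_eq rG => //.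
move=> i z _; congr (peval z _); apply: eq_tang => {}i.
by elim/axP : i; rewrite !pcrossE !scale0r; ring.
Qed.

Lemma reach_mod_toroidal n h : harm n%:R h -> reach_mod (pcross x (pgrad h)).
Proof.
move=> hh; have [n1|n1] := eqVneq n 1%N; last exact/reach_mod0/(reach_toroidal n1).
(* For n = 1 the gradient of h is a constant vector b, and the field x /\ b is itself the rotation
   (- b) /\ x. *)
have /fin_all_exists[b bE] : forall i, exists c, dd i h = c%:A.
  by move=> i; apply: wt0_const; have [+ _] := harm_dd i hh; rewrite n1 subrr.
exists (fun i => - b i); apply: reach_eq reach0 => //.
move=> i z _; congr (peval z _); apply: eq_tang => {}i.
by elim/axP : i; rewrite !pcrossE /pgrad !bE !scaleNr; ring.
Qed.

Lemma reach_mod_vharm n v : (forall i, harm n%:R (v i)) -> reach_mod v.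
Proof.
move=> hv; have [n0|n0] := eqVneq n 0%N.
  (* A constant vector v is the gradient of x . v. *)
  subst n; apply: reach_mod0; apply: (@reach_eq 0 (pgrad (pdot x v))) => //.
    move=> i z _; congr (peval z _); apply: eq_tang => {}i.
    rewrite /pgrad grad_pdot; have [-> _] := hv i; rewrite scale0r addr0.
    have dv j l : dd j (v l) = 0 by exact: harm0_dd.
    rewrite [X in _ + X](_ : _ = 0) ?addr0//.
    by elim/axP : i; rewrite !pcrossE !dv !subr0 !mulr0 subr0.
  apply: (@reach_grad 1); split.
    by rewrite -[1%:R]add0r; apply: wt_pdot => i; case: (hv i).
  rewrite (lap_pdot_harm hv) /pdiv big1 ?mulr0// => i _; exact: harm0_dd.
set d := pdiv v; set q := pdot x (pcurl v).
have hq : harm n%:R q by exact: harm_pdot_pcurl.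
have hd : harm (n%:R - 1) d by exact: harm_pdiv.
have [wd ld] := hd.
have nn : n%:R * (n%:R + 1) != 0 :> R by rewrite mulf_neq0 ?pnatr_eq0// natr1 pnatr_eq0.
have n21 : 2 * n%:R + 1 != 0 :> R by rewrite lt0r_neq0// ltr_wpDl// mulr_ge0.
(* The polynomial x . v has Laplacian 2 div v; the correction makes it harmonic. On the sphere the
   gradient of the correction is, up to a radial term, a multiple of grad (div v). *)
pose h1 := pdot x v - (2 * n%:R + 1)^-1 *: (rho * d).
have hh1 : harm n.+1%:R h1.
  rewrite -natr1; split.
    apply: wtB; first by apply: wt_pdot => i; case: (hv i).
    apply: wtZ; have -> : n%:R + 1 = 2 + (n%:R - 1) :> R by ring.
    exact: wtM wt_rho wd.
  rewrite lapB lapZ (lap_pdot_harm hv) lap_rho ld wd mulr0 addr0 -/d.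
  have -> : 6 * d + 4 * ((n%:R - 1) *: d) = (2 * n%:R + 1) *: (2 * d).
    rewrite !sclrE; ring.
  by rewrite scalerA mulVf// scale1r subrr.
have rd : reach_mod (pgrad d).
  apply: reach_mod0; apply: (@reach_grad n.-1).
  by case: n n0 hd {hv hq wd nn n21 h1 hh1} => [//|n] _; rewrite -natr1 addrK.
pose A : R := (n%:R * (n%:R + 1))^-1.
have := reach_modD (reach_modZ (A * n%:R) (reach_mod0 (reach_grad hh1)))
  (reach_modD (reach_modZ (- A) (reach_mod_toroidal hq))
    (reach_modZ (A * s * (n%:R / (2 * n%:R + 1) - 1)) rd)).
apply: reach_mod_eq => i.
(* The radial terms: one from the decomposition of v, one from the gradient of [rho] in the
   correction. *)
pose K := A *: ((n%:R / (2 * n%:R + 1) * 2 + (n%:R - 1)) *: d).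
have vE j : v j = x j * K + ((A * n%:R) *: pgrad h1 j + ((- A) *: pcross x (pgrad q) j +
    (A * (n%:R / (2 * n%:R + 1) - 1)) *: (rho * pgrad d j))).
  have -> : v j = A *: ((n%:R * (n%:R + 1)) *: v j) by rewrite scalerA mulVf ?scale1r.
  rewrite (vector_harmonic_decomposition j hv).
  rewrite /K /pgrad /h1 -/d -/q !ddE.
  have -> : dd j rho = 2 * x j :> D.
    by elim/axP : j; rewrite /rho !sum_ax !ddE; ring.
  move: (2 * n%:R + 1) n21 => m m0; rewrite !sclrE; ring.
have LC (a b c : R) (U V W : 'I_3 -> D) :
    tang (fun j => a *: U j + (b *: V j + c *: W j)) i =
    a *: tang U i + (b *: tang V i + c *: tang W i).
  rewrite (tangD (fun j => a *: U j)) (tangD (fun j => b *: V j)).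
  by rewrite (tangZ a U) (tangZ b V) (tangZ c W).
rewrite (eq_tang vE) (tangD (fun j => x j * K)) tang_radial add0r !LC.
rewrite (tangM rho (pgrad d)).
move: (tang _ i) (tang _ i) (tang _ i) => T1 T2 T3 z zs.
by rewrite !(pevalD, pevalZ) (on_sphere_rho _ zs) !pevalZ; ring.
Qed.

Lemma reach_mod_all G : reach_mod G.
Proof.
(* The entries of G are replaced by harmonic sums one at a time, so that each vector met in the
   induction has entries of a single degree. *)
pose e j P : 'I_3 -> D := fun i => if i == j then P else 0.
have H j P : reach_mod (e j P).
  have [Q hQ PQ] := harm_span_sphere s P.
  apply: (@reach_mod_eq (e j Q)).
    move=> i z zs; rewrite /tang /pdot !(pevalB, pevalM, peval_sum).
    have E l : peval z (e j Q l) = peval z (e j P l).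
      by rewrite /e; case: ifP => // _; rewrite PQ.
    by rewrite E; congr (_ - _ * _); apply: eq_bigr => k _; rewrite !pevalM E.
  elim: hQ => [|n h T hh _ IH].
    apply: reach_mod_eq (reach_mod0 reach0) => i.
    by rewrite (@eq_tang _ _ _ (e j 0))// => k; rewrite /e; case: ifP.
  apply: reach_mod_eq (reach_modD (reach_mod_vharm (v := e j h) (n := n) _) IH) => i.
    by rewrite (@eq_tang _ _ _ (e j (h + T)))// => k; rewrite /e; case: ifP => // _; rewrite addr0.
  by rewrite /e; case: ifP => // _; exact: harm0.
apply: reach_mod_eq (reach_modD (H o0 (G o0)) (reach_modD (H o1 (G o1)) (H o2 (G o2)))) => i.
rewrite (@eq_tang _ _ _ G)// => {}i.
by elim/axP : i; rewrite /e !axE//= ?addr0 ?add0r.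
Qed.

Lemma reach_all f G : exists b, reach f (fun i => G i - pcross (fun j => (b j)%:A) x i).
Proof.
have [b rb] := reach_mod_all G; exists b.
have := reachD (reach_normal f) rb; apply: reach_eq; first by rewrite addr0.
by move=> i z _; congr (peval z _); apply: eq_tang => j; rewrite add0r.
Qed.

End boundary_values.

(** * Orthogonality to rotations, for an abstract rotation-invariant integral *)

Section sphere_integral.
Context {R : realFieldType} {D : polyAlg R}.
Implicit Types (P Q h f : D) (u v w G : 'I_3 -> D) (i j : 'I_3) (k n : nat) (c : R)
  (z b : 'I_3 -> R).
Local Notation x := (@xx R D).
Variables (lam mu s : R) (L : D -> R).
Hypotheses (hmu : 0 < mu) (hlam : 0 < 3 * lam + 2 * mu).
(** The properties of the surface integral on which the algebra rests. [Lrot] is invariance under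
    infinitesimal rotations; it does the work of integration by parts. *)
Hypotheses (LD : forall P Q, L (P + Q) = L P + L Q)
  (LZ : forall c P, L (c *: P) = c * L P)
  (Ls : forall P Q, on_sphere s P Q -> L P = L Q)
  (Lrot : forall i j P, L (x i * dd j P - x j * dd i P) = 0).

Lemma L_sum (I : Type) (r : seq I) (T : pred I) (F : I -> D) :
  L (\sum_(a <- r | T a) F a) = \sum_(a <- r | T a) L (F a).
Proof.
apply: (big_morph L) => //; by have := LZ 0 0; rewrite scale0r mul0r.
Qed.

Lemma LB P Q : L (P - Q) = L P - L Q.
Proof. by rewrite -(scaleN1r Q) LD LZ mulN1r. Qed.

Lemma L_rho P : L (rho * P) = s * L P.
Proof. by rewrite -LZ; apply: Ls; exact: on_sphere_rho. Qed.

Lemma L_toroidal P i : L (pcross x (pgrad P) i) = 0.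
Proof. by elim/axP : i; rewrite pcrossE; exact: Lrot. Qed.

(** The squares of the three rotation operators add up to the Laplacian of the sphere, whose values
    [L] annihilates and for which h is an eigenvector of eigenvalue - c (c + 1). *)
Lemma L_harm c h : harm c h -> c * (c + 1) != 0 -> L h = 0.
Proof.
move=> [wh lh] c0; pose T i P := pcross x (pgrad P) i.
have E : \sum_i T i (T i h) = rho * lap h - euler (euler h) - euler h.
  rewrite /T; pring.
have : L (\sum_i T i (T i h)) = 0.
  by rewrite L_sum big1// => i _; exact: L_toroidal.
rewrite E lh wh eulerZ wh mulr0 sub0r scalerA -scaleNr -scalerBl LZ => /eqP.
rewrite mulf_eq0 => /orP[|/eqP//].
by rewrite -opprD oppr_eq0 -[X in _ + X]mulr1 -mulrDr (negPf c0).
Qed.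

(* Both sides differ by the integral of a harmonic polynomial of degree n + 1. *)
Lemma L_moment i n h : harm n%:R h -> (2 * n%:R + 1) * L (x i * h) = s * L (dd i h).
Proof.
move=> hh; have n0 : 2 * n%:R + 1 != 0 :> R by rewrite lt0r_neq0// ltr_wpDl// mulr_ge0.
have := L_harm (harm_raise i hh n0); rewrite LB LZ L_rho natr1 natr1 -natrM pnatr_eq0.
by move=> /(_ isT)/subr0_eq ->; rewrite mulVKf.
Qed.

Definition rotf b : 'I_3 -> D := pcross (fun j => (b j)%:A) x.

(** The triple product a . (b /\ x) = b . (x /\ a) isolates b. The divergence term is radial, hence
    orthogonal to b /\ x. *)
Lemma pdot_pstress_rot u b : pdot (pstress lam mu u) (rotf b) =
  \sum_i b i *: ((2 * mu) *: pcross x (fun j => euler (u j)) i +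
    mu *: (x i * pdot x (pcurl u) - rho * pcurl u i)).
Proof.
rewrite /rotf /pstress /pdot /rho !sum_ax !pcrossE.
set e0 := euler _; set e1 := euler _; set e2 := euler _.
rewrite -/(scl _) -/(scl _) -/(scl _) !sclrE; ring.
Qed.

(** Integration by parts: x . curl u is a sum of rotational derivatives of the entries of u, and
    moving x_i inside them costs x /\ u. *)
Lemma L_pdot_pcurl u i : L (x i * pdot x (pcurl u)) = L (pcross x u i).
Proof.
have -> : x i * pdot x (pcurl u) =
    pcross x u i + \sum_k pcross x (pgrad (x i * u k)) k.
  elim/axP : i; pring.
by rewrite LD L_sum big1 ?addr0// => k _; exact: L_toroidal.
Qed.

Lemma L_pstress_rot u b : L (pdot (pstress lam mu u) (rotf b)) =
  \sum_i b i * (2 * mu * L (pcross x (fun j => euler (u j)) i) +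
    mu * (L (pcross x u i) - s * L (pcurl u i))).
Proof.
rewrite pdot_pstress_rot L_sum; apply: eq_bigr => i _.
by rewrite LZ LD !LZ LB L_pdot_pcurl L_rho.
Qed.

Lemma pcurlD u v i : pcurl (fun j => u j + v j) i = pcurl u i + pcurl v i.
Proof. elim/axP : i; pring. Qed.
Lemma pcurlZ c u i : pcurl (fun j => c *: u j) i = c *: pcurl u i.
Proof. elim/axP : i; pring. Qed.
Lemma pcurl_rho P i : pcurl (fun j => rho * dd j P) i = 2 * pcross x (pgrad P) i.
Proof. elim/axP : i; pring. Qed.

(** By homogeneity the i-th summand is mu times (2 n + 1) L (x /\ u) - s L (curl u). Passing from u
    to v changes both integrals by rotational derivatives only, and for harmonic v the difference is
    0 by [L_moment]. *)
Lemma L_pstress_rot_elas n v b : (forall i, harm n%:R (v i)) ->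
  L (pdot (pstress lam mu (elas lam mu n v)) (rotf b)) = 0.
Proof.
move=> hv; set u := elas lam mu n v; have [wd _] := harm_pdiv hv.
have wu i : euler (u i) = n%:R *: u i.
  apply: wtD; first by case: (hv i).
  apply: wtZ; have -> : n%:R = 2 + (n%:R - 1 - 1) :> R by ring.
  exact: wtM wt_rho (wt_dd _ wd).
rewrite L_pstress_rot big1// => i _.
rewrite (@eq_pcross _ _ x (fun j => euler (u j)) x (fun j => n%:R *: u j))//.
have Lx : L (pcross x u i) = L (pcross x v i).
  have -> : pcross x u i = pcross x v i + Lame_coef lam mu n *: (rho * pcross x (pgrad (pdiv v)) i).
    rewrite /u /elas /pgrad; elim/axP : i; rewrite !pcrossE !sclrE; ring.
  by rewrite LD LZ L_rho L_toroidal !mulr0 addr0.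
have Lc : L (pcurl u i) = L (pcurl v i).
  rewrite /u /elas pcurlD pcurlZ pcurl_rho LD LZ.
  by rewrite -(scl_nat 2) -sclE LZ L_toroidal !mulr0 addr0.
have M : (2 * n%:R + 1) * L (pcross x v i) = s * L (pcurl v i).
  by elim/axP : i {Lx Lc}; rewrite !pcrossE !LB !mulrBr !L_moment.
rewrite pcrossZr LZ Lx Lc -M; ring.
Qed.

Lemma L_pstress_rot_sol u b : sol lam mu u ->
  L (pdot (pstress lam mu u) (rotf b)) = 0.
Proof.
move=> /(sol_structure hmu hlam)[N [V [hV uV]]].
have -> : pdot (pstress lam mu u) (rotf b) =
    \sum_(k < N) pdot (pstress lam mu (elas lam mu k (V k))) (rotf b).
  have -> : u = fun i => \sum_(k < N) elas lam mu k (V k) i by apply/funext.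
  elim: N {uV} => [|N IH].
    rewrite big_ord0 (_ : (fun i => _) = fun i => 0 *: (0 : D)).
      by rewrite pstress_fZ /pdot big1// => i _; rewrite scale0r mul0r.
    by apply/funext => i; rewrite big_ord0 scaler0.
  rewrite big_ord_recr/= -IH -pdotxDl; congr (pdot _ _); rewrite -pstress_fD.
  by congr pstress; apply/funext => i; rewrite big_ord_recr.
by rewrite L_sum big1// => k _; exact: L_pstress_rot_elas.
Qed.

(** From |b /\ x|^2 = |b|^2 |x|^2 - (b . x)^2, where the second moments of the coordinates are s / 3
    on the diagonal and 0 off it. *)
Lemma L_rot_norm b : L (pdot (rotf b) (rotf b)) = 2 / 3 * s * L 1 * \sum_i b i ^+ 2.
Proof.
have M i j : 3 * L (x i * x j) = s * (i == j)%:R * L 1.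
  have hx : harm 1%:R (x j).
    split; first exact: wt_xx.
    by rewrite /lap big1// => k _; rewrite dd_xx dd_nat.
  have := L_moment i hx; rewrite dd_xx => E.
  rewrite -mulrA -(LZ (i == j)%:R 1) scaler_nat -E; congr (_ * _); ring.
have E : pdot (rotf b) (rotf b) =
    rho * scl (\sum_i b i ^+ 2) - \sum_i \sum_j (b i * b j) *: (x i * x j).
  rewrite /rotf /pdot /rho !sum_ax !pcrossE -/(scl _) -/(scl _) -/(scl _).
  rewrite !expr2 !sclrE; ring.
have M' i j : L (x i * x j) = s / 3 * (i == j)%:R * L 1.
  have := M i j; set t := L (x i * x j) => e.
  have -> : t = (3 * t) / 3 by field.
  by rewrite e; field.
by rewrite E LB L_rho /scl LZ !sum_ax !LD !LZ !M' !axE//= !mulr0n; field.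
Qed.

End sphere_integral.

(** * Polynomials as functions *)

Section mpoly_instance.
Import -(notations) mpoly.
Variable R : realType.

Let A : comAlgType R := mpoly 3 R.

Lemma mpoly_ind_gen (T : A -> Prop) : T 1 ->
  (forall p q, T p -> T q -> T (p + q)) -> (forall c p, T p -> T (c *: p)) ->
  (forall i p, T p -> T (mpolyX R (mnm1 i) * p)) -> forall p, T p.
Proof.
move=> T1 TD TZ TX; have TXn i k p : T p -> T (mpolyX R (mnm1 i) ^+ k * p).
  by elim: k p => [|k IH] p Tp; rewrite ?mul1r// exprS -mulrA; exact/TX/IH.
elim/mpolyind => [|c m p _ _ Tp]; first by rewrite -(scale0r (1 : A)); exact: TZ.
apply: TD Tp; apply: TZ; rewrite mpolyXE_id -[X in T X]mulr1.
rewrite !big_ord_recr big_ord0/= mul1r -!mulrA; do 3!apply: (TXn); exact: T1.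
Qed.

Lemma mderiv_mpolyX i j : mderiv i (mpolyX R (mnm1 j)) = (i == j)%:R :> A.
Proof.
rewrite mderivX mnm1E eq_sym; case: eqP => [->|_]; last by rewrite scale0r.
rewrite scale1r; have -> : mnm_sub (mnm1 j) (mnm1 j) = mnm0 :> multinom 3.
  by apply/mnmP => k; rewrite mnmBE subnn mnm0E.
exact: mpolyX0.
Qed.

Definition mpolyAlg : polyAlg R := @PolyAlg R A (@mderiv 3 R) (fun i => mpolyX R (mnm1 i))
  (@meval 3 R) (@mderivD 3 R) (@mderivZ 3 R) (@mderivM 3 R) (fun i j p => mderiv_comm j i p)
  mderiv_mpolyX (@mevalD 3 R) (@mevalZ 3 R) (@mevalM 3 R) (@meval1 3 R) (@mevalXU 3 R)
  mpoly_ind_gen.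

Lemma wtX (D : polyAlg R) c (P : D) n : wt c P -> wt (n%:R * c) (P ^+ n).
Proof.
move=> wP; elim: n => [|n IH]; first by rewrite mul0r; exact: wt1.
by rewrite exprS -natr1 mulrDl mul1r addrC; exact: wtM.
Qed.

Lemma wt_monomial m : wt (mdeg m)%:R (mpolyX R m : mpolyAlg).
Proof.
rewrite mpolyXE_id mdegE !big_ord_recr !big_ord0 /= mul1r add0n !natrD.
have W i : wt (m i)%:R (mpolyX R (mnm1 i) ^+ m i : mpolyAlg).
  by rewrite -[X in wt X _]mulr1; apply: wtX; exact: (@wt_xx _ mpolyAlg).
by apply: wtM; first apply: wtM.
Qed.

Lemma mcoeff_euler m (P : mpolyAlg) :
  mcoeff m (euler P) = (mdeg m)%:R * mcoeff m P.
Proof.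
elim/(@mpolyind 3 R) : P => [|c n p _ _ IH].
  by rewrite (@euler0 _ mpolyAlg) mcoeff0 mulr0.
rewrite eulerD (eulerZ (D := mpolyAlg)) (wt_monomial n) !(mcoeffD, mcoeffZ) IH mulrDr.
rewrite mcoeffX; case: eqP => [->|_]; rewrite ?mulr0// !mulr1; congr (_ + _).
exact: mulrC.
Qed.

(** Monomials are eigenvectors of the Euler operator, and in characteristic 0 the eigenvalue
    determines the degree. *)
Lemma homog_wt k (P : mpolyAlg) : P \is ishomog1 k mdeg <-> wt k%:R P.
Proof.
split=> [/dhomogP hP|wP].
  apply/mpolyP => m; rewrite mcoeff_euler mcoeffZ.
  have [/hP ->//|] := boolP (m \in msupp P).
  by rewrite -mcoeff_eq0 => /eqP ->; rewrite !mulr0.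
apply/dhomogP => m; rewrite mcoeff_msupp => m0; apply/eqP.
have := mcoeff_euler m P; rewrite wP mcoeffZ => /(mulIf m0)/eqP.
by rewrite eqr_nat eq_sym.
Qed.

End mpoly_instance.

Section calculus.
Context {R : realType}.
Context {D : polyAlg R}.
Implicit Types (P Q : D) (u : 'I_3 -> D).

(** The chain rule, with a general inner map: it serves for lines, for the coordinates of space and
    for the angular parametrization. *)
Lemma is_derive_peval (V : normedModType R) (P : D) (f : 'I_3 -> V -> R)
    (df : 'I_3 -> R) (a v : V) : (forall i, is_derive a v (f i) (df i)) ->
  is_derive a v (fun y => peval (f^~ y) P)
    (\sum_i peval (f^~ a) (dd i P) * df i).
Proof.
move=> fE; elim/palg_ind : P => [|P Q IP IQ|c P IP|j P IP].
- rewrite (_ : (fun y => _) = cst 1); last by apply/funext => y; rewrite peval1.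
  rewrite big1; first exact: is_derive_cst.
  by move=> i _; rewrite dd1 peval0 mul0r.
- rewrite (_ : (fun y => _) = (fun y => peval (f^~ y) P) \+ (fun y => peval (f^~ y) Q)).
    under eq_bigr do rewrite ddD pevalD mulrDl.
    by rewrite big_split; exact: is_deriveD.
  by apply/funext => y; rewrite pevalD.
- rewrite (_ : (fun y => _) = c \*: (fun y => peval (f^~ y) P)).
    under eq_bigr do rewrite ddZ pevalZ -mulrA.
    by rewrite -mulr_sumr; exact: is_deriveZ.
  by apply/funext => y; rewrite pevalZ.
- rewrite (_ : (fun y => _) = (f j : V -> R^o) * (fun y => peval (f^~ y) P)).
    have := is_deriveM (fE j) IP => /is_derive_eq; apply.
    under [RHS]eq_bigr do rewrite ddM pevalD dd_xx !pevalM peval_xx mulrDl.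
    rewrite big_split/= addrC; congr (_ + _).
      by rewrite scaler_sumr; apply: eq_bigr => i _; rewrite -mulrA.
    rewrite (bigD1 j)//= eqxx big1 ?addr0 => [|i ij].
      by rewrite mulr1n peval1 mul1r.
    by rewrite (negPf ij) mulr0n (@peval0 _ D) !mul0r.
  by apply/funext => y; rewrite pevalM peval_xx.
Qed.

(** Induction on the number of homogeneous components: a derivative has one component less and still
    vanishes everywhere, so P has gradient 0 and is constant. *)
Lemma peval_eq0 P : (forall z, peval z P = 0) -> P = 0.
Proof.
have [N [F [wF _ PF]]] := homog_components P; move: (PF N (leqnn N)) => {PF}.
elim: N P F wF => [|N IH] P F wF PE P0; first by rewrite PE big_ord0.
suff dP i : dd i P = 0.
  have /wt0_const[c cP] : wt 0 P.
    by rewrite /wt scale0r /euler big1// => i _; rewrite dP mulr0.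
  by have := P0 (fun=> 0); rewrite cP pevalZ peval1 mulr1 => ->; rewrite scale0r.
apply: (IH _ (fun k => dd i (F k.+1))) => [k||z].
- by have := wt_dd i (wF k.+1); rewrite -natr1 addrK.
- rewrite PE dd_sum big_ord_recl/= (wtN1_eq0 (P := dd i (F 0%N))) ?add0r//.
  by have := wt_dd i (wF 0%N); rewrite sub0r.
- have dx j : is_derive (0 : R^o) 1 (fun t : R^o => z j + (j == i)%:R * t) ((j == i)%:R : R).
    rewrite -[X in is_derive _ _ _ X]add0r -[X in is_derive _ _ _ (_ + X)]mulr1.
    exact: is_deriveD.
  have [_] := is_derive_peval P dx.
  rewrite (_ : (fun y => _) = cst 0); last by apply/funext => t; exact: P0.
  rewrite derive_cst (bigD1 i)//= big1 => [|j /negPf ->]; last by rewrite mulr0.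
  rewrite eqxx mulr1 addr0 => ->; congr (peval _ _).
  by apply/funext => j; rewrite mulr0 addr0.
Qed.

(** Evaluation in coordinates centred at [x0], so that the algebra sees a sphere about the
    origin. *)
Definition evc (x0 : 'rV[R]_3) P (y : 'rV[R]_3) : R := peval (fun i => y 0 i - x0 0 i) P.
Definition evcv x0 u (y : 'rV[R]_3) : 'rV[R]_3 := \row_i evc x0 (u i) y.

Lemma is_derive_coord (y v : 'rV[R]_3) i :
  is_derive y v (fun y : 'rV[R]_3 => y 0 i) (v 0 i).
Proof.
have did : derivable (@id 'rV[R]_3) y v by exact: derivable_id.
apply: DeriveDef; first by have /derivable_mxP := did; exact.
have /(congr1 (fun M : 'rV[R]_3 => M 0 i)) := derive_mx did.
by rewrite (@derive_id _ _ y v) mxE => <-.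
Qed.

Lemma is_derive_evc x0 P (y v : 'rV[R]_3) :
  is_derive y v (evc x0 P) (\sum_i evc x0 (dd i P) y * v 0 i).
Proof.
apply: (@is_derive_peval _ _ (fun i (y : 'rV[R]_3) => y 0 i - x0 0 i)) => i.
rewrite -[v 0 i]subr0; apply: is_deriveB; exact: is_derive_coord.
Qed.

Lemma partial_evc x0 i P : partial i (evc x0 P) = evc x0 (dd i P).
Proof.
apply/funext => y; rewrite /partial; have [_ ->] := is_derive_evc x0 P y (delta_mx 0 i).
rewrite (bigD1 i)//= big1 ?addr0 => [|j ij]; rewrite mxE eqxx/= ?eqxx ?mulr1//.
by rewrite (negPf ij) mulr0.
Qed.

End calculus.

(** * Change of the centre of coordinates *)

Section translation.
Context {R : realType} {D : polyAlg R}.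
Implicit Types (P Q : D) (u : 'I_3 -> D) (a : 'rV[R]_3).

Lemma evcD a P Q y : evc a (P + Q) y = evc a P y + evc a Q y.
Proof. exact: pevalD. Qed.
Lemma evcB a P Q y : evc a (P - Q) y = evc a P y - evc a Q y.
Proof. exact: pevalB. Qed.
Lemma evcZ a c P y : evc a (c *: P) y = c * evc a P y.
Proof. exact: pevalZ. Qed.
Lemma evcM a P Q y : evc a (P * Q) y = evc a P y * evc a Q y.
Proof. exact: pevalM. Qed.
Lemma evc1 a y : evc a (1 : D) y = 1.
Proof. exact: peval1. Qed.
Lemma evc0 a y : evc a (0 : D) y = 0.
Proof. exact: peval0. Qed.
Lemma evc_xx a i y : evc a (xx i : D) y = y 0 i - a 0 i.
Proof. exact: peval_xx. Qed.
Lemma evc_sum a y (I : Type) (r : seq I) (T : pred I) (F : I -> D) :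
  evc a (\sum_(i <- r | T i) F i) y = \sum_(i <- r | T i) evc a (F i) y.
Proof. exact: peval_sum. Qed.

Lemma translate_ex a P : exists Q, forall y, evc 0 Q y = evc a P y.
Proof.
elim/palg_ind : P => [|P Q [P' PE] [Q' QE]|c P [P' PE]|i P [P' PE]].
- by exists 1 => y; rewrite !evc1.
- by exists (P' + Q') => y; rewrite !evcD PE QE.
- by exists (c *: P') => y; rewrite !evcZ PE.
- exists ((xx i - (a 0 i)%:A) * P') => y; rewrite !evcM PE.
  by rewrite evcB !evc_xx evcZ evc1 mulr1 mxE subr0.
Qed.

(** The given system is homogeneous about the origin, the boundary analysis is about [x0]; this
    passes from one to the other. *)
Definition translate a P : D := projT1 (cid (translate_ex a P)).

Lemma translateE a P : evc 0 (translate a P) = evc a P.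
Proof. by apply/funext => y; exact: (projT2 (cid (translate_ex a P))). Qed.

Lemma evc_inj P Q : (forall y, evc 0 P y = evc 0 Q y) -> P = Q.
Proof.
move=> PQ; apply/eqP; rewrite -subr_eq0; apply/eqP/peval_eq0 => z.
have := PQ (\row_i z i); rewrite /evc => E; rewrite pevalB.
have -> : z = fun i => (\row_i z i : 'rV[R]_3) 0 i - (0 : 'rV[R]_3) 0 i.
  by apply/funext => i; rewrite !mxE subr0.
by rewrite E subrr.
Qed.

Lemma dd_translate a i P : dd i (translate a P) = translate a (dd i P).
Proof. by apply: evc_inj => y; rewrite -partial_evc !translateE partial_evc. Qed.
Lemma translateD a P Q : translate a (P + Q) = translate a P + translate a Q.
Proof. by apply: evc_inj => y; rewrite evcD !translateE evcD. Qed.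
Lemma translateZ a c P : translate a (c *: P) = c *: translate a P.
Proof. by apply: evc_inj => y; rewrite evcZ !translateE evcZ. Qed.

Lemma sol_translate lam mu a u : sol lam mu u -> sol lam mu (fun i => translate a (u i)).
Proof.
move=> su i; rewrite /Eop /lap /pdiv !sum_ax !dd_translate -!translateD !dd_translate.
rewrite -!translateZ -translateD.
have := su i; rewrite /Eop /lap /pdiv !sum_ax => ->.
by have := translateZ a 0 0; rewrite !scale0r.
Qed.

End translation.

Section differential_operators.
Context {R : realType} {D : polyAlg R}.
Implicit Types (P Q : D) (u v : 'I_3 -> D) (y : 'rV[R]_3).

Lemma laplacian_evc x0 P : laplacian (evc x0 P) = evc x0 (lap P).
Proof.
apply/funext => y; rewrite /laplacian /lap evc_sum; apply: eq_bigr => i _.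
by rewrite !partial_evc.
Qed.

Lemma evcv_coord x0 u i : (fun y => evcv x0 u y 0 i) = evc x0 (u i).
Proof. by apply/funext => y; rewrite mxE. Qed.

Lemma derive_evcv x0 u y (v : 'rV[R]_3) :
  'D_v (evcv x0 u) y = \row_i \sum_j evc x0 (dd j (u i)) y * v 0 j.
Proof.
have der i := is_derive_evc x0 (u i) y v.
have dv : derivable (evcv x0 u) y v.
  by apply/derivable_mxP => i j; rewrite ord1 evcv_coord; case: (der j).
apply/rowP => i; have /(congr1 (fun M : 'rV[R]_3 => M 0 i)) := derive_mx dv.
by rewrite !mxE evcv_coord => ->; case: (der i).
Qed.

Lemma div_evcv x0 u : div (evcv x0 u) = evc x0 (pdiv u).
Proof.
apply/funext => y; rewrite /div /pdiv evc_sum; apply: eq_bigr => i _.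
by rewrite evcv_coord partial_evc.
Qed.

Lemma vec3_0 (a b c : R) : vec3 a b c 0 o0 = a. Proof. by rewrite mxE inordK. Qed.
Lemma vec3_1 (a b c : R) : vec3 a b c 0 o1 = b. Proof. by rewrite mxE inordK. Qed.
Lemma vec3_2 (a b c : R) : vec3 a b c 0 o2 = c. Proof. by rewrite mxE inordK. Qed.
Definition vec3E := (vec3_0, vec3_1, vec3_2).

Lemma curl_evcv x0 u : curl (evcv x0 u) = evcv x0 (pcurl u).
Proof.
apply/funext => y; apply/rowP; rewrite /curl; apply: axP;
  by rewrite vec3E mxE pcrossE evcB !evcv_coord !partial_evc.
Qed.

Lemma cross_evcv x0 u v y :
  cross (evcv x0 u y) (evcv x0 v y) = evcv x0 (pcross u v) y.
Proof.
apply/rowP; rewrite /cross; apply: axP;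
  by rewrite vec3E [in RHS]mxE pcrossE evcB !evcM ![evcv _ _ _ _ _]mxE.
Qed.

Lemma dot_evcv x0 u v y : dot (evcv x0 u y) (evcv x0 v y) = evc x0 (pdot u v) y.
Proof.
by rewrite /dot /pdot evc_sum; apply: eq_bigr => i _; rewrite !mxE evcM.
Qed.

Lemma evcv_xx x0 y : evcv x0 (@xx R D) y = y - x0.
Proof. by apply/rowP => i; rewrite !mxE evc_xx. Qed.

Lemma evcvZ x0 c u y : evcv x0 (fun i => c *: u i) y = c *: evcv x0 u y.
Proof. by apply/rowP => i; rewrite !mxE evcZ. Qed.
Lemma evcvD x0 u v y : evcv x0 (fun i => u i + v i) y = evcv x0 u y + evcv x0 v y.
Proof. by apply/rowP => i; rewrite !mxE evcD. Qed.

Section boundary.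
Variables (lam mu r : R) (x0 : 'rV[R]_3).

Lemma sphere_normalE y : sphere_normal x0 r y = r^-1 *: evcv x0 (@xx R D) y.
Proof. by rewrite evcv_xx. Qed.

Lemma crossZl c (a b : 'rV[R]_3) : cross (c *: a) b = c *: cross a b.
Proof.
by apply/rowP; apply: axP; rewrite [in RHS]mxE /cross !vec3E !mxE; ring.
Qed.
Lemma dotZl c (a b : 'rV[R]_3) : dot (c *: a) b = c * dot a b.
Proof. by rewrite /dot mulr_sumr; apply: eq_bigr => i _; rewrite mxE mulrA. Qed.
Lemma dotZr c (a b : 'rV[R]_3) : dot a (c *: b) = c * dot a b.
Proof. by rewrite /dot mulr_sumr; apply: eq_bigr => i _; rewrite mxE mulrCA. Qed.
Lemma dotC (a b : 'rV[R]_3) : dot a b = dot b a.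
Proof. by apply: eq_bigr => i _; rewrite mulrC. Qed.

Lemma stress_evcv u y : stress lam mu (sphere_normal x0 r) (evcv x0 u) y =
  r^-1 *: evcv x0 (pstress lam mu u) y.
Proof.
rewrite /stress derive_evcv curl_evcv div_evcv sphere_normalE crossZl cross_evcv.
apply/rowP => i; rewrite !mxE /pstress !evcD !evcZ evcM /euler.
rewrite !mulrDr [in RHS]addrAC; congr (_ + _ + _); last 2 first.
- by ring.
- by ring.
rewrite evc_sum !mulr_sumr; apply: eq_bigr => j _; rewrite evcM !mxE; ring.
Qed.

Lemma normal_part_evcv u y :
  normal_part x0 r (evcv x0 u) y = r^-1 * evc x0 (pdot (@xx R D) u) y.
Proof. by rewrite /normal_part sphere_normalE dotZr dotC dot_evcv. Qed.

Definition ptang_stress u : 'I_3 -> D := fun i => r^-1 *: (pstress lam mu u i -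
  r ^- 2 *: (pdot (@xx R D) (pstress lam mu u) * xx i)).

Lemma tangential_stress_evcv u :
  tangential_stress x0 r lam mu (evcv x0 u) = evcv x0 (ptang_stress u).
Proof.
apply/funext => y; rewrite /tangential_stress stress_evcv sphere_normalE.
rewrite dotZl dotZr (dotC (evcv _ _ _)) dot_evcv.
apply/rowP => i; rewrite !mxE /ptang_stress evcZ evcB evcZ evcM.
by rewrite -exprVn; ring.
Qed.

End boundary.

Lemma grad_evc x0 P : grad (evc x0 P) = evcv x0 (pgrad P).
Proof. by apply/funext => y; apply/rowP => i; rewrite !mxE partial_evc. Qed.

Lemma dot_rho y : dot y y = evc 0 (rho : D) y.
Proof.
have {1 2}-> : y = evcv 0 (@xx R D) y by rewrite evcv_xx subr0.
by rewrite dot_evcv.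
Qed.

Lemma elastic_polynomialE lam mu k P j :
  elastic_polynomial lam mu k (evc 0 P) j =
  evcv 0 (elas lam mu k (fun i : 'I_3 => if i == j then P else 0)).
Proof.
apply/funext => y; rewrite /elastic_polynomial dot_rho partial_evc grad_evc.
apply/rowP => i; rewrite !mxE evcD evcZ evcM eqxx/= mulrA; congr (_ + _ * _).
  by case: eqP => _; rewrite ?evc0 ?mulr1 ?mulr0.
rewrite /pdiv /pgrad; congr (evc _ (dd _ _) _).
rewrite (bigD1 j)//= eqxx big1 ?addr0// => l /negPf ->; exact: dd0.
Qed.

End differential_operators.

Section harmonic.
Context {R : realType}.
Local Notation D := (mpolyAlg R).

Lemma harmonic_polynomialP k (f : 'rV[R]_3 -> R) :
  harmonic_polynomial k f <-> exists2 P : D, harm k%:R P & f = evc 0 P.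
Proof.
have ev0 (P : D) y : evc 0 P y = mpoly.meval (fun i => y 0 i) P.
  by rewrite /evc; congr (peval _ P); apply/funext => i; rewrite mxE subr0.
split=> [[[P hP fP] lf]|[P [wP lP] ->]].
  have {}fP : f = evc 0 (P : D) by apply/funext => y; rewrite ev0.
  exists P => //; split; first exact/homog_wt.
  by apply: evc_inj => y; rewrite -laplacian_evc -fP lf evc0.
split; last by move=> y; rewrite laplacian_evc lP evc0.
by exists P; [exact/homog_wt|move=> y; rewrite ev0].
Qed.

End harmonic.

(** * Integration over the sphere *)

Section density_transfer.
Local Open Scope ereal_scope.
Context d1 d2 (X : measurableType d1) (Y : measurableType d2) (R : realType).
Variables (mu : {measure set X -> \bar R}) (nu : {measure set Y -> \bar R}).
Variables (phi : X -> Y) (mphi : measurable_fun setT phi).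
Variables (D : set X) (mD : measurable D) (w : X -> R).
Hypotheses (mw : measurable_fun setT w) (w0 : forall t, D t -> (0 <= w t)%R).
Hypothesis nuE : forall A, measurable A ->
  nu A = \int[mu]_(t in D `&` phi @^-1` A) (w t)%:E.

Import HBNNSimple.

(** [nu] is the image under [phi] of the measure of density [w] on [D]. Increasing simple
    approximations reduce the formula to indicators, where it is [nuE]. *)
Lemma ge0_integral_transfer (f : Y -> \bar R) :
  measurable_fun setT f -> (forall y, 0 <= f y) ->
  \int[nu]_y f y = \int[mu]_(t in D) (f (phi t) * (w t)%:E).
Proof.
move=> mf f0; pose f_ := nnsfun_approx measurableT mf.
have f_cvg y : EFin \o f_^~ y @ \oo --> f y by exact: cvg_nnsfun_approx.
transitivity (limn (fun n => \int[nu]_y (f_ n y)%:E)).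
  rewrite -monotone_convergence//.
  - by apply: eq_integral => y _; apply/esym/cvg_lim => //; exact: f_cvg.
  - by move=> n; exact/measurable_EFinP/measurable_funP.
  - by move=> n y _; rewrite lee_fin.
  - by move=> y _ m n mn; rewrite lee_fin; exact/lefP/nd_nnsfun_approx.
have mfphi n : measurable_fun setT (f_ n \o phi) by exact: measurableT_comp.
rewrite [X in limn X](_ : _ =
    (fun n => \int[mu]_(t in D) (f_ n (phi t) * w t)%:E)).
  rewrite -monotone_convergence//; last 3 first.
  - move=> n; apply/measurable_EFinP/measurable_funTS/measurable_funM => //; exact: mfphi.
  - by move=> n t Dt; rewrite lee_fin mulr_ge0 ?w0.
  - move=> t Dt m n mn; rewrite lee_fin ler_wpM2r ?w0//; exact/lefP/nd_nnsfun_approx.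
  apply: eq_integral => t /[!inE] Dt; apply/cvg_lim => //.
  under eq_fun do rewrite EFinM.
  by apply: cvgeZr => //; exact: f_cvg.
apply/funext => n.
have mA k : measurable (f_ n @^-1` [set k]) by [].
transitivity (\sum_(k \in range (f_ n))
    \int[mu]_(t in D) (k * \1_(f_ n @^-1` [set k]) (phi t) * w t)%:E).
  under eq_integral do rewrite fimfunE -fsumEFin//.
  rewrite ge0_integral_fsum//; last 2 first.
  - by move=> y; exact/measurable_EFinP/measurable_funM.
  - by move=> y x _; rewrite nnfun_muleindic_ge0.
  apply: eq_fsbigr => k _; rewrite integralZl_indic_nnsfun// integral_indic// setIT nuE//.
  (* A negative k is not a value of the approximation and both sides are 0; a nonnegative one can be
     pulled out of the integral. *)
  have [k0|k0] := ltP k 0%R.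
    rewrite preimage_nnfun0// preimage_set0 setI0 integral_set0 mule0.
    by rewrite integral0_eq// => t _; rewrite indicE in_set0 mulr0 mul0r.
  rewrite integral_mkcondr -ge0_integralZl//; last 2 first.
  - apply/measurable_restrict => //; first by rewrite -[X in measurable X]setTI; exact: mphi.
    by apply/measurable_EFinP; apply: measurable_funS mw.
  - by move=> t Dt; rewrite patchE; case: ifP => // _; rewrite lee_fin w0.
  apply: eq_integral => t _; rewrite patchE indicE.
  rewrite (_ : (t \in phi @^-1` _) = (phi t \in f_ n @^-1` [set k]))//.
  by case: ifP => _; rewrite ?mule0 ?mulr1 ?mulr0 ?mul0r// EFinM.
rewrite -ge0_integral_fsum//.
- by apply: eq_integral => t _; rewrite fsumEFin// -mulr_fsuml// -fimfunE.
- move=> k; apply/measurable_EFinP/measurable_funTS/measurable_funM => //.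
  by apply: measurable_funM => //; apply: measurableT_comp.
- by move=> k t Dt; rewrite EFinM mule_ge0 ?lee_fin ?w0// -lee_fin nnfun_muleindic_ge0.
Qed.

Lemma integral_transfer (f : Y -> R) : measurable_fun setT f ->
  \int[nu]_y (f y)%:E = \int[mu]_(t in D) (f (phi t) * w t)%:E.
Proof.
move=> mf; rewrite integralE [RHS]integralE.
have mfE : measurable_fun setT (EFin \o f) by exact/measurable_EFinP.
rewrite !ge0_integral_transfer//; last 2 first.
- exact: measurable_funeneg.
- exact: measurable_funepos.
congr (_ - _); apply: eq_integral => t /[!inE] Dt.
- by rewrite !funeposE !EFinM maxe_pMl ?lee_fin ?w0// mul0e.
- by rewrite !funenegE EFinM -mulNe maxe_pMl ?lee_fin ?w0// mul0e.
Qed.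

End density_transfer.

Section angles_integral.
Context {R : realType}.
Local Notation leb := (@lebesgue_measure R).
Local Notation T2 := (measurableTypeR R * measurableTypeR R)%type.
Implicit Types (f : T2 -> R).

Lemma is_derive_continuous (f df : R -> R) :
  (forall t : R, is_derive t 1 f (df t)) -> continuous f.
Proof.
move=> h t; apply: differentiable_continuous; apply/derivable1_diffP.
by case: (h t).
Qed.

Lemma FTC_segment (F f : R -> R) (a c : R) : a < c -> (forall t : R, is_derive t 1 F (f t)) ->
  continuous f -> (\int[leb]_(t in `[a, c]) (f t)%:E = (F c - F a)%:E)%E.
Proof.
move=> ac dF cf; have cF := is_derive_continuous dF.
rewrite (continuous_FTC2 (F := F) ac) ?EFinB//.
- exact: continuous_subspaceT.
- split=> [t _||]; first by case: (dF t).
  + exact/cvg_at_right_filter/cF.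
  + exact/cvg_at_left_filter/cF.
- by move=> t _; rewrite derive1E; case: (dF t).
Qed.

Lemma angles_fin : ((leb \x leb)%E (angles : set T2) < +oo)%E.
Proof.
rewrite /angles product_measure1E//= !lebesgue_measure_itv/=.
by case: ifP => _; case: ifP => _; rewrite ?mule0 ?mul0e// -!EFinB -EFinM ltry.
Qed.

Lemma angles_integrable f : measurable_fun setT f -> (exists M, forall t, `|f t| <= M) ->
  (leb \x leb)%E.-integrable (angles : set T2) (EFin \o f).
Proof.
move=> mf [M fM]; apply: measurable_bounded_integrable.
- exact: measurable_angles.
- exact: angles_fin.
- exact: measurable_funTS.
- exists M; split; first exact: num_real.
  by move=> x Mx t _; exact: le_trans (fM t) (ltW Mx).
Qed.

Lemma angles_integrable_mkcond f : measurable_fun setT f ->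
  (exists M, forall t, `|f t| <= M) ->
  (leb \x leb)%E.-integrable setT ((EFin \o f) \_ (angles : set T2)).
Proof.
move=> mf bf; have mA : measurable (angles : set T2) by exact: measurable_angles.
exact: ((integrable_mkcond (EFin \o f) mA).1 (angles_integrable mf bf)).
Qed.

Lemma integral_angles_phi f (c : R) : measurable_fun setT f ->
  (exists M, forall t, `|f t| <= M) ->
  (forall a, 0 <= a <= pi -> (\int[leb]_(y in `[0%R, (2 * pi)%R]) (f (a, y))%:E = c%:E)%E) ->
  (\int[leb \x leb]_(t in angles) (f t)%:E = (pi * c)%:E)%E.
Proof.
move=> mf bf fc; have fi := angles_integrable_mkcond mf bf.
rewrite integral_mkcond -(integral12_prod_meas1 fi) /fubini_F.
transitivity (\int[leb]_(x in `[0%R, pi]) c%:E)%E.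
  rewrite [RHS]integral_mkcond; apply: eq_integral => x _.
  rewrite patchE; case: ifPn => [|xn].
    rewrite inE/= in_itv/= => xI; rewrite -(fc _ xI) [RHS]integral_mkcond.
    apply: eq_integral => y _; rewrite !patchE.
    rewrite (_ : ((x, y) \in angles) = (y \in `[0%R, (2 * pi)%R]%classic))//.
    by apply/idP/idP; rewrite !inE /angles/=; [case|move=> yI; split; rewrite //= in_itv].
  rewrite integral0_eq// => y _; rewrite patchE memNset// => -[/= xI _].
  by move/negP : xn; apply; rewrite inE.
rewrite integral_cst//= lebesgue_measure_itv/= lte_fin pi_gt0 oppr0 adde0 -EFinM.
by rewrite mulrC.
Qed.

Lemma integral_angles_theta f (c : R) : measurable_fun setT f ->
  (exists M, forall t, `|f t| <= M) ->
  (forall y, (\int[leb]_(a in `[0%R, pi]) (f (a, y))%:E = c%:E)%E) ->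
  (\int[leb \x leb]_(t in angles) (f t)%:E = (2 * pi * c)%:E)%E.
Proof.
move=> mf bf fc; have fi := angles_integrable_mkcond mf bf.
rewrite integral_mkcond -(integral21_prod_meas1 fi) /fubini_G.
transitivity (\int[leb]_(y in `[0%R, (2 * pi)%R]) c%:E)%E.
  rewrite [RHS]integral_mkcond; apply: eq_integral => y _.
  rewrite patchE; case: ifPn => [|yn].
    rewrite inE/= => yI; rewrite -(fc y) [RHS]integral_mkcond.
    apply: eq_integral => x _; rewrite !patchE.
    rewrite (_ : ((x, y) \in angles) = (x \in `[0%R, pi]%classic))//.
    by apply/idP/idP; rewrite !inE /angles/=; [case|split].
  rewrite integral0_eq// => x _; rewrite patchE memNset// => -[_ /= yI].
  by move/negP : yn; apply; rewrite inE.
have p2 : (0 < 2 * pi :> R) by rewrite mulr_gt0// pi_gt0.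
by rewrite integral_cst//= lebesgue_measure_itv/= lte_fin p2 oppr0 adde0 -EFinM mulrC.
Qed.

End angles_integral.

Section surface.
Context {R : realType} {D : polyAlg R}.
Implicit Types (P Q : D).
Variables (x0 : 'rV[R]_3) (r : R).
Hypothesis hr : 0 < r.
Local Notation S := (sphere_area x0 r).
Local Notation leb := (@lebesgue_measure R).

Definition sph (a y : R) : 'I_3 -> R := fun i =>
  r * vec3 (sin a * cos y) (sin a * sin y) (cos a) 0 i.

Lemma evc_spherical P t : evc x0 P (spherical x0 r t) = peval (sph t.1 t.2) P.
Proof.
rewrite /evc; congr (peval _ _); apply/funext => i.
by rewrite /spherical /sph !mxE addrAC subrr add0r.
Qed.

Lemma sph_norm a y : \sum_i sph a y i * sph a y i = r ^+ 2.
Proof.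
rewrite sum_ax /sph !vec3E.
have := cos2Dsin2 a; have := cos2Dsin2 y => hy ha.
transitivity (r ^+ 2 * (sin a ^+ 2 * (cos y ^+ 2 + sin y ^+ 2) + cos a ^+ 2)); first by ring.
by rewrite hy mulr1 addrC ha mulr1.
Qed.

Lemma measurable_peval d (T : measurableType d) (f : 'I_3 -> T -> R) P :
  (forall i, measurable_fun setT (f i)) ->
  measurable_fun setT (fun t => peval (f^~ t) P).
Proof.
move=> mf; elim/palg_ind : P => [|P Q mP mQ|c P mP|i P mP].
- by under eq_fun do rewrite peval1; exact: measurable_cst.
- by under eq_fun do rewrite pevalD; exact: measurable_funD.
- by under eq_fun do rewrite pevalZ; exact: measurable_funM.
- by under eq_fun do rewrite pevalM peval_xx; exact: measurable_funM.
Qed.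

Lemma bounded_peval (I : Type) (f : 'I_3 -> I -> R) P :
  (exists C, forall i t, `|f i t| <= C) ->
  exists M, forall t, `|peval (f^~ t) P| <= M.
Proof.
move=> [C fC]; elim/palg_ind : P => [|P Q [M MP] [N NQ]|c P [M MP]|i P [M MP]].
- by exists 1 => t; rewrite peval1 normr1.
- by exists (M + N) => t; rewrite pevalD (le_trans (ler_normD _ _))// lerD.
- by exists (`|c| * M) => t; rewrite pevalZ normrM ler_wpM2l.
- by exists (C * M) => t; rewrite pevalM peval_xx normrM ler_pM.
Qed.

Lemma sph_bounded P : exists M, forall a y, `|peval (sph a y) P| <= M.
Proof.
have [|M MP] := @bounded_peval (R * R) (fun i t => sph t.1 t.2 i) P.
  exists r => i t; rewrite /sph normrM gtr0_norm// ler_piMr ?(ltW hr)//.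
  have sc (a b : R) : `|a| <= 1 -> `|b| <= 1 -> `|a * b| <= 1.
    by move=> ha hb; rewrite normrM mulr_ile1.
  have s1 (a : R) : `|sin a| <= 1 by rewrite ler_norml sin_geN1 sin_le1.
  have c1 (a : R) : `|cos a| <= 1 by rewrite ler_norml cos_geN1 cos_le1.
  by elim/axP : i; rewrite vec3E ?sc.
by exists M => a y; exact: (MP (a, y)).
Qed.

Lemma measurable_sin1 : measurable_fun setT (fun t : R * R => sin t.1).
Proof. by apply: measurableT_comp => //; apply: continuous_measurable_fun; exact: continuous_sin. Qed.
Lemma measurable_cos1 : measurable_fun setT (fun t : R * R => cos t.1).
Proof. by apply: measurableT_comp => //; apply: continuous_measurable_fun; exact: continuous_cos. Qed.
Lemma measurable_sin2 : measurable_fun setT (fun t : R * R => sin t.2).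
Proof. by apply: measurableT_comp => //; apply: continuous_measurable_fun; exact: continuous_sin. Qed.
Lemma measurable_cos2 : measurable_fun setT (fun t : R * R => cos t.2).
Proof. by apply: measurableT_comp => //; apply: continuous_measurable_fun; exact: continuous_cos. Qed.

Lemma measurable_sph P : measurable_fun setT (fun t : R * R => peval (sph t.1 t.2) P).
Proof.
apply: (@measurable_peval _ _ (fun i (t : R * R) => sph t.1 t.2 i)) => i.
apply: measurable_funM => //; elim/axP : i; under eq_fun do rewrite vec3E.
- exact: measurable_funM measurable_sin1 measurable_cos2.
- exact: measurable_funM measurable_sin1 measurable_sin2.
- exact: measurable_cos1.
Qed.

(** The partial derivatives of [sph] in the polar angle and, below, in the azimuth. *)
Definition dth (a y : R) : 'I_3 -> R := fun i =>
  r * vec3 (cos a * cos y) (cos a * sin y) (- sin a) 0 i.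
Definition dph (a y : R) : 'I_3 -> R := fun i =>
  r * vec3 (- (sin a * sin y)) (sin a * cos y) 0 0 i.

Lemma is_derive_theta P (a y : R) :
  is_derive a 1 (fun a : R => peval (sph a y) P) (\sum_i peval (sph a y) (dd i P) * dth a y i).
Proof.
apply: (@is_derive_peval _ _ _ P (fun i a => sph a y i)) => i.
rewrite /sph /dth; elim/axP : i; rewrite !vec3E; under eq_fun do rewrite vec3E;
  by apply: is_derive_eq; rewrite /GRing.scale/=; ring.
Qed.

Lemma is_derive_phi P (a y : R) :
  is_derive y 1 (fun y : R => peval (sph a y) P) (\sum_i peval (sph a y) (dd i P) * dph a y i).
Proof.
apply: (@is_derive_peval _ _ _ P (fun i y => sph a y i)) => i.
rewrite /sph /dph; elim/axP : i; rewrite !vec3E; under eq_fun do rewrite vec3E;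
  by apply: is_derive_eq; rewrite /GRing.scale/=; ring.
Qed.

End surface.

Section surface.
Context {R : realType} {D : polyAlg R}.
Local Notation T2 := (measurableTypeR R * measurableTypeR R)%type.
Implicit Types (P Q : D) (f g : T2 -> R).
Variables (x0 : 'rV[R]_3) (r : R).
Hypothesis hr : 0 < r.
Local Notation S := (sphere_area x0 r).
Local Notation leb := (@lebesgue_measure R).
Local Notation x := (@xx R D).

(** What Fubini and the fundamental theorem of calculus in each angle require, in a form stable
    under sums and products. *)
Definition nice f := [/\ measurable_fun setT f, exists M, forall t, `|f t| <= M,
  forall a, continuous (fun y : R => f (a, y)) &
  forall y, continuous (fun a : R => f (a, y))].

Lemma niceD f g : nice f -> nice g -> nice (fun t => f t + g t).
Proof.
move=> [mf [M fM] f1 f2] [mg [N gN] g1 g2]; split.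
- exact: measurable_funD.
- by exists (M + N) => t; rewrite (le_trans (ler_normD _ _))// lerD.
- by move=> a y; apply: continuousD; [exact: f1|exact: g1].
- by move=> y a; apply: continuousD; [exact: f2|exact: g2].
Qed.

Lemma niceM f g : nice f -> nice g -> nice (fun t => f t * g t).
Proof.
move=> [mf [M fM] f1 f2] [mg [N gN] g1 g2]; split.
- exact: measurable_funM.
- by exists (M * N) => t; rewrite normrM ler_pM.
- by move=> a y; apply: continuousM; [exact: f1|exact: g1].
- by move=> y a; apply: continuousM; [exact: f2|exact: g2].
Qed.

Lemma nice_cst (c : R) : nice (fun=> c).
Proof.
split; first exact: measurable_cst.
- by exists `|c|.
- by move=> a y; exact: cvg_cst.
- by move=> a y; exact: cvg_cst.
Qed.

Lemma nice_sin1 : nice (fun t => sin t.1).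
Proof.
split; first exact: measurable_sin1.
- by exists 1 => t; rewrite ler_norml sin_geN1 sin_le1.
- by move=> a y; exact: cst_continuous.
- by move=> y a; exact: continuous_sin.
Qed.
Lemma nice_cos1 : nice (fun t => cos t.1).
Proof.
split; first exact: measurable_cos1.
- by exists 1 => t; rewrite ler_norml cos_geN1 cos_le1.
- by move=> a y; exact: cst_continuous.
- by move=> y a; exact: continuous_cos.
Qed.
Lemma nice_sin2 : nice (fun t => sin t.2).
Proof.
split; first exact: measurable_sin2.
- by exists 1 => t; rewrite ler_norml sin_geN1 sin_le1.
- by move=> a y; exact: continuous_sin.
- by move=> a y; exact: cst_continuous.
Qed.
Lemma nice_cos2 : nice (fun t => cos t.2).
Proof.
split; first exact: measurable_cos2.
- by exists 1 => t; rewrite ler_norml cos_geN1 cos_le1.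
- by move=> a y; exact: continuous_cos.
- by move=> a y; exact: cst_continuous.
Qed.
Lemma nice_sph P : nice (fun t => peval (sph r t.1 t.2) P).
Proof.
split; first exact: measurable_sph.
- by have [M hM] := sph_bounded hr P; exists M => t; exact: hM.
- by move=> a; apply: is_derive_continuous => y; exact: is_derive_phi.
- by move=> y; apply: is_derive_continuous => a; exact: is_derive_theta.
Qed.

Lemma nice_sum (F : 'I_3 -> T2 -> R) : (forall i, nice (F i)) -> nice (fun t => \sum_i F i t).
Proof. by move=> nF; under eq_fun do rewrite sum_ax; do 2?apply: niceD. Qed.

Lemma nice_integral_phi (B : R -> R -> R) f : nice f ->
  (forall a y : R, is_derive y 1 (B a) (f (a, y))) -> (forall a, B a (2 * pi) = B a 0) ->
  (\int[leb \x leb]_(t in angles) (f t)%:E = 0)%E.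
Proof.
move=> [mf bf f1 _] dB B0; rewrite (integral_angles_phi (c := 0))// ?mulr0// => a _.
have p2 : (0 < 2 * pi :> R) by rewrite mulr_gt0// pi_gt0.
by rewrite (FTC_segment p2 (dB a) (f1 a)) B0 subrr.
Qed.

Lemma nice_integral_theta (A : R -> R -> R) f (c : R) : nice f ->
  (forall a y : R, is_derive a 1 (A^~ y) (f (a, y))) -> (forall y, A pi y - A 0 y = c) ->
  (\int[leb \x leb]_(t in angles) (f t)%:E = (2 * pi * c)%:E)%E.
Proof.
move=> [mf bf _ f2] dA A0; rewrite (integral_angles_theta (c := c))// => y.
by rewrite (FTC_segment (pi_gt0 R) (dA^~ y) (f2 y)) A0.
Qed.

Lemma measurable_coord i : measurable_fun setT (fun y : borel3 R => y 0 i).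
Proof.
apply: (measurability (@RGenOInfty.G R)); first exact: RGenOInfty.measurableE.
move=> _ [_ [a ->] <-]; rewrite setTI; apply: sub_sigma_algebra.
apply: (@open_comp _ _ (fun y : 'rV[R]_3 => y 0 i)); last exact: interval_open.
by move=> y _; exact: coord_continuous.
Qed.

Lemma measurable_evc P : measurable_fun setT (evc x0 P : borel3 R -> R).
Proof.
apply: (@measurable_peval _ _ _ _ (fun i (y : borel3 R) => y 0 i - x0 0 i)) => i.
by apply: measurable_funB; [exact: measurable_coord|exact: measurable_cst].
Qed.

Lemma surface_integralE P :
  (\int[S]_y (evc x0 P y)%:E =
   \int[leb \x leb]_(t in angles) (peval (sph r t.1 t.2) P * (r ^+ 2 * sin t.1))%:E)%E.
Proof.
have mw : measurable_fun setT (fun t : T2 => r ^+ 2 * sin t.1).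
  by have [] := niceM (nice_cst (r ^+ 2)) nice_sin1.
have w0 (t : T2) : angles t -> 0 <= r ^+ 2 * sin t.1.
  by move=> /angles_sin_ge0 t0; rewrite mulr_ge0// sqr_ge0.
have mP : measurable_fun setT (evc x0 P : borel3 R -> R).
  exact: measurable_evc.
have ms : measurable_fun setT (spherical x0 r : T2 -> borel3 R) by exact: measurable_spherical.
have mA : measurable (angles : set T2) by exact: measurable_angles.
rewrite (@integral_transfer _ _ _ _ R (leb \x leb)%E S (spherical x0 r) ms angles mA _ mw w0 _ _ mP)//.
by apply: eq_integral => t _; rewrite evc_spherical.
Qed.

Definition weight (t : T2) : R := r ^+ 2 * sin t.1.
(** The surface integral as a real-valued functional, in the role of [L]; [sphintE] links it to
    [sphere_area]. *)
Definition sphint P : R :=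
  \int[(leb \x leb)%E]_(t in angles) (peval (sph r t.1 t.2) P * weight t).

Lemma nice_weight P : nice (fun t => peval (sph r t.1 t.2) P * weight t).
Proof. exact: niceM (nice_sph P) (niceM (nice_cst _) nice_sin1). Qed.

Lemma nice_integrable f : nice f -> (leb \x leb)%E.-integrable (angles : set T2) (EFin \o f).
Proof. by move=> [mf bf _ _]; exact: angles_integrable. Qed.

Lemma sphintE P : (\int[S]_y (evc x0 P y)%:E = (sphint P)%:E)%E.
Proof.
rewrite surface_integralE /sphint /Rintegral fineK//.
apply: integrable_fin_num; first exact: measurable_angles.
exact: nice_integrable (nice_weight P).
Qed.

Lemma sphintD P Q : sphint (P + Q) = sphint P + sphint Q.
Proof.
rewrite /sphint; under eq_Rintegral do rewrite pevalD mulrDl.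
apply: RintegralD; first exact: measurable_angles.
- exact: nice_integrable (nice_weight P).
- exact: nice_integrable (nice_weight Q).
Qed.

Lemma sphintZ c P : sphint (c *: P) = c * sphint P.
Proof.
rewrite /sphint; under eq_Rintegral do rewrite pevalZ -mulrA.
apply: RintegralZl; first exact: measurable_angles.
exact: nice_integrable (nice_weight P).
Qed.

Lemma sphint_on_sphere P Q : on_sphere (r ^+ 2) P Q -> sphint P = sphint Q.
Proof.
by move=> PQ; apply: eq_Rintegral => t _; rewrite PQ// sph_norm.
Qed.

Lemma sphint_split0 f g P : nice f -> nice g ->
  (forall t, peval (sph r t.1 t.2) P * weight t = f t + g t) ->
  (\int[leb \x leb]_(t in angles) (f t)%:E = 0)%E ->
  (\int[leb \x leb]_(t in angles) (g t)%:E = 0)%E -> sphint P = 0.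
Proof.
move=> nf ng Pfg f0 g0; rewrite /sphint; under eq_Rintegral do rewrite Pfg.
have mA : measurable (angles : set T2) by exact: measurable_angles.
rewrite (RintegralD mA (nice_integrable nf) (nice_integrable ng)).
by rewrite /Rintegral f0 g0 addr0.
Qed.

Definition dP_th P (t : T2) := \sum_i peval (sph r t.1 t.2) (dd i P) * dth r t.1 t.2 i.
Definition dP_ph P (t : T2) := \sum_i peval (sph r t.1 t.2) (dd i P) * dph r t.1 t.2 i.

Lemma nice_dth P : nice (dP_th P).
Proof.
apply: nice_sum => i; apply: niceM; first exact: nice_sph.
apply: niceM; first exact: nice_cst.
elim/axP : i; under [X in nice X]eq_fun do rewrite vec3E.
- exact: niceM nice_cos1 nice_cos2.
- exact: niceM nice_cos1 nice_sin2.
- under [X in nice X]eq_fun do rewrite -mulN1r.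
  exact: niceM (nice_cst _) nice_sin1.
Qed.

Lemma nice_dph P : nice (dP_ph P).
Proof.
apply: nice_sum => i; apply: niceM; first exact: nice_sph.
apply: niceM; first exact: nice_cst.
elim/axP : i; under [X in nice X]eq_fun do rewrite vec3E.
- under [X in nice X]eq_fun do rewrite -mulN1r.
  exact: niceM (nice_cst _) (niceM nice_sin1 nice_sin2).
- exact: niceM nice_sin1 nice_cos2.
- exact: nice_cst.
Qed.

Lemma sin_2pi : sin (2 * pi) = 0 :> R. Proof. by rewrite mulr_natl sin2pi. Qed.
Lemma cos_2pi : cos (2 * pi) = 1 :> R. Proof. by rewrite mulr_natl cos2pi. Qed.
Lemma sph_period (a : R) P : peval (sph r a (2 * pi)) P = peval (sph r a 0) P.
Proof. by rewrite /sph sin_2pi cos_2pi sin0 cos0. Qed.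

(** Rotation about the polar axis is the derivative in phi, and the area density does not depend on
    phi. *)
Lemma sphint_rot01 P : sphint (x o0 * dd o1 P - x o1 * dd o0 P) = 0.
Proof.
have nf : nice (fun t => weight t * dP_ph P t).
  exact: niceM (niceM (nice_cst _) nice_sin1) (nice_dph P).
apply: (sphint_split0 (f := fun t => weight t * dP_ph P t) (g := fun=> 0)) => //.
- exact: nice_cst.
- move=> t; rewrite pevalB !pevalM !peval_xx /dP_ph /sph /dph sum_ax !vec3E; ring.
- apply: (nice_integral_phi (B := fun a y => weight (a, y) * peval (sph r a y) P)) => //.
    move=> a y; have h := is_derive_phi r P a y; rewrite /weight/= /dP_ph.
    by apply: is_derive_eq; rewrite /GRing.scale/=; ring.
  by move=> a; congr (_ * _); exact: sph_period.
- by rewrite integral0.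
Qed.

(* sin(theta) (x_1 d_2 - x_2 d_1) P =
     d_theta (- sin(theta) sin(phi) P) + d_phi (- cos(theta) cos(phi) P). *)
Lemma sphint_rot12 P : sphint (x o1 * dd o2 P - x o2 * dd o1 P) = 0.
Proof.
pose p (t : T2) := peval (sph r t.1 t.2) P.
pose f t := r ^+ 2 * (-1 * (sin t.2 * (cos t.1 * p t + sin t.1 * dP_th P t))).
pose g t := r ^+ 2 * (cos t.1 * (sin t.2 * p t + -1 * (cos t.2 * dP_ph P t))).
have np : nice p by exact: nice_sph.
have nf : nice f.
  apply: niceM (nice_cst _) (niceM (nice_cst _) (niceM nice_sin2 (niceD _ _))).
    exact: niceM nice_cos1 np.
  exact: niceM nice_sin1 (nice_dth P).
have ng : nice g.
  apply: niceM (nice_cst _) (niceM nice_cos1 (niceD (niceM nice_sin2 np) _)).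
  exact: niceM (nice_cst _) (niceM nice_cos2 (nice_dph P)).
apply: (sphint_split0 nf ng).
- move=> t; rewrite /f /g /weight pevalB !pevalM !peval_xx /dP_ph /dP_th /sph /dph /dth.
  rewrite !sum_ax !vec3E -/(sph _ _ _).
  (* The two sides agree only modulo cos^2 + sin^2 = 1, so their difference is exhibited as a
     multiple of this relation. *)
  apply/eqP; rewrite -subr_eq0; apply/eqP.
  transitivity (r ^+ 3 * (sin t.1 * cos t.1) * peval (sph r t.1 t.2) (dd o1 P) *
    (cos t.2 ^+ 2 + sin t.2 ^+ 2 - 1)); last by rewrite cos2Dsin2 subrr mulr0.
  ring.
- pose A (a y : R) := r ^+ 2 * (- (sin a * sin y * p (a, y))).
  have dA (a y : R) : is_derive a 1 (A^~ y) (f (a, y)).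
    have h := is_derive_theta r P a y; rewrite /A /f /p /= /dP_th.
    by apply: is_derive_eq; rewrite /GRing.scale/=; ring.
  rewrite (nice_integral_theta (c := 0) nf dA) ?mulr0// => y.
  by rewrite /A sinpi sin0 !mul0r subrr.
- pose B (a y : R) := r ^+ 2 * (- (cos a * cos y * p (a, y))).
  have dB (a y : R) : is_derive y 1 (B a) (g (a, y)).
    have h := is_derive_phi r P a y; rewrite /B /g /p /= /dP_ph.
    by apply: is_derive_eq; rewrite /GRing.scale/=; ring.
  by apply: (nice_integral_phi ng dB) => a; rewrite /B /p/= sph_period cos_2pi cos0.
Qed.

(** sin(theta) (x_2 d_0 - x_0 d_2) P = d_theta (sin(theta) cos(phi) P) + d_phi (- cos(theta)
    sin(phi) P). *)
Lemma sphint_rot20 P : sphint (x o2 * dd o0 P - x o0 * dd o2 P) = 0.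
Proof.
pose p (t : T2) := peval (sph r t.1 t.2) P.
pose f t := r ^+ 2 * (cos t.2 * (cos t.1 * p t + sin t.1 * dP_th P t)).
pose g t := r ^+ 2 * (-1 * (cos t.1 * (cos t.2 * p t + sin t.2 * dP_ph P t))).
have np : nice p by exact: nice_sph.
have nf : nice f.
  apply: niceM (nice_cst _) (niceM nice_cos2 (niceD _ _)).
    exact: niceM nice_cos1 np.
  exact: niceM nice_sin1 (nice_dth P).
have ng : nice g.
  apply: niceM (nice_cst _) (niceM (nice_cst _) (niceM nice_cos1 (niceD (niceM nice_cos2 np) _))).
  exact: niceM nice_sin2 (nice_dph P).
apply: (sphint_split0 nf ng).
- move=> t; rewrite /f /g /weight pevalB !pevalM !peval_xx /dP_ph /dP_th /sph /dph /dth.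
  rewrite !sum_ax !vec3E -/(sph _ _ _).
  apply/eqP; rewrite -subr_eq0; apply/eqP.
  transitivity (- r ^+ 3 * (sin t.1 * cos t.1) * peval (sph r t.1 t.2) (dd o0 P) *
    (cos t.2 ^+ 2 + sin t.2 ^+ 2 - 1)); last by rewrite cos2Dsin2 subrr mulr0.
  ring.
- pose A (a y : R) := r ^+ 2 * (sin a * cos y * p (a, y)).
  have dA (a y : R) : is_derive a 1 (A^~ y) (f (a, y)).
    have h := is_derive_theta r P a y; rewrite /A /f /p /= /dP_th.
    by apply: is_derive_eq; rewrite /GRing.scale/=; ring.
  rewrite (nice_integral_theta (c := 0) nf dA) ?mulr0// => y.
  by rewrite /A sinpi sin0 !mul0r subrr.
- pose B (a y : R) := r ^+ 2 * (- (cos a * sin y * p (a, y))).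
  have dB (a y : R) : is_derive y 1 (B a) (g (a, y)).
    have h := is_derive_phi r P a y; rewrite /B /g /p /= /dP_ph.
    by apply: is_derive_eq; rewrite /GRing.scale/=; ring.
  by apply: (nice_integral_phi ng dB) => a; rewrite /B sin_2pi sin0 !(mul0r, mulr0).
Qed.

Lemma sphint_rot i j P : sphint (x i * dd j P - x j * dd i P) = 0.
Proof.
have N k l : sphint (x k * dd l P - x l * dd k P) = 0 ->
    sphint (x l * dd k P - x k * dd l P) = 0.
  by move=> h; rewrite -opprB -scaleN1r sphintZ h mulr0.
have Z k : sphint (x k * dd k P - x k * dd k P) = 0.
  by rewrite subrr -(scale0r (0 : D)) sphintZ mul0r.
move: (sphint_rot01 P) (sphint_rot12 P) (sphint_rot20 P) => h01 h12 h20.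
have {N}h : [/\ sphint (x o1 * dd o0 P - x o0 * dd o1 P) = 0,
    sphint (x o2 * dd o1 P - x o1 * dd o2 P) = 0 &
    sphint (x o0 * dd o2 P - x o2 * dd o0 P) = 0] by split; apply: N.
case: h => h10 h21 h02; elim/axP : i; elim/axP : j;
  [exact: Z|exact: h01|exact: h02|exact: h10|exact: Z|exact: h12|exact: h20|exact: h21|exact: Z].
Qed.

Lemma sphint1 : 0 < sphint 1.
Proof.
suff -> : sphint 1 = 2 * pi * (r ^+ 2 * 2).
  by rewrite !mulr_gt0// ?pi_gt0// exprn_gt0.
rewrite /sphint; under eq_Rintegral do rewrite peval1 mul1r.
have nw : nice weight by exact: niceM (nice_cst _) nice_sin1.
pose A (a y : R) := - (r ^+ 2 * cos a).
have dA (a y : R) : is_derive a 1 (A^~ y) (weight (a, y)).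
  by rewrite /A; apply: is_derive_eq; rewrite /GRing.scale/= /weight/=; ring.
rewrite /Rintegral (nice_integral_theta (c := r ^+ 2 * 2) nw dA)// => y.
by rewrite /A cospi cos0; ring.
Qed.

End surface.

(** * Density of polynomials *)

Section Lp_density.
Context {R : realType} d (T : measurableType d).
Variables (mu : {measure set T -> \bar R}) (p : R).
Hypotheses (mufin : (mu setT < +oo)%E) (p1 : 1 <= p).
Implicit Types (f g H : T -> R) (A B : set T).

Let p0 : 0 < p. Proof. exact: lt_le_trans p1. Qed.

Definition powint f : \bar R := (\int[mu]_y (`|f y| `^ p)%:E)%E.

Lemma measurable_powabs f : measurable_fun setT f ->
  measurable_fun setT (fun y => `|f y| `^ p).
Proof.
by move=> mf; apply: (@measurableT_comp _ _ _ _ _ _ (@powR R ^~ p)) => //; exact: measurableT_comp.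
Qed.

Lemma measurable_powabsE f : measurable_fun setT f ->
  measurable_fun setT (fun y => (`|f y| `^ p)%:E).
Proof. by move=> mf; apply/measurable_EFinP; exact: measurable_powabs. Qed.

Lemma powint_ge0 f : (0 <= powint f)%E.
Proof. by apply: integral_ge0 => y _; rewrite lee_fin powR_ge0. Qed.

Lemma Lnorm_powint f : ('N[mu]_(p%:E) [EFin \o f] = powint f `^ p^-1)%E.
Proof.
by rewrite unlock.
Qed.

Lemma powint_Lnorm f : (powint f = 'N[mu]_(p%:E) [EFin \o f] `^ p)%E.
Proof.
by rewrite poweR_Lnorm ?gt_eqF.
Qed.

Lemma powint_le f g : measurable_fun setT f -> measurable_fun setT g ->
  {ae mu, forall y, `|f y| <= `|g y|} -> (powint f <= powint g)%E.
Proof.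
move=> mf mg fg; apply: ae_ge0_le_integral => //.
- exact: measurable_powabsE.
- exact: measurable_powabsE.
- apply: filterS fg => y fg _; rewrite lee_fin ge0_ler_powR ?nnegrE// ltW//.
Qed.

(** From |f + g| <= 2 max(|f|, |g|). The factor 2^p is harmless for density arguments, which can
    therefore work with p-th powers of norms. *)
Lemma powintD f g : measurable_fun setT f -> measurable_fun setT g ->
  (powint (fun y => f y + g y)%R <= (2 `^ p)%:E * (powint f + powint g))%E.
Proof.
move=> mf mg; rewrite /powint -ge0_integralD//; last 2 first.
- exact: measurable_powabsE.
- exact: measurable_powabsE.
have mS : measurable_fun setT (fun y => (`|f y| `^ p)%:E + (`|g y| `^ p)%:E)%E.
  by apply: emeasurable_funD; exact: measurable_powabsE.
rewrite -ge0_integralZl//; last by move=> y _; rewrite -EFinD lee_fin addr_ge0 ?powR_ge0.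
apply: ge0_le_integral => //.
- by apply: measurable_powabsE; exact: measurable_funD.
- exact: measurable_funeM.
move=> y _; rewrite -EFinD -EFinM lee_fin.
apply: (@le_trans _ _ ((2 * Num.max `|f y| `|g y|) `^ p)).
  have m0 : 0 <= Num.max `|f y| `|g y| by rewrite le_max normr_ge0.
  apply: ge0_ler_powR; rewrite ?nnegrE ?(ltW p0) ?mulr_ge0//.
  rewrite (le_trans (ler_normD _ _))// mulr_natl mulr2n lerD// le_max lexx ?orbT//.
rewrite powRM// ?le_max ?normr_ge0// ler_wpM2l ?powR_ge0//.
by case: (leP `|f y| `|g y|) => _; rewrite ?lerDl ?lerDr powR_ge0.
Qed.

Lemma powintZ (c : R) f : measurable_fun setT f ->
  (powint (fun y => c * f y)%R = (`|c| `^ p)%:E * powint f)%E.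
Proof.
move=> mf; rewrite /powint -ge0_integralZl//; last exact: measurable_powabsE.
by apply: eq_integral => y _; rewrite normrM powRM// EFinM.
Qed.

Lemma cvg_powabs (u : nat -> R) : u n @[n --> \oo] --> 0 ->
  `|u n| `^ p @[n --> \oo] --> 0.
Proof.
move=> u0; apply/cvgrPdist_le => e e0.
(* For |u| <= 1 and p >= 1 the power |u|^p is at most |u|. *)
have m0 : 0 < Num.min e 1 by rewrite lt_min e0 ltr01.
move/cvgrPdist_le : u0 => /(_ _ m0); apply: filterS => n.
rewrite !sub0r !normrN le_min => /andP[ue u1].
rewrite ger0_norm ?powR_ge0//; apply: le_trans ue.
have [->|un0] := eqVneq (u n) 0; first by rewrite normr0 powR0 ?gt_eqF.
by rewrite ge1r_powR// normr_gt0 un0.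
Qed.

Lemma powint_cvg (g_ : nat -> T -> R) f H :
  (forall n, measurable_fun setT (g_ n)) -> measurable_fun setT f ->
  measurable_fun setT H -> (powint H < +oo)%E ->
  {ae mu, forall y, g_ n y @[n --> \oo] --> f y} ->
  {ae mu, forall y n, `|f y - g_ n y| <= H y} ->
  forall e, 0 < e -> exists n, (powint (fun y => f y - g_ n y)%R < e%:E)%E.
Proof.
move=> mg mf mH iH gf gH e e0.
have mfg n : measurable_fun setT (fun y => f y - g_ n y) by exact: measurable_funB.
have [] := @dominated_convergence _ T R mu setT measurableT
  (fun n y => (`|f y - g_ n y| `^ p)%:E) (cst 0%E) (fun y => (`|H y| `^ p)%:E).
- by move=> n; exact: measurable_powabsE (mfg n).
- exact: measurable_cst.
- apply: filterS gf => y gf _; apply/cvg_EFin; first exact: nearW.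
  apply: cvg_powabs; rewrite -(subrr (f y)); apply: cvgB => //; exact: cvg_cst.
- apply/integrableP; split; first exact: measurable_powabsE.
  by under eq_integral do rewrite gee0_abs ?lee_fin ?powR_ge0//.
- apply: filterS gH => y gH n _; rewrite gee0_abs ?lee_fin ?powR_ge0//.
  apply: ge0_ler_powR; rewrite ?nnegrE ?(ltW p0)//.
  exact: le_trans (gH n) (ler_norm _).
move=> _ _; rewrite integral_cst// mul0e => /fine_cvgP[fin].
move/cvgrPdist_lt => /(_ _ e0) near_e.
have [n [/= fn en]] := filter_ex (filterI fin near_e).
exists n; rewrite /powint -(fineK fn) lte_fin; move: en; rewrite /= sub0r normrN.
exact: le_lt_trans (ler_norm _).
Qed.

Variable W : set (T -> R).
Hypotheses (mW : forall f, W f -> measurable_fun setT f)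
  (WD : forall f g, W f -> W g -> W (fun y => f y + g y))
  (WZ : forall (c : R) f, W f -> W (fun y => c * f y)).

Definition Lp_approx f := measurable_fun setT f /\
  forall e, 0 < e -> exists2 g, W g & (powint (fun y => f y - g y)%R < e%:E)%E.

Lemma Lp_approxW f : W f -> Lp_approx f.
Proof.
move=> Wf; split; first exact: mW.
move=> e e0; exists f => //; rewrite /powint integral0_eq ?lte_fin// => y _.
by rewrite subrr normr0 powR0// gt_eqF.
Qed.

Lemma lt_half_eps (e c : R) (a b : \bar R) : 0 < c -> (a < (e / (2 * c))%:E)%E ->
  (b < (e / (2 * c))%:E)%E -> (c%:E * (a + b) < e%:E)%E.
Proof.
move=> c0; have -> : e = c * (e / (2 * c) + e / (2 * c)) by field; rewrite gt_eqF.
set t := e / (2 * c) => at_ bt; rewrite EFinM lte_pmul2l ?lte_fin// EFinD.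
rewrite (_ : c * _ / _ = t) in at_ bt; first exact: lteD.
by rewrite /t; field; rewrite gt_eqF.
Qed.

Lemma Lp_approx_trans f : measurable_fun setT f ->
  (forall e, 0 < e -> exists2 g, Lp_approx g & (powint (fun y => f y - g y)%R < e%:E)%E) ->
  Lp_approx f.
Proof.
move=> mf fg; split=> // e e0.
have c0 : 0 < 2 `^ p :> R by rewrite powR_gt0.
have e2 : 0 < e / (2 * 2 `^ p) by rewrite divr_gt0// mulr_gt0.
have [g [mg ag] Ifg] := fg _ e2; have [h Wh Igh] := ag _ e2.
exists h => //; have mh := mW Wh.
have -> : (fun y => f y - h y) = (fun y => (f y - g y) + (g y - h y)).
  by apply/funext => y; rewrite addrA subrK.
apply: le_lt_trans (powintD _ _) _; [exact: measurable_funB|exact: measurable_funB|].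
exact: lt_half_eps c0 Ifg Igh.
Qed.

Lemma Lp_approxD f g : Lp_approx f -> Lp_approx g -> Lp_approx (fun y => f y + g y).
Proof.
move=> [mf af] [mg ag]; split; first exact: measurable_funD.
move=> e e0; have c0 : 0 < 2 `^ p :> R by rewrite powR_gt0.
have e2 : 0 < e / (2 * 2 `^ p) by rewrite divr_gt0// mulr_gt0.
have [f' Wf' If] := af _ e2; have [g' Wg' Ig] := ag _ e2.
exists (fun y => f' y + g' y); first exact: WD.
have -> : (fun y => f y + g y - (f' y + g' y)) = (fun y => (f y - f' y) + (g y - g' y)).
  by apply/funext => y; ring.
have mf' := mW Wf'; have mg' := mW Wg'.
apply: le_lt_trans (powintD _ _) _; [exact: measurable_funB|exact: measurable_funB|].
exact: lt_half_eps c0 If Ig.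
Qed.

Lemma Lp_approxZ (c : R) f : Lp_approx f -> Lp_approx (fun y => c * f y).
Proof.
(* The summand 1 in the divisor below keeps it positive also for c = 0. *)
move=> [mf af]; split; first exact: measurable_funM.
move=> e e0; have c0 : 0 < `|c| `^ p + 1 by rewrite ltr_pwDr// powR_ge0.
have [g Wg Ig] := af _ (divr_gt0 e0 c0); exists (fun y => c * g y); first exact: WZ.
have -> : (fun y => c * f y - c * g y) = (fun y => c * (f y - g y)).
  by apply/funext => y; rewrite mulrBr.
rewrite powintZ; last exact/measurable_funB/mW.
apply: (@le_lt_trans _ _ ((`|c| `^ p + 1)%:E * powint (fun y => (f y - g y)%R)))%E.
  by rewrite lee_wpmul2r ?powint_ge0// lee_fin lerDl.
by rewrite -lte_pdivlMl// -EFinM mulrC.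
Qed.

Lemma Lp_approx_cvg (g_ : nat -> T -> R) f H :
  (forall n, Lp_approx (g_ n)) -> measurable_fun setT f ->
  measurable_fun setT H -> (powint H < +oo)%E ->
  {ae mu, forall y, g_ n y @[n --> \oo] --> f y} ->
  {ae mu, forall y n, `|f y - g_ n y| <= H y} -> Lp_approx f.
Proof.
move=> ag mf mH iH gf gH; apply: (Lp_approx_trans mf) => e e0.
have [|n hn] := powint_cvg _ mf mH iH gf gH e0; first by move=> n; case: (ag n).
by exists (g_ n); [exact: ag|exact: hn].
Qed.

Lemma powint_cst (c : R) : (powint (fun=> c) < +oo)%E.
Proof.
by rewrite /powint integral_cst// lte_mul_pinfty ?lee_fin ?powR_ge0.
Qed.

Variable G : set (set T).
Hypotheses (GI : setI_closed G) (GE : @measurable _ T = <<s G >>).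
Hypotheses (W1 : Lp_approx (fun=> 1)) (WG : forall A, G A -> Lp_approx \1_A).

(** The sets with approximable indicator form a lambda-system: proper differences by linearity,
    increasing unions by dominated convergence. It contains the generating pi-system [G]. *)
Lemma Lp_approx_indic A : measurable A -> Lp_approx \1_A.
Proof.
move=> mA; suff: <<s G >> `<=` [set A | measurable A /\ Lp_approx \1_A].
  by move=> /(_ A); rewrite -GE => /(_ mA)[].
apply: (@lambda_system_subset T G GI setT); last 1 first.
- by move=> B _.
- split.
  + by move=> B _.
  + split; first exact: measurableT.
    by rewrite indicT; exact: W1.
  + move=> B C CB [mB aB] [mC aC]; split; first exact: measurableD.
    rewrite (_ : \1_(B `\` C) = (fun y => \1_B y + -1 * \1_C y)); last first.
      apply/funext => y; rewrite !indicE in_setD mulN1r.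
      have [/set_mem /CB yB|yC] := boolP (y \in C); last by rewrite andbT subr0.
      by rewrite (mem_set yB) subrr.
    exact: (Lp_approxD aB (Lp_approxZ (-1) aC)).
  + move=> F ndF FE; have mF : measurable (\bigcup_i F i).
      by apply: bigcup_measurable => i _; case: (FE i).
    split; first exact: mF.
    apply: (@Lp_approx_cvg (fun n => \1_(F n)) _ (fun=> 1)).
    * by move=> n; case: (FE n).
    * exact: measurable_indic.
    * exact: measurable_cst.
    * exact: powint_cst.
    * apply: nearW => y; have [[i _ Fiy]|nF] := pselect ((\bigcup_i F i) y).
        rewrite indicE mem_set; last by exists i.
        apply: cvg_near_cst; exists i => // n /= ni; rewrite indicE mem_set//.
        by have /subsetPset := ndF _ _ ni; apply.
      rewrite indicE memNset//; apply: cvg_near_cst; apply: nearW => n.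
      by rewrite indicE memNset// => Fny; apply: nF; exists n.
    * apply: nearW => y n; rewrite !indicE.
      by case: (_ \in _); case: (_ \in _); rewrite ?subrr ?subr0 ?sub0r ?normrN ?normr0 ?normr1.
- by move=> B GB; split; [rewrite GE; exact: sub_sigma_algebra|exact: WG].
Qed.

Import HBNNSimple.

Lemma Lp_approx_sum (I : Type) (r : seq I) (F : I -> T -> R) : (forall i, Lp_approx (F i)) ->
  Lp_approx (fun y => \sum_(i <- r) F i y).
Proof.
move=> aF; elim: r => [|i r IH].
  have := Lp_approxZ 0 W1; congr Lp_approx; apply/funext => y.
  by rewrite big_nil mul0r.
have := Lp_approxD (aF i) IH; congr Lp_approx; apply/funext => y.
by rewrite big_cons.
Qed.

Lemma Lp_approx_nnsfun (h : {nnsfun T >-> R}) : Lp_approx h.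
Proof.
pose s := fset_set (h @` setT).
rewrite (_ : (h : T -> R) = (fun y =>
    \sum_(i < #|`s|) (s`_i * \1_(h @^-1` [set s`_i]) y))).
  by apply: Lp_approx_sum => i; apply: Lp_approxZ; apply: Lp_approx_indic.
by apply/funext => y; rewrite {1}fimfunEord.
Qed.

Lemma Lp_approx_ge0 f : measurable_fun setT f -> (forall y, 0 <= f y) ->
  (powint f < +oo)%E -> Lp_approx f.
Proof.
move=> mf f0 fi; have mfE : measurable_fun setT (EFin \o f) by exact/measurable_EFinP.
pose s_ := nnsfun_approx measurableT mfE.
have sf y : s_ n y @[n --> \oo] --> f y.
  have f0E z : setT z -> (0 <= (EFin \o f) z)%E by rewrite lee_fin.
  by have /fine_cvgP[] := cvg_nnsfun_approx measurableT mfE f0E (I : setT y).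
apply: (@Lp_approx_cvg s_ f f _ mf mf fi).
- by move=> n; exact: Lp_approx_nnsfun.
- by apply: nearW => y; exact: sf.
- apply: nearW => y n.
  have sn : s_ n y <= f y.
    have ns : nondecreasing_seq (fun n => s_ n y).
      by move=> m k mk; exact/lefP/nd_nnsfun_approx.
    rewrite -(cvg_lim _ (sf y))//; apply: nondecreasing_cvgn_le => //.
    by apply/cvg_ex; exists (f y).
  by rewrite ger0_norm ?subr_ge0// lerBlDr lerDl.
Qed.

Theorem Lp_dense f : measurable_fun setT f -> (powint f < +oo)%E -> Lp_approx f.
Proof.
move=> mf fi.
have mp : measurable_fun setT (fun y => Num.max (f y) 0) by exact: measurable_maxr.
have mn : measurable_fun setT (fun y => Num.max (- f y) 0).
  by apply: measurable_maxr => //; exact: measurableT_comp.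
have -> : f = (fun y => Num.max (f y) 0 + -1 * Num.max (- f y) 0).
  apply/funext => y; rewrite mulN1r; case: (leP 0 (f y)) => h.
    by rewrite max_r ?subr0// oppr_le0.
  by rewrite max_l ?oppr_ge0 ?(ltW h)// opprK add0r.
apply: Lp_approxD.
  apply: (Lp_approx_ge0 mp); first by move=> y; rewrite le_max lexx orbT.
  apply: le_lt_trans fi; apply: powint_le => //; apply: nearW => y.
  by case: (leP 0 (f y)) => h; rewrite ?normr0.
apply: Lp_approxZ; apply: (Lp_approx_ge0 mn); first by move=> y; rewrite le_max lexx orbT.
apply: le_lt_trans fi; apply: powint_le => //; apply: nearW => y.
by case: (leP 0 (- f y)) => h; rewrite ?normr0 ?normrN.
Qed.

End Lp_density.

(** * Polynomial approximation of a threshold *)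

Section threshold.
Context {R : realType}.
Implicit Types (s t q : R) (n m : nat).

Lemma bernoulli s m : -1 <= s -> 1 + m%:R * s <= (1 + s) ^+ m.
Proof.
move=> s1; elim: m => [|m IH]; first by rewrite mul0r addr0 expr0.
have s10 : 0 <= 1 + s by rewrite -lerBlDl sub0r.
rewrite exprS; apply: le_trans (ler_wpM2l s10 IH).
rewrite -natr1 -subr_ge0 (_ : _ - _ = m%:R * s ^+ 2); last by ring.
by rewrite mulr_ge0// sqr_ge0.
Qed.

(** Each of the n terms t^k with k < n is at least t^n, and the geometric sum is at most 1 / (1 -
    t). *)
Lemma natmul_expr_le t n : 0 <= t < 1 -> n%:R * t ^+ n <= (1 - t)^-1.
Proof.
move=> /andP[t0 t1]; rewrite -[leRHS]mul1r ler_pdivlMr ?subr_gt0//.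
have : (1 - t) * (n%:R * t ^+ n) <= (1 - t) * \sum_(k < n) t ^+ k.
  rewrite ler_wpM2l ?subr_ge0 ?(ltW t1)// -[n in n%:R]card_ord -sumr_const mulr_suml.
  apply: ler_sum => k _; rewrite mul1r ler_wiXn2l ?(ltW t1)//; exact: ltnW.
rewrite mulrC => /le_trans; apply.
by rewrite -opprB mulNr -subrX1 opprB gerBl exprn_ge0.
Qed.

(* Tends to 1 for s < 1/2, and to 0 for 1/2 <= s <= 1. *)
Definition cutoff s n : R := (1 - s ^+ n) ^+ (n * 2 ^ n)%N.

Lemma cutoff_itv s n : 0 <= s <= 1 -> 0 <= cutoff s n <= 1.
Proof.
move=> /andP[s0 s1]; rewrite /cutoff.
have h0 : 0 <= 1 - s ^+ n by rewrite subr_ge0 exprn_ile1.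
by rewrite exprn_ge0//= exprn_ile1// gerBl exprn_ge0.
Qed.

Lemma cutoff_cvg s : 0 <= s <= 1 -> cutoff s n @[n --> \oo] --> ((s < 2^-1)%R%:R : R).
Proof.
move=> s01; have /andP[s0 s1] := s01; case: ltP => s2; rewrite ?mulr1n ?mulr0n.
  (* By Bernoulli the cutoff is at least 1 - n q^n with q < 1. Writing q^n = t^n t^n leaves one
     factor t^n to absorb n and the other to tend to 0. *)
  pose q := 2 * s; pose t := Num.sqrt q.
  have q0 : 0 <= q by rewrite mulr_ge0.
  have q1 : q < 1 by rewrite /q mulrC -ltr_pdivlMr// mul1r.
  have t0 : 0 <= t by rewrite sqrtr_ge0.
  have t1 : t < 1 by rewrite -[ltRHS]sqrtr1 ltr_sqrt.
  have tq : t ^+ 2 = q by rewrite sqr_sqrtr.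
  have lo : 1 - (1 - t)^-1 * t ^+ n @[n --> \oo] --> (1 : R).
    rewrite -[X in _ --> X]subr0; apply: cvgB; first exact: cvg_cst.
    rewrite -(mulr0 (1 - t)^-1); apply: cvgM; first exact: cvg_cst.
    by apply: cvg_expr; rewrite ger0_norm.
  apply: (@squeeze_cvgr _ _ _ _ (fun n => 1 - (1 - t)^-1 * t ^+ n) (cst 1) _ _ 1 lo);
    last exact: cvg_cst.
  apply: nearW => n /=.
  have /andP[c0 ->] := cutoff_itv n s01; rewrite andbT.
  apply: le_trans (_ : _ <= 1 + (n * 2 ^ n)%:R * (- s ^+ n)) _; last first.
    by apply: bernoulli; rewrite lerN2 exprn_ile1.
  rewrite mulrN lerB// natrM natrX -mulrA -exprMn -/q -tq exprAC expr2 mulrA.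
  by rewrite ler_wpM2r ?exprn_ge0// natmul_expr_le// t0.
have hi : (n.+1%:R)^-1 @[n --> \oo] --> (0 : R) by exact: cvg_harmonic.
apply: (@squeeze_cvgr _ _ _ _ (cst 0) (fun n => n.+1%:R^-1) _ _ 0 _ hi);
  last exact: cvg_cst.
apply: nearW => n /=.
have /andP[-> _] := cutoff_itv n s01; rewrite andTb.
(* As s^n >= x, the cutoff is at most (1 - x)^m, hence at most 1 / (1 + x)^m; by Bernoulli this is
   at most 1 / (1 + m x) = 1 / (n + 1). *)
pose x : R := 2 ^- n; pose m := (n * 2 ^ n)%N.
have x0 : 0 <= x by rewrite invr_ge0 exprn_ge0.
have x1 : x <= 1 by rewrite /x -exprVn exprn_ile1 ?invr_ge0 ?invf_le1 ?ler1n.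
have sx : x <= s ^+ n by rewrite /x -exprVn lerXn2r ?nnegrE// ltW.
have mx : 1 + m%:R * x = n.+1%:R.
  by rewrite /m /x natrM natrX mulfK ?expf_neq0// addrC natr1.
apply: (@le_trans _ _ ((1 - x) ^+ m)).
  by rewrite lerXn2r ?nnegrE ?subr_ge0 ?exprn_ile1// lerB.
rewrite -[leRHS]mul1r ler_pdivlMr// -mx.
apply: (@le_trans _ _ ((1 - x) ^+ m * (1 + x) ^+ m)).
  by rewrite ler_wpM2l ?exprn_ge0 ?subr_ge0// bernoulli// (le_trans _ x0)// lerN10.
rewrite -exprMn exprn_ile1 ?mulr_ge0 ?subr_ge0 ?addr_ge0//.
by rewrite (_ : _ * _ = 1 - x ^+ 2) ?gerBl ?sqr_ge0//; ring.
Qed.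

End threshold.

Lemma ae_impl d (T : measurableType d) (R : realType) (mu : {measure set T -> \bar R})
    (P Q : T -> Prop) : {ae mu, forall y, P y} -> (forall y, P y -> Q y) ->
  {ae mu, forall y, Q y}.
Proof. by move=> aP PQ; apply: filterS aP => y; exact: PQ. Qed.

Lemma ae_and d (T : measurableType d) (R : realType) (m : {measure set T -> \bar R})
    (P Q : T -> Prop) : {ae m, forall y, P y} -> {ae m, forall y, Q y} ->
  {ae m, forall y, P y /\ Q y}.
Proof. by move=> aP aQ; apply: filterS2 aP aQ. Qed.

Section sphere_density.
Context {R : realType} {D : polyAlg R}.
Implicit Types (P Q : D) (a : 'I_3 -> R).
Variables (x0 : 'rV[R]_3) (r p : R).
Hypotheses (hr : 0 < r) (p1 : 1 <= p).
Local Notation S := (sphere_area x0 r).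
Local Notation x := (@xx R D).

Lemma sphere_area_fin : (S setT < +oo)%E.
Proof.
have := sphintE x0 hr (1 : D); under eq_integral do rewrite evc1.
by rewrite integral_cst// mul1e => ->; rewrite ltry.
Qed.

Definition on_sph (y : 'rV[R]_3) := \sum_i (y 0 i - x0 0 i) * (y 0 i - x0 0 i) = r ^+ 2.

Lemma on_sph_coord (y : 'rV[R]_3) i : on_sph y -> `|y 0 i - x0 0 i| <= r.
Proof.
move=> ys; rewrite -ler_sqr ?nnegrE ?(ltW hr)// real_normK ?num_real// -ys (bigD1 i)//=.
by rewrite expr2 lerDl; apply: sumr_ge0 => j _; rewrite -expr2 sqr_ge0.
Qed.

Lemma ae_sphere : {ae S, forall y : borel3 R, on_sph y}.
Proof.
exists (~` [set y | evc x0 (rho : D) y = r ^+ 2]); split.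
- apply: measurableC; rewrite -[X in measurable X]setTI.
  exact: (measurable_evc x0 (rho : D)) measurableT _ (measurable_set1 _).
- rewrite /sphere_area; rewrite (_ : _ `&` _ = set0) ?integral_set0//.
  apply/seteqP; split => // t [_] /= []; rewrite evc_spherical peval_rho.
  exact: sph_norm.
- move=> y /= ny ry; apply: ny; move: ry; rewrite /on_sph /evc peval_rho; exact.
Qed.

(** Open lower orthants: a pi-system generating the Borel sets, with indicators that are products of
    one-dimensional thresholds. *)
Definition box a : set (borel3 R) := [set y | forall i, y 0 i < a i].

Lemma box_setI : setI_closed [set A | exists a, A = box a].
Proof.
move=> _ _ [a ->] [b ->]; exists (fun i => Num.min (a i) (b i)).
apply/seteqP; split=> [y [ya yb] i|y yab]; first by rewrite lt_min ya yb.
by split=> i; have := yab i; rewrite lt_min => /andP[].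
Qed.

Lemma measurable_box a : measurable (box a).
Proof.
have -> : box a = \bigcap_(i in [set: 'I_3]) [set y : borel3 R | y 0 i < a i].
  by apply/seteqP; split=> [y ya i _|y ya i]; exact: ya.
apply: fin_bigcap_measurable => // i _; rewrite -[X in measurable X]setTI.
have -> : [set y : borel3 R | y 0 i < a i] = (fun y : borel3 R => y 0 i) @^-1` `]-oo, a i[.
  by apply/seteqP; split=> y /=; rewrite in_itv.
by apply: (measurable_coord i) => //; exact: measurable_itv.
Qed.

(** For the inclusion into the generated sigma-algebra, the identity from [T'] to the Borel space is
    measurable because its coordinates are: a half-space is the union of the boxes whose other
    bounds are n. *)
Lemma box_generates : @measurable _ (borel3 R) = <<s [set A | exists a, A = box a] >>.
Proof.
apply/seteqP; split=> [A mA|]; last first.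
  apply: smallest_sub; first exact: sigma_algebra_measurable.
  by move=> _ [a ->]; exact: measurable_box.
pose T' := g_sigma_algebraType [set A : set (borel3 R) | exists a, A = box a].
suff : measurable_fun setT (fun y : T' => y : borel3 R).
  by move=> /(_ measurableT _ mA); rewrite setTI.
apply: (@measurable_borel3 R _ T' (fun y : T' => y : 'rV[R]_3)) => i.
apply: (measurability (@RGenInftyO.G R)); first exact: RGenInftyO.measurableE.
move=> _ [_ [b ->] <-]; rewrite setTI.
have -> : (fun y : T' => (y : 'rV[R]_3) 0 i) @^-1` `]-oo, b[ =
    \bigcup_n (box (fun j => if j == i then b else n%:R)).
  apply/seteqP; split=> [y /=|y [n _ /(_ i)]]; last by rewrite eqxx /= in_itv.
  rewrite in_itv/= => yb; exists (Num.truncn (\sum_j `|(y : 'rV[R]_3) 0 j|)).+1 => // j /=.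
  case: eqP => [->//|_]; rewrite (le_lt_trans (ler_norm _))//.
  apply: le_lt_trans (truncnS_gt _); rewrite (bigD1 j)//= lerDl; exact: sumr_ge0.
by apply: bigcup_measurable => n _; apply: sub_sigma_algebra; eexists.
Qed.

Definition poly_functions : set (borel3 R -> R) := [set f | exists P : D, f = evc x0 P].

Lemma poly_functionsD f g : poly_functions f -> poly_functions g -> poly_functions (fun y => f y + g y).
Proof. by move=> [P ->] [Q ->]; exists (P + Q); apply/funext => y; rewrite evcD. Qed.
Lemma poly_functionsZ (c : R) f : poly_functions f -> poly_functions (fun y => c * f y).
Proof. by move=> [P ->]; exists (c *: P); apply/funext => y; rewrite evcZ. Qed.
Lemma measurable_poly_functions f : poly_functions f -> measurable_fun setT f.
Proof. by move=> [P ->]; exact: measurable_evc. Qed.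

Definition bshift a i : R := a i - x0 0 i.
Definition bwidth a i : R := r + `|bshift a i|.
(** The affine function of y_i that takes the threshold a_i to 1/2 and the sphere into [0, 1], where
    [cutoff_cvg] applies. *)
Definition bcoord a i : D :=
  (2 * bwidth a i)^-1 *: (x i - (bshift a i)%:A) + 2^-1%:A.

Lemma bcoordE a i y : evc x0 (bcoord a i) y = (2 * bwidth a i)^-1 * (y 0 i - a i) + 2^-1.
Proof.
rewrite evcD evcZ evcB evc_xx !evcZ !evc1 !mulr1; congr (_ * _ + _).
by rewrite /bshift opprB addrA subrK.
Qed.

Lemma bwidth_gt0 a i : 0 < bwidth a i.
Proof. by rewrite ltr_pwDl. Qed.

Lemma bcoord_itv a i y : on_sph y -> 0 <= evc x0 (bcoord a i) y <= 1.
Proof.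
move=> ys; have w0 := bwidth_gt0 a i.
have yr := on_sph_coord i ys.
have : `|y 0 i - a i| <= bwidth a i.
  rewrite /bwidth /bshift (_ : y 0 i - a i = (y 0 i - x0 0 i) - (a i - x0 0 i)).
    by rewrite (le_trans (ler_normB _ _))// lerD.
  by rewrite opprB addrA subrK.
rewrite ler_norml bcoordE => /andP[lo hi].
have w2 : (2 * bwidth a i)^-1 * bwidth a i = 2^-1.
  by field; rewrite gt_eqF.
have v0 : 0 <= (2 * bwidth a i)^-1 by rewrite invr_ge0 mulr_ge0// ltW.
apply/andP; split.
  by have := ler_wpM2l v0 lo; rewrite mulrN w2 -subr_ge0 opprK.
have := ler_wpM2l v0 hi; rewrite w2 => h.
by rewrite (le_trans (lerD h (lexx _)))// -[leRHS](mulVf (_ : 2 != 0 :> R)) ?mulr_natr ?mulr2n.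
Qed.

Lemma bcoord_lt a i y : (evc x0 (bcoord a i) y < 2^-1) = (y 0 i < a i).
Proof.
by rewrite bcoordE gtrDr pmulr_rlt0 ?subr_lt0// invr_gt0 mulr_gt0// bwidth_gt0.
Qed.

Definition bpoly a n : D := \prod_i (1 - bcoord a i ^+ n) ^+ (n * 2 ^ n)%N.

Lemma evcX Q n y : evc x0 (Q ^+ n) y = evc x0 Q y ^+ n.
Proof. by elim: n => [|n IH]; rewrite ?evc1// !exprS evcM IH. Qed.

Lemma bpolyE a n y : evc x0 (bpoly a n) y = \prod_i cutoff (evc x0 (bcoord a i) y) n.
Proof.
rewrite /bpoly (big_morph (evc x0 ^~ y) (fun P Q => evcM x0 P Q y) (evc1 x0 y)).
by apply: eq_bigr => i _; rewrite evcX evcB evc1 evcX.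
Qed.

Lemma Lp_approx_box a : Lp_approx S p poly_functions \1_(box a).
Proof.
have ae := ae_sphere.
have H1 n : Lp_approx S p poly_functions (evc x0 (bpoly a n)).
  by apply: (Lp_approxW _ p1 measurable_poly_functions); exists (bpoly a n).
have H2 : measurable_fun setT (\1_(box a) : borel3 R -> R).
  by apply: measurable_indic; exact: measurable_box.
have H3 : measurable_fun setT ((fun=> 1) : borel3 R -> R) by exact: measurable_cst.
apply: (Lp_approx_cvg p1 measurable_poly_functions H1 H2 H3 (powint_cst p sphere_area_fin 1)).
- apply: (ae_impl ae) => y ys.
  under eq_fun do rewrite bpolyE.
  have -> : \1_(box a) y = \prod_i (evc x0 (bcoord a i) y < 2^-1)%R%:R :> R.
    have [ya|nya] := pselect (box a y).
      by rewrite indicE mem_set// big1// => i _; rewrite bcoord_lt ya.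
    rewrite indicE memNset//; have [i /negP yi] : exists i, ~ (y 0 i < a i).
      by apply/not_existsP => h; apply: nya => i; have := h i; apply: contrapT.
    by rewrite (bigD1 i)//= bcoord_lt (negPf yi) mul0r.
  rewrite !big_ord_recr !big_ord0/=; under eq_fun do rewrite !big_ord_recr big_ord0/=.
  by do 3?apply: cvgM; (exact: cvg_cst || exact: cutoff_cvg (bcoord_itv a _ ys)).
- apply: (ae_impl ae) => y ys n; rewrite bpolyE.
  set b := \prod_i _.
  have /andP[b0 b1] : 0 <= b <= 1.
    have ci i : 0 <= cutoff (evc x0 (bcoord a i) y) n <= 1.
      exact/cutoff_itv/bcoord_itv.
    rewrite /b; apply: (big_ind (fun z => 0 <= z <= 1)) => [|u v|i _]; last exact: ci.
      by rewrite ler01 lexx.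
    by move=> /andP[u0 u1] /andP[v0 v1]; rewrite mulr_ge0//= mulr_ile1.
  rewrite indicE; case: (_ \in _) => /=; rewrite ler_norml; lra.
Qed.

Lemma poly_dense (f : borel3 R -> R) : measurable_fun setT f -> (powint S p f < +oo)%E ->
  forall e, 0 < e -> exists P : D, (powint S p (fun y => f y - evc x0 P y)%R < e%:E)%E.
Proof.
move=> mf fi e e0.
have W1 : Lp_approx S p poly_functions (fun=> 1).
  by apply: (Lp_approxW _ p1 measurable_poly_functions); exists 1; apply/funext => y; rewrite evc1.
have WG A : [set A | exists a, A = box a] A -> Lp_approx S p poly_functions \1_A.
  by move=> [a ->]; exact: Lp_approx_box.
have [_ /(_ e e0)[_ [P ->] fP]] := Lp_dense sphere_area_fin p1 measurable_poly_functions
  poly_functionsD poly_functionsZ box_setI box_generates W1 WG mf fi.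
by exists P.
Qed.

End sphere_density.

(** * Completeness *)

Lemma Lfun_powint d (T : measurableType d) (R : realType) (mu : {measure set T -> \bar R})
    (p : R) (f : T -> R) : 1 <= p ->
  f \in Lfun mu p%:E <-> measurable_fun setT f /\ (powint mu p f < +oo)%E.
Proof.
move=> p1; have p0 : 0 < p := lt_le_trans ltr01 p1; rewrite inE; split.
  move=> /andP[]; rewrite !inE /= /finite_norm => mf fi; split => //.
  by rewrite powint_Lnorm// poweR_lty.
move=> [mf fi]; apply/andP; rewrite !inE /= /finite_norm; split => //.
by rewrite Lnorm_powint poweR_lty.
Qed.

Section boundary_data.
Context {R : realType} {D : polyAlg R}.
Implicit Types (P Q : D) (u v : 'I_3 -> D) (y : 'rV[R]_3).
Variables (x0 : 'rV[R]_3) (r p lam mu : R).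
Hypotheses (hr : 0 < r) (p1 : 1 <= p) (hmu : 0 < mu) (hlam : 0 < 3 * lam + 2 * mu).
Local Notation S := (sphere_area x0 r).
Local Notation x := (@xx R D).

Lemma evc_bounded P : exists M, forall y, on_sph x0 r y -> `|evc x0 P y| <= M.
Proof.
have [|M hM] := @bounded_peval R D {y | on_sph x0 r y}
    (fun i t => (projT1 t) 0 i - x0 0 i) P.
  by exists r => i [t ts] /=; exact: on_sph_coord.
by exists M => y ys; exact: (hM (exist _ y ys)).
Qed.

Lemma powint_evc P : (powint S p (evc x0 P) < +oo)%E.
Proof.
have [M hM] := evc_bounded P.
apply: le_lt_trans (powint_cst p (sphere_area_fin (D := D) x0 hr) M).
apply: powint_le => //; first exact: measurable_evc.
apply: (ae_impl (ae_sphere (D := D) x0 r)) => y ys.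
exact: le_trans (hM y ys) (ler_norm _).
Qed.

Lemma Lfun_evc P : evc x0 P \in Lfun S p%:E.
Proof. by apply/(Lfun_powint _ _ p1); split; [exact: measurable_evc|exact: powint_evc]. Qed.

Lemma evc_on_sphere P Q y : on_sphere (r ^+ 2) P Q -> on_sph x0 r y -> evc x0 P y = evc x0 Q y.
Proof. by move=> PQ ys; exact: PQ. Qed.

Lemma sub_x0 y : y - x0 = evcv x0 x y. Proof. by rewrite evcv_xx. Qed.

Lemma cross_rotf (b : 'rV[R]_3) y :
  cross b (y - x0) = evcv x0 (rotf (fun i => b 0 i) : _ -> D) y.
Proof.
have -> : b = evcv x0 (fun j => (b 0 j)%:A : D) y.
  by apply/rowP => i; rewrite mxE evcZ evc1 mulr1.
rewrite {1}sub_x0 cross_evcv; congr (evcv _ (pcross _ _) _).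
by apply/funext => j; rewrite mxE evcZ evc1 mulr1.
Qed.

Lemma pdotC u v : pdot u v = pdot v u.
Proof. by apply: eq_bigr => i _; rewrite mulrC. Qed.
Lemma pdotZl c u v : pdot (fun i => c *: u i) v = c *: pdot u v.
Proof. by rewrite /pdot scaler_sumr; apply: eq_bigr => i _; rewrite scalerAl. Qed.
Lemma pdotBl u v w : pdot (fun i => u i - v i : D) w = pdot u w - pdot v w.
Proof. by rewrite /pdot -sumrB; apply: eq_bigr => i _; rewrite mulrBl. Qed.
Lemma pdotMl P u v : pdot (fun i => P * u i) v = P * pdot u v.
Proof. by rewrite /pdot mulr_sumr; apply: eq_bigr => i _; rewrite mulrA. Qed.

Lemma pdot_xx_rotf b : pdot x (rotf b) = 0.
Proof. rewrite /rotf /pdot !sum_ax !pcrossE; ring. Qed.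

Local Notation ptang := (ptang_stress lam mu r).

Lemma pdot_ptang u v : pdot (ptang u) v =
  r^-1 *: (pdot (pstress lam mu u) v - r ^- 2 *: (pdot x (pstress lam mu u) * pdot x v)).
Proof.
by rewrite /ptang_stress pdotZl pdotBl pdotZl pdotMl.
Qed.

Lemma sphint_ptang_rot u b : sol lam mu u -> sphint r (pdot (ptang u) (rotf b)) = 0.
Proof.
move=> su; rewrite pdot_ptang pdot_xx_rotf mulr0 scaler0 subr0 (sphintZ hr).
rewrite (L_pstress_rot_sol (s := r ^+ 2) hmu hlam (sphintD hr) (sphintZ hr) _ _ b su) ?mulr0//.
- exact: sphint_on_sphere.
- exact: (sphint_rot hr).
Qed.

Lemma compatible_sol u : sol lam mu u ->
  compatible_data x0 r p (evc x0 (r^-1 *: pdot x u)) (evcv x0 (ptang u)).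
Proof.
move=> su; split.
- exact: Lfun_evc.
- by move=> i; rewrite evcv_coord; exact: Lfun_evc.
- apply: (ae_impl (ae_sphere (D := D) x0 r)) => y ys.
  have yr : evc x0 (pdot x x) y = r ^+ 2 by rewrite -ys; exact: peval_rho.
  rewrite (sphere_normalE (D := D)) dotZr dot_evcv pdot_ptang (pdotC (pstress _ _ _)).
  rewrite evcZ evcB evcZ evcM yr; set B := evc _ _ _.
  have -> : r ^- 2 * (B * r ^+ 2) = B by field; rewrite gt_eqF.
  by rewrite subrr !mulr0.
- move=> b; under eq_integral do rewrite cross_rotf dot_evcv.
  by rewrite (sphintE x0 hr) sphint_ptang_rot.
Qed.

End boundary_data.

Section superposition.
Context {R : realType} {D : polyAlg R}.
Implicit Types (P Q : D) (u v : 'I_3 -> D).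
Variables (lam mu r : R).

Definition single (j : 'I_3) P : 'I_3 -> D := fun i => if i == j then P else 0.

Lemma harm_single k j P i : harm k%:R P -> harm k%:R (single j P i).
Proof. by rewrite /single; case: ifP => // _ _; exact: harm0. Qed.

Lemma elasD k u v i : elas lam mu k (fun j => u j + v j) i =
  elas lam mu k u i + elas lam mu k v i.
Proof. by rewrite /elas pdivD ddD mulrDr scalerDr addrACA. Qed.
Lemma elasZ k c u i : elas lam mu k (fun j => c *: u j) i = c *: elas lam mu k u i.
Proof.
by rewrite /elas pdivZ ddZ -scalerAr scalerDr !scalerA (mulrC c).
Qed.

Lemma elas_sum k (I : Type) (s : seq I) (F : I -> 'I_3 -> D) i :
  elas lam mu k (fun j => \sum_(a <- s) F a j) i = \sum_(a <- s) elas lam mu k (F a) i.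
Proof.
elim: s => [|a s IH]; last first.
  by rewrite big_cons -IH -elasD; congr (elas _ _ _ _ _); apply/funext => j; rewrite big_cons.
rewrite big_nil -[RHS](scale0r (elas lam mu k (fun=> 0) i)) -elasZ.
by congr (elas _ _ _ _ _); apply/funext => j; rewrite big_nil scaler0.
Qed.

Lemma single_sum v : v = fun i => \sum_j single j (v j) i.
Proof.
apply/funext => i; rewrite (bigD1 i)//= big1 /single ?eqxx ?addr0// => j ji.
by rewrite eq_sym (negPf ji).
Qed.

Local Notation ptang := (ptang_stress lam mu r).

Lemma ptangD u v : ptang (fun i => u i + v i) = fun i => ptang u i + ptang v i.
Proof.
apply/funext => i; rewrite /ptang_stress pstress_fD pdotxD !sclrE; ring.
Qed.
Lemma ptangZ c u : ptang (fun i => c *: u i) = fun i => c *: ptang u i.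
Proof.
apply/funext => i; rewrite /ptang_stress pstress_fZ pdotxZ !sclrE; ring.
Qed.

Variables (x0 : 'rV[R]_3) (q : nat -> 'I_3 -> D).
Local Notation x := (@xx R D).

Definition comb N (c : nat -> R) : 'I_3 -> D := fun i => \sum_(n < N) c n *: q n i.

Lemma combS N c : comb N.+1 c = fun i => comb N c i + c N *: q N i.
Proof. by apply/funext => i; rewrite /comb big_ord_recr. Qed.

Lemma comb0 c : comb 0 c = fun=> 0.
Proof. by apply/funext => i; rewrite /comb big_ord0. Qed.

Lemma sol_comb N c : (forall n, sol lam mu (q n)) -> sol lam mu (comb N c).
Proof.
move=> sq; elim: N => [|N IH]; first by rewrite comb0; exact: sol0.
by rewrite combS; apply: solD => //; exact/solZ/sq.
Qed.

Lemma normal_part_comb N (c : nat -> R) y : \sum_(n < N) c n * normal_part x0 r (evcv x0 (q n)) y =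
  evc x0 (r^-1 *: pdot x (comb N c)) y.
Proof.
elim: N => [|N IH].
  rewrite big_ord0 comb0 (_ : pdot _ _ = 0) ?scaler0 ?evc0//.
  by rewrite /pdot big1// => i _; rewrite mulr0.
rewrite big_ord_recr/= IH combS pdotxD pdotxZ scalerDr evcD; congr (_ + _).
by rewrite normal_part_evcv !evcZ mulrCA.
Qed.

Lemma tangential_stress_comb N (c : nat -> R) y :
  \sum_(n < N) c n *: tangential_stress x0 r lam mu (evcv x0 (q n)) y = evcv x0 (ptang (comb N c)) y.
Proof.
elim: N => [|N IH].
  rewrite big_ord0 comb0; apply/rowP => i; rewrite !mxE.
  have -> : (fun=> 0 : D) = (fun=> 0 *: (0 : D)) :> ('I_3 -> D).
    by apply/funext => j; rewrite scaler0.
  by rewrite ptangZ scale0r evc0.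
rewrite big_ord_recr/= IH combS ptangD evcvD; congr (_ + _).
by rewrite ptangZ evcvZ tangential_stress_evcv.
Qed.

End superposition.

(** * Expansion of polynomial solutions in the given system *)

Section span.
Context {R : realType}.
Local Notation D := (mpolyAlg R).
Implicit Types (P Q : D) (u v : 'I_3 -> D) (y : 'rV[R]_3).
Variables (lam mu : R) (x0 : 'rV[R]_3) (r : R).
Hypotheses (hmu : 0 < mu) (hlam : 0 < 3 * lam + 2 * mu).
Variable w : forall k : nat, 'I_(2 * k + 1)%N -> 'rV[R]_3 -> R.
Arguments w : clear implicits.
Variables (hw : forall k : nat, harmonic_basis k (w k)) (e : nat -> elastic_index)
  (he : bijective e).
Local Notation x := (@xx R D).
Local Notation Pn := (elastic_system lam mu w e).

Lemma harmonic_rep k s : exists2 P : D, harm k%:R P & w k s = evc 0 P.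
Proof. by have [h _ _] := hw k; exact/harmonic_polynomialP. Qed.

Arguments harmonic_rep : clear implicits.

Definition basis_poly k s : D := s2val (cid2 (harmonic_rep k s)).
Arguments basis_poly : clear implicits.
Lemma harm_basis_poly k s : harm k%:R (basis_poly k s).
Proof. exact: s2valP (cid2 (harmonic_rep k s)). Qed.
Lemma basis_polyE k s : w k s = evc 0 (basis_poly k s).
Proof. exact: s2valP' (cid2 (harmonic_rep k s)). Qed.

(** The same functions as the given system, written as polynomials in y - x0. *)
Definition centered_system (n : nat) : 'I_3 -> D :=
  let: existT k (s, j) := e n in
  fun i => translate (- x0) (elas lam mu k (single j (basis_poly k s)) i).

Lemma sol_centered_system n : sol lam mu (centered_system n).
Proof.
rewrite /centered_system; case: (e n) => k [s j]; apply: sol_translate; apply: sol_elas => //.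
move=> i; exact: harm_single (harm_basis_poly s).
Qed.

Lemma evc_translate_opp P : evc x0 (translate (- x0) P) = evc 0 P.
Proof.
apply/funext => y; have := congr1 (fun g => g (y - x0)) (translateE (- x0) P).
rewrite /evc => E; rewrite -[RHS](_ : peval (fun i => (y - x0) 0 i - (- x0) 0 i) P = _).
  by rewrite -E; congr (peval _ _); apply/funext => i; rewrite !mxE subr0.
by congr (peval _ _); apply/funext => i; rewrite !mxE opprK subrK subr0.
Qed.

Lemma evc_shift P y : evc 0 P y = evc x0 P (y + x0).
Proof. by rewrite /evc; congr (peval _ P); apply/funext => i; rewrite !mxE addrK subr0. Qed.

Lemma evcv_translate u : evcv 0 (fun i => translate x0 (u i)) = evcv x0 u.
Proof. by apply/funext => y; apply/rowP => i; rewrite !mxE translateE. Qed.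

Lemma elastic_systemE n : Pn n = evcv x0 (centered_system n).
Proof.
rewrite /elastic_system /centered_system; case: (e n) => k [s j].
rewrite basis_polyE elastic_polynomialE.
by apply/funext => y; apply/rowP => i; rewrite !mxE evc_translate_opp.
Qed.

(** The equation for all M >= N forces the later coefficients to contribute nothing, so two
    combinations add termwise. *)
Definition in_span (U : 'rV[R]_3 -> 'rV[R]_3) := exists N (c : nat -> R),
  forall M, (N <= M)%N -> forall y, U y = \sum_(n < M) c n *: Pn n y.

Lemma in_span_P n : in_span (Pn n).
Proof.
exists n.+1, (fun m => (m == n)%:R) => M nM y.
rewrite (bigD1 (Ordinal nM))//= eqxx scale1r big1 ?addr0// => m mn.
by rewrite (_ : (m == n :> nat) = false) ?scale0r//; apply/negbTE.
Qed.

Lemma in_spanD U V : in_span U -> in_span V -> in_span (fun y => U y + V y).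
Proof.
move=> [N [c UE]] [N' [c' VE]]; exists (maxn N N'), (fun n => c n + c' n) => M.
rewrite geq_max => /andP[NM N'M] y; rewrite (UE _ NM) (VE _ N'M) -big_split.
by apply: eq_bigr => n _; rewrite scalerDl.
Qed.

Lemma in_spanZ (a : R) U : in_span U -> in_span (fun y => a *: U y).
Proof.
move=> [N [c UE]]; exists N, (fun n => a * c n) => M NM y.
by rewrite (UE _ NM) scaler_sumr; apply: eq_bigr => n _; rewrite scalerA.
Qed.

Lemma in_span_sum (I : Type) (s : seq I) (F : I -> 'rV[R]_3 -> 'rV[R]_3) :
  (forall i, in_span (F i)) -> in_span (fun y => \sum_(i <- s) F i y).
Proof.
move=> sF; elim: s => [|i s IH].
  exists 0%N, (fun=> 0) => M _ y; rewrite big_nil big1// => n _.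
  by rewrite scale0r.
by under eq_fun do rewrite big_cons; exact: in_spanD.
Qed.

(** Each entry of v expands in the harmonic basis, and [elas] is linear with members of the system
    as values on single basis entries. *)
Lemma in_span_elas k v : (forall i, harm k%:R (v i)) ->
  in_span (evcv 0 (elas lam mu k v)).
Proof.
move=> hv; have [_ _ hspan] := hw k.
have H j : exists c : 'I_(2 * k + 1) -> R, v j = \sum_s c s *: basis_poly k s.
  have [|c cE] := hspan (evc 0 (v j)); first by apply/harmonic_polynomialP; exists (v j).
  exists c; apply: evc_inj => y; rewrite cE evc_sum.
  by apply: eq_bigr => s _; rewrite evcZ basis_polyE.
have [c cE] := choice H.
suff -> : evcv 0 (elas lam mu k v) = fun y => \sum_(a : 'I_3 * 'I_(2 * k + 1))
    c a.1 a.2 *: elastic_polynomial lam mu k (w k a.2) a.1 y.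
  apply: in_span_sum => -[j s]; apply: in_spanZ => /=.
  have [e' _ e'K] := he; have := in_span_P (e' (existT _ k (s, j))).
  by rewrite /elastic_system e'K.
apply/funext => y; rewrite -(pair_bigA _ (fun j s =>
  c j s *: elastic_polynomial lam mu k (w k s) j y))/=.
under eq_bigr => j _ do under eq_bigr => s _ do rewrite basis_polyE elastic_polynomialE.
apply/rowP => i; rewrite summxE mxE.
under eq_bigr => j _ do (rewrite summxE; under eq_bigr => s _ do rewrite !mxE -evcZ).
under eq_bigr => j _ do rewrite -evc_sum.
rewrite -evc_sum; congr (evc _ _ _); rewrite [in LHS](single_sum v) elas_sum.
apply: eq_bigr => j _; transitivity (elas lam mu k (fun l =>
    \sum_s c j s *: single j (basis_poly k s) l) i).
  congr (elas _ _ _ _ _); apply/funext => l; rewrite /single cE.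
  by case: ifP => // _; rewrite big1// => s _; rewrite scaler0.
by rewrite elas_sum; apply: eq_bigr => s _; rewrite elasZ.
Qed.

Lemma in_span_sol u : sol lam mu u -> in_span (evcv x0 u).
Proof.
move=> su; rewrite -evcv_translate.
have [N [V [hV VE]]] := sol_structure hmu hlam (sol_translate x0 su).
rewrite (_ : evcv 0 _ = fun y => \sum_(k < N) evcv 0 (elas lam mu k (V k)) y).
  by apply: in_span_sum => k; exact: in_span_elas.
apply/funext => y; apply/rowP => i; rewrite summxE mxE VE evc_sum.
by apply: eq_bigr => k _; rewrite mxE.
Qed.

Lemma sol_comb_ex u : sol lam mu u -> exists N c, u = comb centered_system N c.
Proof.
move=> /in_span_sol[N [c uE]]; exists N, c; apply/funext => i.
have E y : evc x0 (u i) y = evc x0 (comb centered_system N c i) y.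
  have := congr1 (fun v : 'rV[R]_3 => v 0 i) (uE N (leqnn N) y).
  rewrite mxE summxE => ->; rewrite /comb evc_sum; apply: eq_bigr => n _.
  by rewrite mxE elastic_systemE mxE evcZ.
by apply: evc_inj => y; rewrite !evc_shift.
Qed.

End span.

(** * Control of the rotation and approximation of the data *)

Section L1_Lp.
Context d (T : measurableType d) {R : realType} (m : {measure set T -> \bar R}).
Variable p : R.
Hypotheses (mfin : (m setT < +oo)%E) (p1 : 1 <= p).

(* |t| <= dl + dl^(1-p) |t|^p. *)
Lemma integral_abs_le (E : T -> R) (dl : R) : measurable_fun setT E -> 0 < dl ->
  (\int[m]_y `|E y|%:E <= dl%:E * m setT + (dl / dl `^ p)%:E * powint m p E)%E.
Proof.
move=> mE d0; have q0 : 0 <= dl / dl `^ p by rewrite divr_ge0 ?powR_ge0// ltW.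
have mP := measurable_powabsE p mE.
rewrite /powint -ge0_integralZl//.
have z0 y : setT y -> (0 <= (dl / dl `^ p)%:E * (`|E y| `^ p)%:E)%E.
  by move=> _; rewrite -EFinM lee_fin mulr_ge0 ?powR_ge0.
have d0' y : setT y -> (0 <= (cst dl%:E : T -> \bar R) y)%E by rewrite lee_fin ltW.
rewrite -integral_cst// -ge0_integralD//; last exact: measurable_funeM.
apply: ge0_le_integral => //.
- by apply/measurable_EFinP; exact: measurableT_comp.
- apply: emeasurable_funD => //; exact: measurable_funeM.
move=> y _; rewrite -EFinM -EFinD lee_fin.
have [le_d|d_lt] := leP `|E y| dl.
  by rewrite (le_trans le_d)// lerDl mulr_ge0 ?powR_ge0.
have : `|E y| / dl <= (`|E y| / dl) `^ p.
  by rewrite le1r_powR// ler_pdivlMr// mul1r ltW.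
rewrite ler_pdivrMr// => /le_trans; apply.
have -> : (`|E y| / dl) `^ p = `|E y| `^ p / dl `^ p.
  by rewrite powRM ?invr_ge0 ?(ltW d0)// -powR_inv1 ?(ltW d0)// -powRrM mulN1r powRN.
rewrite -mulrA mulrC (mulrC _ dl) ler_wpDl// ltW//.
Qed.

End L1_Lp.

Section approximation.
Context {R : realType} {D : polyAlg R}.
Implicit Types (P Q : D) (u v G : 'I_3 -> D) (y : 'rV[R]_3).
Variables (x0 : 'rV[R]_3) (r p lam mu : R).
Hypotheses (hr : 0 < r) (p1 : 1 <= p) (hmu : 0 < mu) (hlam : 0 < 3 * lam + 2 * mu).
Local Notation S := (sphere_area x0 r).
Local Notation x := (@xx R D).
Local Notation ptang := (ptang_stress lam mu r).

(** [reach_all] with the powers of r restored: data are scaled by r against the factor 1 / r in the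
    normal, and [tang] carries a factor |x|^2 = r^2. *)
Lemma reach_boundary f G : exists b u, [/\ sol lam mu u,
  on_sphere (r ^+ 2) (r^-1 *: pdot x u) f &
  forall i, on_sphere (r ^+ 2) (ptang u i) (r ^- 2 *: tang G i - rotf b i)].
Proof.
have r0 := lt0r_neq0 hr.
have [b [u [su uf uG]]] := reach_all hmu hlam (exprn_gt0 2 hr) (r *: f) (fun i => r *: G i).
exists (fun i => b i / r), u; split=> // [z zs|i z zs].
  by rewrite pevalZ (uf z zs) pevalZ mulKf.
have := uG i z zs; rewrite (tangB (fun i => r *: G i)) (tangZ r G).
have -> : tang (pcross (fun j => (b j)%:A) x) i = rho * rotf b i.
  by rewrite /tang -/(rotf b) pdot_xx_rotf mul0r subr0.
have -> : rotf (fun i => b i / r) i = r^-1 *: rotf b i :> D.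
  rewrite /rotf; elim/axP : i {uG}; rewrite !pcrossE !(mulrC _ r^-1) -!scalerA !sclrE; ring.
have -> : peval z (ptang u i) = r ^- 3 * peval z (tang (pstress lam mu u) i).
  rewrite /ptang_stress /tang pevalZ !pevalB pevalZ !pevalM peval_rho zs; field.
  exact: r0.
move=> ->; rewrite (pevalB _ (r *: _)) (pevalB _ (r ^- 2 *: _)) !pevalZ pevalM peval_rho zs.
by move: (peval z (tang G i)) (peval z (rotf b i)) => a c; field.
Qed.

Lemma rotf_bound b y i : on_sph x0 r y ->
  `|evc x0 (rotf b i : D) y| <= r * \sum_j `|b j|.
Proof.
move=> ys; have H j k : `|b j * (y 0 k - x0 0 k)| <= r * `|b j|.
  by rewrite normrM mulrC ler_wpM2r// on_sph_coord.
have B j k l m : `|b j * (y 0 k - x0 0 k) - b l * (y 0 m - x0 0 m)| <= r * `|b j| + r * `|b l|.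
  by rewrite (le_trans (ler_normB _ _))// lerD.
have E j k l m : evc x0 ((b j)%:A * x k - (b l)%:A * x m : D) y =
    b j * (y 0 k - x0 0 k) - b l * (y 0 m - x0 0 m).
  by rewrite evcB !evcM !evcZ !evc1 !evc_xx !mulr1.
have pos j : 0 <= r * `|b j| by rewrite mulr_ge0// ltW.
rewrite /rotf sum_ax; elim/axP : i; rewrite pcrossE E; apply: (le_trans (B _ _ _ _));
  have := pos o0; have := pos o1; have := pos o2; lra.
Qed.

Lemma powint_sum3 (E : 'I_3 -> borel3 R -> R) (dl : R) :
  (forall i, measurable_fun setT (E i)) -> 0 <= dl ->
  (forall i, (powint S p (E i) <= dl%:E)%E) ->
  (powint S p (fun t => \sum_i `|E i t|)%R <= (2 `^ p * (2 `^ p * (dl + dl) + dl))%:E)%E.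
Proof.
move=> mE d0 hE; have nE i : measurable_fun setT (fun t => `|E i t|).
  exact: measurableT_comp.
have c0 : (0 <= (2 `^ p : R)%:E)%E by rewrite lee_fin powR_ge0.
have pn i : (powint S p (fun t => `|E i t|)%R <= dl%:E)%E.
  by rewrite /powint; under eq_integral do rewrite normr_id; exact: hE.
have n01 : measurable_fun setT (fun t => `|E o0 t| + `|E o1 t|) by exact: measurable_funD.
rewrite (_ : (fun t => \sum_i `|E i t|) = fun t => (`|E o0 t| + `|E o1 t|) + `|E o2 t|);
  last by apply/funext => t; rewrite sum_ax.
apply: (le_trans (powintD _ p1 n01 (nE o2))).
rewrite EFinM lee_wpmul2l// EFinD leeD//.
apply: (le_trans (powintD _ p1 (nE o0) (nE o1))).
by rewrite EFinM lee_wpmul2l// EFinD leeD.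
Qed.

Lemma evc_integrable P : S.-integrable setT (EFin \o evc x0 P).
Proof. by apply/Lfun1_integrable; exact: (Lfun_evc _ hr (lexx 1)). Qed.

(** The stress of u is orthogonal to b /\ x, and the radial part of G does not see this tangential
    field; what remains is the integral of |b /\ x|^2. *)
Lemma sphint_reach G u b : sol lam mu u ->
  (forall i, on_sphere (r ^+ 2) (ptang u i) (r ^- 2 *: tang G i - rotf b i)) ->
  sphint r (pdot G (rotf b)) = 2 / 3 * r ^+ 2 * sphint r (1 : D) * \sum_i b i ^+ 2.
Proof.
move=> su uG; have r0 := lt0r_neq0 hr.
have := sphint_ptang_rot hr hmu hlam b su.
have Lo := @sphint_on_sphere R D r.
rewrite -(L_rot_norm (sphintD hr) (sphintZ hr) Lo (sphint_rot hr)).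
have -> : sphint r (pdot (ptang u) (rotf b)) =
    sphint r (pdot G (rotf b) - pdot (rotf b) (rotf b)).
  apply: Lo => z zs; rewrite pevalB /pdot !peval_sum -sumrB.
  transitivity (\sum_i (peval z (G i) * peval z (rotf b i : D) -
      peval z (rotf b i : D) * peval z (rotf b i : D)
      - r ^- 2 * peval z (pdot x G) * (z i * peval z (rotf b i : D)))).
    apply: eq_bigr => i _; rewrite pevalM (uG i z zs) (pevalB _ (r ^- 2 *: _)) pevalZ /tang.
    by rewrite pevalB !pevalM peval_rho zs peval_xx; field.
  rewrite [LHS]sumrB [X in _ - X](_ : _ = 0) ?subr0; last first.
    transitivity (r ^- 2 * peval z (pdot x G) * peval z (pdot x (rotf b))).
      rewrite (_ : peval z (pdot x (rotf b)) = \sum_i z i * peval z (rotf b i : D)).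
        by rewrite mulr_sumr.
      by rewrite /pdot peval_sum; apply: eq_bigr => i _; rewrite pevalM peval_xx.
    by rewrite pdot_xx_rotf peval0 mulr0.
  by apply: eq_bigr => i _; rewrite !pevalM.
rewrite -[in X in X -> _]scaleN1r (sphintD hr) (sphintZ hr) mulN1r => /eqP.
by rewrite subr_eq0 => /eqP.
Qed.

(** As F is orthogonal to b /\ x, the integral of (F - G) . (b /\ x) is - K |b|^2 with K the
    constant on the left, while its absolute value is at most 3 r A times the sum of the |b_j|.
    Cauchy-Schwarz gives the second factor 3 in 9. *)
Lemma rot_estimate f (F : borel3 R -> 'rV[R]_3) G u b (A : R) :
  compatible_data x0 r p f F -> sol lam mu u ->
  (forall i, on_sphere (r ^+ 2) (ptang u i) (r ^- 2 *: tang G i - rotf b i)) ->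
  (forall i, \int[S]_y `|F y 0%R i - evc x0 (G i) y|%:E <= A%:E)%E ->
  2 / 3 * r ^+ 2 * sphint r (1 : D) * \sum_i `|b i| <= 9 * r * A.
Proof.
move=> [_ LF _ Fb] su uG hA.
set B := \sum_i `|b i|; set K := 2 / 3 * r ^+ 2 * sphint r (1 : D).
have B0 : 0 <= B by exact: sumr_ge0.
have mF i : measurable_fun setT (fun y : borel3 R => F y 0 i).
  by have /(Lfun_powint _ _ p1)[] := LF i.
pose E i (t : borel3 R) := F t 0 i - evc x0 (G i) t.
have mE i : measurable_fun setT (E i) by apply: measurable_funB => //; exact: measurable_evc.
pose k (t : borel3 R) := \sum_i E i t * evc x0 (rotf b i : D) t.
have mk : measurable_fun setT k.
  rewrite /k; under eq_fun do rewrite sum_ax.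
  have mi i : measurable_fun setT (fun t : borel3 R => E i t * evc x0 (rotf b i : D) t).
    by apply: measurable_funM => //; exact: measurable_evc.
  by apply: measurable_funD => //; apply: measurable_funD.
pose H (t : borel3 R) := r * B * \sum_i `|E i t|.
have mH : measurable_fun setT (fun t : borel3 R => \sum_i `|E i t|).
  under eq_fun do rewrite sum_ax.
  have mi i : measurable_fun setT (fun t : borel3 R => `|E i t|).
    exact: measurableT_comp.
  by apply: measurable_funD => //; apply: measurable_funD.
have rB0 : 0 <= r * B by rewrite mulr_ge0// ltW.
have kH : {ae S, forall y : borel3 R, `|k y| <= H y}.
  apply: (ae_impl (ae_sphere (D := D) x0 r)) => t ts.
  rewrite /H mulr_sumr (le_trans (ler_norm_sum _ _ _))//; apply: ler_sum => i _.
  by rewrite normrM mulrC ler_wpM2r// rotf_bound.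
have intk : (\int[S]_t `|k t|%:E <= (r * B * (3 * A))%:E)%E.
  apply: (@le_trans _ _ (\int[S]_t (H t)%:E)%E).
    apply: ae_ge0_le_integral => //.
    - by apply/measurable_EFinP; exact: measurableT_comp.
    - by move=> t _; rewrite lee_fin mulr_ge0// sumr_ge0.
    - by apply/measurable_EFinP; exact: measurable_funM.
    - by apply: (ae_impl kH) => t kt _; rewrite lee_fin.
  rewrite /H; under eq_integral do rewrite EFinM.
  have mHE : measurable_fun setT (fun t : borel3 R => (\sum_i `|E i t|)%:E).
    exact/measurable_EFinP.
  have H0 (t : borel3 R) : setT t -> (0 <= (\sum_i `|E i t|)%:E)%E.
    by move=> _; rewrite lee_fin sumr_ge0.
  rewrite ge0_integralZl//.
  rewrite [leRHS]EFinM lee_wpmul2l// ?lee_fin//.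
  under eq_integral do rewrite -sumEFin.
  rewrite ge0_integral_sum//; last first.
    by move=> i; apply/measurable_EFinP; exact: measurableT_comp.
  rewrite (_ : 3 * A = \sum_(i < 3) A); last by rewrite sumr_const card_ord mulr_natl.
  by rewrite -sumEFin; apply: lee_sum => i _; exact: hA.
have ik : S.-integrable setT (EFin \o k).
  apply/integrableP; split; first exact/measurable_EFinP.
  by apply: le_lt_trans intk (ltry _).
have ig := evc_integrable (pdot G (rotf b)).
have := Fb (\row_i b i).
have hE t : dot (F t) (cross (\row_i b i) (t - x0)) = k t + evc x0 (pdot G (rotf b)) t.
  rewrite (cross_rotf (D := D)) /dot /k /pdot evc_sum -big_split/=; apply: eq_bigr => i _.
  have -> : (fun j => (\row_i b i : 'rV[R]_3) 0 j) = b by apply/funext => j; rewrite mxE.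
  by rewrite mxE evcM /E mulrBl subrK.
under eq_integral do rewrite hE EFinD.
rewrite (integralD measurableT ik ig) (sphintE x0 hr) (sphint_reach su uG) => kE.
have kfin : (\int[S]_t (k t)%:E)%E \is a fin_num by exact: integrable_fin_num ik.
have le_k : (`|\int[S]_t (k t)%:E| <= (r * B * (3 * A))%:E)%E.
  apply: le_trans intk; exact: le_abse_integral (measurable_int _ ik).
move: kE le_k; rewrite -(fineK kfin) => /eqP; rewrite -EFinD eqe addr_eq0 => /eqP ->.
rewrite abse_EFin normrN lee_fin => hK.
have K0 : 0 <= K.
  by rewrite !mulr_ge0 ?ltW ?exprn_gt0 ?(sphint1 (D := D) hr).
have B2 : B ^+ 2 <= 3 * \sum_i b i ^+ 2.
  rewrite /B !sum_ax; move: (b o0) (b o1) (b o2) => b0 b1 b2.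
  rewrite -(real_normK (num_real b0)) -(real_normK (num_real b1)) -(real_normK (num_real b2)).
  by have := sqr_ge0 (`|b0| - `|b1|); have := sqr_ge0 (`|b0| - `|b2|);
    have := sqr_ge0 (`|b1| - `|b2|); nra.
have := le_trans (ler_norm _) hK; rewrite -/K => {}hK.
have : B * (K * B) <= B * (9 * r * A).
  have -> : B * (K * B) = K * B ^+ 2 by ring.
  apply: le_trans (ler_wpM2l K0 B2) _; rewrite mulrCA.
  by apply: le_trans (ler_wpM2l (ler0n _ 3) hK) _; rewrite le_eqVlt; apply/orP; left; apply/eqP; ring.
(* The common factor B cancels unless it is 0, in which case the bound only needs A >= 0. *)
have [B00|Bp] := eqVneq B 0; last by rewrite ler_pM2l// lt_neqAle eq_sym Bp B0.
move=> _; rewrite B00 mulr0; apply: mulr_ge0; first by rewrite mulr_ge0// ltW.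
by rewrite -lee_fin; apply: le_trans (hA o0); apply: integral_ge0 => t _; rewrite lee_fin.
Qed.

End approximation.

Section approximation.
Context {R : realType} {D : polyAlg R}.
Implicit Types (P Q : D) (u v G : 'I_3 -> D) (y : 'rV[R]_3).
Variables (x0 : 'rV[R]_3) (r p lam mu : R).
Hypotheses (hr : 0 < r) (p1 : 1 <= p) (hmu : 0 < mu) (hlam : 0 < 3 * lam + 2 * mu).
Local Notation S := (sphere_area x0 r).
Local Notation x := (@xx R D).
Local Notation ptang := (ptang_stress lam mu r).

(** G need not be tangential, but F is, so the normal part of G is that of G - F. Projecting G
    therefore costs the error a second time, whence the factor 2. *)
Lemma tangential_error (F : 'rV[R]_3) G u b y i : on_sph x0 r y ->
  dot F (y - x0) = 0 ->
  on_sphere (r ^+ 2) (ptang u i) (r ^- 2 *: tang G i - rotf b i) ->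
  `|F 0 i - evc x0 (ptang u i) y| <=
    2 * \sum_j `|F 0 j - evc x0 (G j) y| + r * \sum_j `|b j|.
Proof.
move=> ys Fy uG; have r0 := lt0r_neq0 hr; have hrot := rotf_bound (D := D) hr b i ys.
rewrite (evc_on_sphere uG ys) (evcB x0 (r ^- 2 *: _)) evcZ /tang evcB !evcM.
have -> : evc x0 (rho : D) y = r ^+ 2 by rewrite -ys; exact: peval_rho.
set T := \sum_j `|F 0 j - evc x0 (G j) y|.
have hT j : `|F 0 j - evc x0 (G j) y| <= T by rewrite /T (bigD1 j)//= lerDl sumr_ge0.
have Gx : evc x0 (pdot x G) y = - \sum_j (F 0 j - evc x0 (G j) y) * (y 0 j - x0 0 j).
  transitivity (evc x0 (pdot x G) y - dot F (y - x0)); first by rewrite Fy subr0.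
  by rewrite /pdot /dot !sum_ax !evcD !evcM !evc_xx !mxE; ring.
have hG : `|evc x0 (pdot x G) y| <= T * r.
  rewrite Gx normrN /T mulr_suml (le_trans (ler_norm_sum _ _ _))//; apply: ler_sum => j _.
  by rewrite normrM ler_wpM2l// on_sph_coord.
have h2 : `|r ^- 2 * (evc x0 (pdot x G) y * (y 0 i - x0 0 i))| <= T.
  rewrite !normrM ger0_norm ?invr_ge0 ?exprn_ge0 ?(ltW hr)//.
  rewrite ler_pdivrMl ?exprn_gt0// (_ : r ^+ 2 * T = T * r * r); last by ring.
  by rewrite ler_pM// on_sph_coord.
rewrite evc_xx (_ : _ - _ = (F 0 i - evc x0 (G i) y)
  + r ^- 2 * (evc x0 (pdot x G) y * (y 0 i - x0 0 i)) + evc x0 (rotf b i : D) y).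
  rewrite (le_trans (ler_normD _ _))// lerD// (le_trans (ler_normD _ _))//.
  by rewrite mulr_natl mulr2n lerD.
by field.
Qed.

Lemma approx_sol f (F : borel3 R -> 'rV[R]_3) : compatible_data x0 r p f F ->
  forall e, 0 < e -> exists u, [/\ sol lam mu u,
    (powint S p (fun t => f t - evc x0 (r^-1 *: pdot x u) t)%R < e%:E)%E &
    forall i, (powint S p (fun t => F t 0 i - evc x0 (ptang u i) t)%R < e%:E)%E].
Proof.
move=> compat e e0; have [Lf LF Fn _] := compat.
have p0 : 0 < p := lt_le_trans ltr01 p1.
have Sfin := sphere_area_fin (D := D) x0 hr.
have [mf If] : measurable_fun setT f /\ (powint S p f < +oo)%E by exact/(Lfun_powint _ _ p1).
have mIF i : measurable_fun setT (fun t : borel3 R => F t 0 i) /\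
    (powint S p (fun t : borel3 R => F t 0 i)%R < +oo)%E.
  exact/(Lfun_powint _ _ p1).
pose K : R := 2 / 3 * r ^+ 2 * sphint r (1 : D).
have K0 : 0 < K by rewrite !mulr_gt0 ?exprn_gt0 ?(sphint1 (D := D) hr).
pose sg := fine (S setT).
have sgE : S setT = sg%:E by rewrite fineK// ge0_fin_numE.
have sg0 : 0 <= sg by rewrite fine_ge0.
(* From [rot_estimate] with A = dl (sg + 1): the sum of the |b j| is at most C dl. *)
pose C := 9 * r * (sg + 1) / K.
have C0 : 0 <= C by rewrite divr_ge0 ?(ltW K0)// !mulr_ge0 ?(ltW hr)// addr_ge0.
pose c : R := 2 `^ p; have c0 : 0 <= c by exact: powR_ge0.
(* The factor of eta in the final bound: [powintD], the doubling and [powint_sum3] give the powers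
   of c, and the rotation gives the last term. *)
pose M := c * (c * (c * (c * 2 + 1)) + (r * C) `^ p * sg).
have M0 : 0 <= M.
  rewrite mulr_ge0// addr_ge0 ?mulr_ge0 ?powR_ge0//.
  by rewrite addr_ge0// mulr_ge0.
pose eta := e / (M + 1); have M1 : 0 < M + 1 by rewrite ltr_pwDr.
have eta0 : 0 < eta by rewrite divr_gt0.
have eta_e : eta <= e by rewrite ler_pdivrMr// ler_peMr ?(ltW e0)// lerDr.
have M_e : M * eta < e.
  by rewrite mulrA ltr_pdivrMr// mulrC ltr_pM2l// ltrDl.
(* This choice makes both terms of [integral_abs_le] multiples of dl, and the p-th power of the
   rotation bound a multiple of eta. *)
pose dl := eta `^ p^-1; have dl0 : 0 < dl by exact: powR_gt0.
have dlE : dl `^ p = eta by rewrite -powRrM mulVf ?gt_eqF// powRr1// ltW.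
have [f' ff'] := poly_dense (D := D) hr p1 mf If eta0.
have /fin_all_exists[G FG] : forall i, exists P : D,
    (powint S p (fun t : borel3 R => F t 0 i - evc x0 P t)%R < eta%:E)%E.
  by move=> i; have [mFi IFi] := mIF i; exact: (poly_dense (D := D) hr p1 mFi IFi eta0).
have [b [u [su uf uG]]] := reach_boundary hr hmu hlam f' G.
exists u; split=> // [|i].
  apply: le_lt_trans (lt_le_trans ff' _); last by rewrite lee_fin.
  apply: powint_le => //.
  - by apply: measurable_funB => //; exact: measurable_evc.
  - by apply: measurable_funB => //; exact: measurable_evc.
  - apply: (ae_impl (ae_sphere (D := D) x0 r)) => t ts.
    by rewrite (evc_on_sphere uf ts).
pose E j (t : borel3 R) := F t 0 j - evc x0 (G j) t.
have mE j : measurable_fun setT (E j).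
  by apply: measurable_funB; [case: (mIF j)|exact: measurable_evc].
have hE j : (powint S p (E j) <= eta%:E)%E by exact: ltW (FG j).
have hA j : (\int[S]_t `|E j t|%:E <= (dl * (sg + 1))%:E)%E.
  apply: le_trans (integral_abs_le _ p1 (mE j) dl0) _.
  rewrite [X in (_ * X + _)%E](_ : _ = sg%:E); last exact: sgE.
  rewrite -EFinM mulrDr mulr1 EFinD leeD2l// dlE.
  apply: (@le_trans _ _ ((dl / eta)%:E * eta%:E)%E).
    apply: lee_wpmul2l; last exact: hE.
    by rewrite lee_fin; apply: divr_ge0; exact: ltW.
  by rewrite -EFinM divfK// gt_eqF.
have hB : \sum_j `|b j| <= C * dl.
  have := rot_estimate hr p1 hmu hlam compat su uG hA; rewrite -/K => h.
  rewrite -(ler_pM2l K0) (le_trans h)// /C le_eqVlt; apply/orP; left; apply/eqP.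
  by field; rewrite gt_eqF.
pose Sm (t : borel3 R) := \sum_j `|E j t|.
have mSm : measurable_fun setT Sm.
  rewrite /Sm; under eq_fun do rewrite sum_ax.
  have mi j : measurable_fun setT (fun t : borel3 R => `|E j t|).
    exact: measurableT_comp.
  by apply: measurable_funD => //; apply: measurable_funD.
have m2S : measurable_fun setT (fun t => 2 * Sm t) by exact: measurable_funM.
have mcst : measurable_fun setT ((fun=> r * (C * dl)) : borel3 R -> R).
  exact: measurable_cst.
apply: (@le_lt_trans _ _ (powint S p (fun t => 2 * Sm t + r * (C * dl))%R)).
  apply: powint_le => //.
  - by apply: measurable_funB; [case: (mIF i)|exact: measurable_evc].
  - exact: measurable_funD.
  - have both : {ae S, forall t : borel3 R, on_sph x0 r t /\ dot (F t) (sphere_normal x0 r t) = 0}.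
      exact: ae_and (ae_sphere (D := D) x0 r) Fn.
    apply: (ae_impl both) => t [ts Ft].
    have Ft0 : dot (F t) (t - x0) = 0.
      apply/eqP; move: Ft; rewrite /sphere_normal dotZr => /eqP.
      by rewrite mulf_eq0 invr_eq0 gt_eqF.
    apply: le_trans (tangential_error ts Ft0 (uG i)) (le_trans _ (ler_norm _)).
    by rewrite lerD2l ler_wpM2l// ltW.
apply: le_lt_trans (powintD _ p1 m2S mcst) _.
apply: (@le_lt_trans _ _ (M * eta)%:E); last by rewrite lte_fin.
have -> : M * eta = c * (c * (c * (c * (eta + eta) + eta)) + (r * C) `^ p * eta * sg).
  by rewrite /M; ring.
rewrite EFinM lee_wpmul2l ?lee_fin// EFinD leeD//.
  rewrite powintZ// ger0_norm// EFinM lee_wpmul2l ?lee_fin//.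
  exact: (powint_sum3 p1 mE (ltW eta0) hE).
rewrite /powint integral_cst// [X in (_ * X)%E](_ : _ = sg%:E); last exact: sgE.
rewrite -EFinM lee_fin.
have rC0 : 0 <= r * C by rewrite mulr_ge0// ltW.
have rCd : 0 <= r * (C * dl) by rewrite mulrA mulr_ge0// ltW.
have E0 : `|r * (C * dl)| `^ p = (r * C) `^ p * eta.
  by rewrite (ger0_norm rCd) (mulrA r) -dlE; apply: powRM => //; exact: ltW.
by rewrite E0.
Qed.

End approximation.

Theorem theorem15 (R : realType) (lam mu : R) (hmu : 0 < mu)
  (hlam : 0 < 3 * lam + 2 * mu)
  (x0 : 'rV[R]_3) (r : R) (hr : 0 < r) (p : R) (hp : 1 <= p)
  (w : forall k : nat, 'I_(2 * k + 1)%N -> 'rV[R]_3 -> R)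
  (hw : forall k : nat, harmonic_basis k (w k))
  (e : nat -> elastic_index) (he : bijective e) :
  let P : nat -> 'rV[R]_3 -> 'rV[R]_3 := elastic_system lam mu w e in
  let lin1 (N : nat) (c : 'I_N -> R) (x : 'rV[R]_3) : R :=
    \sum_(n < N) c n * normal_part x0 r (P n) x in
  let lin2 (N : nat) (c : 'I_N -> R) (x : 'rV[R]_3) : 'rV[R]_3 :=
    \sum_(n < N) c n *: tangential_stress x0 r lam mu (P n) x in
  (forall (N : nat) (c : 'I_N -> R),
     compatible_data x0 r p (lin1 N c) (lin2 N c)) /\
  (forall (f : borel3 R -> R) (F : borel3 R -> 'rV[R]_3),
     compatible_data x0 r p f F ->
     forall eps : R, 0 < eps ->
     exists (N : nat) (c : 'I_N -> R),
       (data_norm x0 r p (fun x => f x - lin1 N c x)%R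
                         (fun x => F x - lin2 N c x)%R < eps%:E)%E).
Proof.
move=> P lin1 lin2; have p0 : 0 < p := lt_le_trans ltr01 hp.
have lin1E N (c : nat -> R) :
    lin1 N (fun n => c n) = evc x0 (r^-1 *: pdot (@xx R (mpolyAlg R)) (comb (centered_system lam mu x0 hw e) N c)).
  apply/funext => y; rewrite /lin1 /P; under eq_bigr do rewrite (elastic_systemE lam mu x0 hw e).
  exact: normal_part_comb.
have lin2E N (c : nat -> R) :
    lin2 N (fun n => c n) = evcv x0 (ptang_stress lam mu r (comb (centered_system lam mu x0 hw e) N c)).
  apply/funext => y; rewrite /lin2 /P; under eq_bigr do rewrite (elastic_systemE lam mu x0 hw e).
  exact: tangential_stress_comb.
split=> [N c|f F compat eps eps0].
  (* The finite family is extended by 0 to a sequence, the form used by [comb]. *)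
  have -> : c = fun n : 'I_N => oapp c 0 (insub (n : nat)).
    by apply/funext => n; rewrite valK.
  rewrite (lin1E N (fun m => oapp c 0 (insub m))) (lin2E N (fun m => oapp c 0 (insub m))).
  apply: compatible_sol => //; apply: sol_comb => n; exact: sol_centered_system.
(* Four norms share eps: that of the scalar datum and those of the three entries of F. *)
have e4 : 0 < (eps / 4) `^ p by rewrite powR_gt0// divr_gt0.
have [u [su fu Fu]] := approx_sol (D := mpolyAlg R) hr hp hmu hlam compat e4.
have [N [c uE]] := sol_comb_ex x0 hmu hlam hw he su; subst u.
exists N, (fun n => c n); rewrite lin1E lin2E /data_norm.
have small (g : borel3 R -> R) : (powint (sphere_area x0 r) p g < ((eps / 4) `^ p)%:E)%E ->
    ('N[sphere_area x0 r]_(p%:E) [EFin \o g] < (eps / 4)%:E)%E.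
  move=> Ig; rewrite Lnorm_powint.
  have gE : powint (sphere_area x0 r) p g = (fine (powint (sphere_area x0 r) p g))%:E.
    by rewrite fineK// ge0_fin_numE ?powint_ge0// (lt_trans Ig)// ltry.
  move: Ig; rewrite gE poweR_EFin !lte_fin => Ig.
  have -> : eps / 4 = ((eps / 4) `^ p) `^ p^-1.
    by rewrite -powRrM mulfV ?gt_eqF// powRr1// divr_ge0// ltW.
  by apply: gt0_ltr_powR; rewrite ?invr_gt0// nnegrE ?powR_ge0// fine_ge0// powint_ge0.
have -> : eps%:E = ((eps / 4)%:E + ((eps / 4)%:E + (eps / 4)%:E + (eps / 4)%:E))%E.
  by rewrite -!EFinD; congr EFin; field.
rewrite sum_ax; apply: lteD; first exact: small.
apply: lteD; first apply: lteD; apply: small;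
  by under [X in powint _ _ X]eq_fun do rewrite !mxE; exact: Fu.
Qed.
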